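(* Let $h \geq 2$ be an integer and let $$D_1 := B_1-\log h-\mathcal{L}_h(2h),\qquad D_2 := D_1^2 + D_1 - \zeta(2) - \sum_p\left(\frac{p^{1/h}-1}{p^{1+1/h}-p+p^{1/h}}\right)^2 .$$ Then, as the real variable $x\to\infty$, $$\sum_{\substack{n \leq x \\ n \in \mathcal{N}_h}} \omega_h^2(n) = \gamma_{0,h}\, x^{1/h}(\log\log x)^2 + (2D_1+1)\gamma_{0,h}\, x^{1/h}\log\log x + D_2\gamma_{0,h}\, x^{1/h} + O_h\!\left(\frac{x^{1/h}\log\log x}{\log x}\right).$$ Moreover, $$\sum_{\substack{n \leq x \\ n \in \mathcal{N}_h}} \omega_{h+1}^2(n) = \Bigg(\left(\mathcal{L}_h(h+1)-\mathcal{L}_h(h+2)\right)^2 + \mathcal{L}_h(h+1)-\mathcal{L}_h(h+2) - \sum_p\left(\frac{p^{1/h}-1}{p^{1+2/h}-p^{1+1/h}+p^{2/h}}\right)^2\Bigg)\gamma_{0,h}\, x^{1/h} + O_h\!\left(x^{1/(h+1)}(\log\log x)^2\right),$$ and for every integer $k>h+1$, $$\sum_{\substack{n \leq x \\ n \in \mathcal{N}_h}} \omega_k^2(n) = \Bigg(\left(\mathcal{L}_h(k)-\mathcal{L}_h(k+1)\right)^2 + \mathcal{L}_h(k)-\mathcal{L}_h(k+1) - \sum_p\left(\frac{p^{1/h}-1}{p^{(k+1)/h}-p^{k/h}+p^{(k+1-h)/h}}\right)^2\Bigg)\gamma_{0,h}\, x^{1/h} + O_{h,k}\!\left(x^{1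/(h+1)}\right).$$
   Context: For natural numbers $n,k$, $\omega_k(n)$ is the number of distinct primes $p$ with $p^k \,\|\, n$ (i.e. $p^k \mid n$ and $p^{k+1}\nmid n$); $\omega_k^2(n)=(\omega_k(n))^2$. For an integer $h\ge 2$, a natural number $n$ is $h$-full if every prime dividing $n$ has multiplicity at least $h$ in $n$; $\mathcal{N}_h$ is the set of $h$-full natural numbers (so $1 \in\mathcal{N}_h$). Sums and products over $p$ run over all primes. Define $$\gamma_{0,h} := \prod_p\left(1+\frac{p-p^{1/h}}{p^2(p^{1/h}-1)}\right),$$ and, for real $r>h$, the convergent sum $$\mathcal{L}_h(r) := \sum_p \frac{1}{p^{(r/h)-1}\left(p-p^{1-1/h}+1\right)}.$$ $\zeta$ is the Riemann zeta function, and $B_1$ is the Mertens constant $B_1 = \gamma + \sum_p\left(\log\left(1-\frac1p\right)+\frac1p\right)$, with $\gamma$ the Euler–Mascheroni constant. $O_h$ (resp. $O_{h,k}$) means that the implied constant depends only on $h$ (resp. on $h$ and $k$); the estimates are asymptotic, i.e. hold for all sufficiently large real $x$. *)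

(* Defs.v *)
From HB Require Import structures.
From mathcomp Require Import all_boot all_order all_algebra.
From mathcomp Require Import all_classical all_reals all_analysis.

Set Implicit Arguments.
Unset Strict Implicit.
Unset Printing Implicit Defensive.

Import Order.TTheory GRing.Theory Num.Theory.
Import numFieldNormedType.Exports.

Local Open Scope classical_set_scope.
Local Open Scope ring_scope.

(* The filter of neighbourhoods of +oo has no canonical filter_on structure in
   the library; the Landau notations require one. *)
Canonical pinfty_filter_on (R : numFieldType) :=
  FilterType (pinfty_nbhs R) (@filter_filter R (pinfty_nbhs R) _).

Definition omega_ (k n : nat) : nat :=
  count (fun p => (p ^ k %| n)%N && ~~ (p ^ k.+1 %| n)%N) (primes n).

Definition hfull (h n : nat) : bool :=
  (0 < n)%N && all (fun p => (h <= logn p n)%N) (primes n).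

(* The sums and products over all primes, the zeta series and the limit
   defining gamma are limits of real sequences, so each denotes the intended
   number only when the limit exists; they all converge for h >= 2
   (and r > h in Lh, s > 1 in zeta). *)

Definition prime_sum (R : realType) (f : nat -> R) : R :=
  limn (fun n => \sum_(0 <= p < n | prime p) f p).

Definition prime_prod (R : realType) (f : nat -> R) : R :=
  limn (fun n => \prod_(0 <= p < n | prime p) f p).

Definition gamma0 (R : realType) (h : nat) : R :=
  prime_prod (fun p =>
    1 + (p%:R - p%:R `^ h%:R^-1) / (p%:R ^+ 2 * (p%:R `^ h%:R^-1 - 1))).

Definition Lh (R : realType) (h : nat) (r : R) : R :=
  prime_sum (fun p =>
    (p%:R `^ (r / h%:R - 1) * (p%:R - p%:R `^ (1 - h%:R^-1) + 1))^-1).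

Definition zeta (R : realType) (s : R) : R :=
  limn (series (fun n : nat => (n.+1%:R `^ s)^-1)).

Definition euler_gamma (R : realType) : R :=
  limn (fun n : nat => series (@harmonic R) n - ln n%:R).

Definition mertens_B1 (R : realType) : R :=
  euler_gamma R + prime_sum (fun p => ln (1 - p%:R^-1) + p%:R^-1).

Definition hfull_omega2_sum (R : realType) (h k : nat) (x : R) : R :=
  \sum_(1 <= n < (Num.truncn x).+1 | hfull h n) (omega_ k n)%:R ^+ 2.

(* Main.v *)
(** An h-full number is uniquely a^h * b where every prime exponent of b lies
    strictly between h and 2h.  Summing over b, the h-full m <= y prime to one
    or two given primes number gamma0 * (product of w_p) * y^(1/h) with an
    error O(y^(1/(h+1))) that is uniform in these primes; here
    w_p = (1 - p^(-1/h)) / (1 - p^(-1/h) + p^(-1)).  Expanding omega_k^2 as a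
    sum over primes p and pairs p <> q with n = p^k m or n = p^k q^k m reduces
    everything to the sums of c_p = w_p p^(-k/h) and of c_p c_q.

    For k > h these sums converge.  For k = h, c_p = 1/p - O(1/p^2), and
    primes are grouped into the dyadic buckets [2^i, 2^(i+1)).  By Mertens'
    theorem the partial sums A_N of c_p over p < 2^N are H_N + c' + O(1/N), H_N
    being the harmonic numbers, so the sum over p q < 2^N is a discrete
    convolution which can be compared with that of 1/i: the latter is exactly
    H_N^2 - (1 + 1/4 + ... + 1/N^2), whence the term zeta(2).

    The constant in Mertens' theorem comes from Abel summation: with
    z = 2^(-d), the sum of z^N (A_(N+1) - A_N) over N is compared both with
    that of z^N / N, i.e. - ln (1 - z), and with the Euler product of
    zeta(1 + d), as d tends to 0. *)

(* All error terms have one source. At y = x/p^k and y = x/(p^k q^k) the counting error y^(1/(h+1))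
   leaves x^(1/(h+1)) times sums of p^(-k/(h+1)) and (pq)^(-k/(h+1)). For k > h+1 these converge.
   For k = h+1 they are sums of 1/p, whence (log log x)^2. For k = h they grow like a power, and
   only the restriction to pq <= X = x^(1/h) keeps them at X^(1/(h+1)) log log x / log x; since
   1/(h+1) + 1/(h(h+1)) = 1/h, the product has exactly the size of the stated error. Dyadic
   resolution is fine enough for this: if 2^N <= X < 2^(N+1), then log N and log(N+1) differ by
   O(1/log x), and squaring makes that O(log log x / log x). The term -log h in D1 records that log
   X = (log x)/h. Counting in powers of 2 brings in a log log 2, which cancels against the same term
   in the constant of the dyadic Mertens theorem. *)
Require Import Defs.
From HB Require Import structures.
From mathcomp Require Import all_boot all_order all_algebra.
From mathcomp Require Import all_classical all_reals all_analysis.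
From mathcomp Require Import ring lra zify.

Import Order.TTheory GRing.Theory Num.Theory.
Import numFieldNormedType.Exports.

Local Open Scope classical_set_scope.
Local Open Scope ring_scope.

(* [lra] does not treat the inverse of a compound expression as an atom. *)
Ltac is_closed_inverse x :=
  match x with
  | GRing.natmul _ ?n => let _ := constr:(ltac:(clear; exact n) : nat) in idtac
  end.
Ltac abstract_inverse T x :=
  assert_fails (idtac; is_closed_inverse x);
  let i := fresh "i" in set (i := @GRing.inv T x) in *;
  repeat match goal with
  | |- context [ @GRing.inv ?T' ?x' ] =>
      unify x x'; change (@GRing.inv T' x') with i in *
  | _ : context [ @GRing.inv ?T' ?x' ] |- _ =>
      unify x x'; change (@GRing.inv T' x') with i in *
  end;
  clearbody i.
Ltac abstract_inverses :=
  repeat match goal with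
  | |- context [ @GRing.inv ?T ?x ] => abstract_inverse T x
  | _ : context [ @GRing.inv ?T ?x ] |- _ => abstract_inverse T x
  end.
Ltac lrai := intros; abstract_inverses; lra.

(** * Convergence with rates and sums over primes *)

(** Every constant here is a [limn], so a bound on it is of use only together with convergence. The
    Cauchy criterion gives both, and the bound [t n] survives the passage to the limit. *)
Lemma cvg_of_tail (R : realType) (u t : nat -> R) (n0 : nat) :
  (forall n m, (n0 <= n)%N -> (n <= m)%N -> `|u m - u n| <= t n) ->
  (forall e, 0 < e -> exists2 n, (n0 <= n)%N & t n <= e) ->
  cvgn u /\ forall n, (n0 <= n)%N -> `|limn u - u n| <= t n.
Proof.
move=> ut t0.
have cu : cvgn u.
  apply/cauchy_cvgP/cauchy_exP => e e0.
  have [n n0n tn] := t0 (e / 2) ltac:(lra).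
  exists (u n); exists n => // m /= nm.
  rewrite /ball /= distrC; have := ut n m n0n nm; lra.
split=> // n n0n.
have cn : (fun m => `|u m - u n|) @ \oo --> `|limn u - u n|.
  by apply: cvg_norm; apply: cvgB => //; exact: cvg_cst.
rewrite -(cvg_lim _ cn) //.
apply: limr_le; first by apply/cvg_ex; exists `|limn u - u n|.
by exists n => // m /= nm; apply: ut.
Qed.

Lemma invn_small (R : realType) (C e : R) (n0 : nat) : 0 < e ->
  exists2 n, (n0 <= n)%N & C / n.+1%:R <= e.
Proof.
move=> e0; exists (n0 + Num.truncn (`|C| / e))%N; first exact: leq_addr.
have := truncnS_gt (`|C| / e); rewrite ltr_pdivrMr // => h.
rewrite ler_pdivrMr ?ltr0n // mulrC.
apply: (le_trans (ler_norm C)); apply/ltW/(lt_le_trans h).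
by rewrite ler_wpM2r ?ler_nat ?ltnS ?leq_addl // ltW.
Qed.

Lemma divr_mul_succ (R : realType) (c x : R) :
  0 < x -> c / (x * (x + 1)) = c / x - c / (x + 1).
Proof. by move=> x0; field; apply/andP; split; apply: lt0r_neq0; lra. Qed.

(** C/(n(n+1)) = C/n - C/(n+1) telescopes, so increments of this size leave a tail of at most
    C/n. *)
Lemma cvg_rate (R : realType) (u : nat -> R) (C : R) :
  (forall n, (0 < n)%N -> `|u n.+1 - u n| <= C / (n%:R * n.+1%:R)) ->
  cvgn u /\ forall n, (0 < n)%N -> `|u n - limn u| <= C / n%:R.
Proof.
move=> uC.
have C0 : 0 <= C.
  have := uC 1%N isT; rewrite mul1r ler_pdivlMr //.
  by apply: le_trans; rewrite mulr_ge0.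
have step n k : (0 < n)%N -> `|u (n + k)%N - u n| <= C / n%:R - C / (n + k)%:R.
  move=> n0; elim: k => [|k IH]; first by rewrite addn0 !subrr normr0.
  rewrite addnS -(subrKA (u (n + k)%N)) (le_trans (ler_normD _ _)) //.
  have := uC (n + k)%N ltac:(lia).
  have -> : C / ((n + k)%:R * (n + k).+1%:R) =
            C / (n + k)%:R - C / (n + k).+1%:R.
    by rewrite -natr1 divr_mul_succ ?ltr0n ?addn_gt0 ?n0.
  lrai.
have [||cu H] := @cvg_of_tail R u (fun n => C / n%:R) 1.
- move=> n m n0 nm; rewrite -(subnKC nm); apply: (le_trans (step _ _ n0)).
  by rewrite lerBlDr lerDl divr_ge0.
- by move=> e e0; have [n _ ?] := invn_small R C e 0 e0; exists n.+1.
by split=> // n n0; rewrite distrC; apply: H.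
Qed.

Lemma le_of_le_inv (R : realType) (a b C : R) (n0 : nat) :
  (forall n, (n0 <= n)%N -> a <= b + C / n.+1%:R) -> a <= b.
Proof.
move=> H; rewrite leNgt; apply/negP => ba.
have [n n0n Cn] := invn_small R C ((a - b) / 2) n0 ltac:(lra).
by have := H n n0n; lrai.
Qed.

Lemma ln_ge_subV (R : realType) (x : R) : 0 < x -> 1 - x^-1 <= ln x.
Proof.
move=> x0; have xV : 0 < x^-1 by rewrite invr_gt0.
have := @le_ln1Dx R (x^-1 - 1) ltac:(lrai).
by rewrite addrC subrK lnV ?posrE //; lrai.
Qed.

Lemma ln_le_sub1 (R : realType) (x : R) : 0 < x -> ln x <= x - 1.
Proof. by move=> x0; have := @le_ln1Dx R (x - 1) ltac:(lra); rewrite addrC subrK. Qed.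

Lemma powR_expR (R : realType) (x a : R) : 0 < x -> x `^ a = expR (a * ln x).
Proof. by move=> x0; rewrite /powR gt_eqF. Qed.

Lemma ler_powRl (R : realType) (x y a : R) :
  0 <= a -> 0 <= x -> x <= y -> x `^ a <= y `^ a.
Proof.
by move=> a0 x0 xy; apply: (ge0_ler_powR a0) => //; rewrite nnegrE // (le_trans x0).
Qed.

(** Replaces comparison with an integral: n^(-d) is (n+1)^(-d) exp(d ln((n+1)/n)), and exp u >= 1 +
    u with ln((n+1)/n) >= 1/(n+1) suffices. Summed over n, the right-hand side telescopes. *)
Lemma powRNDiff_ge (R : realType) (n : nat) (d : R) : (0 < n)%N -> 0 <= d ->
  d * n.+1%:R `^ (- (1 + d)) <= n%:R `^ (- d) - n.+1%:R `^ (- d).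
Proof.
move=> n0 d0; have nR : (0 : R) < n%:R by rewrite ltr0n.
have n1R : (0 : R) < n.+1%:R by rewrite ltr0n.
have -> : n%:R `^ (- d) = n.+1%:R `^ (- d) * expR (d * ln (n.+1%:R / n%:R)) :> R.
  by rewrite !powR_expR // -expRD ln_div ?posrE //; congr expR; lra.
rewrite opprD powRD; last by rewrite (gt_eqF n1R) implybT.
rewrite powR_inv1 ?(ltW n1R) //.
have h1 := expR_ge1Dx (d * ln (n.+1%:R / n%:R)).
have := @ln_ge_subV R (n.+1%:R / n%:R) (divr_gt0 n1R nR).
have -> : 1 - (n.+1%:R / n%:R)^-1 = n.+1%:R^-1 :> R.
  rewrite invf_div -natr1; field.
  by rewrite gt_eqF // ltr_wpDl // ltW.
move=> /(ler_wpM2l d0) h2; have := powR_ge0 n.+1%:R (- d).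
move: h1; set A := _ `^ _; set E := expR _ => h A0.
have : A * (1 + d / n.+1%:R) <= A * E by rewrite ler_wpM2l //; lrai.
lrai.
Qed.

Lemma powRNDiff_le (R : realType) (n : nat) (d : R) : (0 < n)%N -> 0 <= d ->
  n%:R `^ (- d) - n.+1%:R `^ (- d) <= d * n%:R `^ (- (1 + d)).
Proof.
move=> n0 d0; have nR : (0 : R) < n%:R by rewrite ltr0n.
have n1R : (0 : R) < n.+1%:R by rewrite ltr0n.
have -> : n.+1%:R `^ (- d) = n%:R `^ (- d) * expR (- d * ln (n.+1%:R / n%:R)) :> R.
  by rewrite !powR_expR // -expRD ln_div ?posrE //; congr expR; lra.
rewrite opprD powRD; last by rewrite (gt_eqF nR) implybT.
rewrite powR_inv1 ?(ltW nR) //.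
have h1 := expR_ge1Dx (- d * ln (n.+1%:R / n%:R)).
have := @ln_le_sub1 R (n.+1%:R / n%:R) (divr_gt0 n1R nR).
have -> : n.+1%:R / n%:R - 1 = n%:R^-1 :> R.
  by rewrite -natr1; field; rewrite gt_eqF.
move=> /(ler_wpM2l d0) h2; have := powR_ge0 n%:R (- d).
move: h1; set A := _ `^ _; set E := expR _ => h A0.
have : A * (1 - d / n%:R) <= A * E by rewrite ler_wpM2l //; lrai.
lrai.
Qed.

Lemma sum_powR_tail (R : realType) (M K : nat) (d : R) : (0 < M)%N -> 0 < d ->
  \sum_(M.+1 <= n < K) n%:R `^ (- (1 + d)) <= d^-1 * M%:R `^ (- d).
Proof.
move=> M0 d0; rewrite ler_pdivlMl //.
have [KM|MK] := leqP K M.+1; first by rewrite big_geq // mulr0 powR_ge0.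
case: K MK => // K MK; rewrite mulr_sumr big_add1 /=.
have : \sum_(M <= n < K) d * n.+1%:R `^ (- (1 + d)) <=
       \sum_(M <= n < K) - (n.+1%:R `^ (- d) - n%:R `^ (- d)).
  rewrite !big_seq; apply: ler_sum => n; rewrite mem_index_iota => /andP[Mn _].
  by rewrite opprB; apply: powRNDiff_ge; [lia|apply: ltW].
rewrite sumrN telescope_sumr; last lia.
by move/le_trans; apply; rewrite opprB lerBlDr lerDl powR_ge0.
Qed.

Lemma powRN_small (R : realType) (C d e : R) : 0 < d -> 0 < e ->
  exists2 n, (0 < n)%N & C * n%:R `^ (- d) <= e.
Proof.
move=> d0 e0; set y := ((`|C| + 1) / e) `^ d^-1.
exists (Num.truncn y).+1 => //; set n := _.+1.
have C0 : 0 < `|C| + 1 by rewrite ltr_wpDl.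
have y0 : 0 < y by rewrite powR_gt0 // divr_gt0.
have yn : y <= n%:R by apply/ltW/truncnS_gt.
have : y `^ d <= n%:R `^ d by apply: ler_powRl => //; exact: ltW.
rewrite /y -powRrM mulVf ?gt_eqF // powRr1; last exact/ltW/divr_gt0.
have nd : 0 < n%:R `^ d :> R by rewrite powR_gt0 // ltr0n.
rewrite ler_pdivrMr // [_ * e]mulrC => h; rewrite powRN ler_pdivrMr //.
by apply: (le_trans _ h); rewrite (le_trans (ler_norm C)) // lerDl.
Qed.

(** Dominates the primes by all integers above M. The partial sum up to [M.+1] contains p = M, so
    the tail starts at M + 1, as in [sum_powR_tail]. *)
Lemma prime_sum_tail (R : realType) (f : nat -> R) (C d : R) : 0 < d ->
  (forall p, prime p -> `|f p| <= C * p%:R `^ (- (1 + d))) ->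
  cvgn (fun M => \sum_(0 <= p < M | prime p) f p) /\
  forall M, (0 < M)%N ->
    `|prime_sum f - \sum_(0 <= p < M.+1 | prime p) f p| <= C / d * M%:R `^ (- d).
Proof.
move=> d0 fC.
have C0 : 0 <= C.
  have := fC 2%N isT => /(le_trans (normr_ge0 _)).
  by rewrite pmulr_lge0 ?powR_gt0.
have tail n m : (0 < n)%N -> (n <= m)%N ->
  `|\sum_(0 <= p < m.+1 | prime p) f p - \sum_(0 <= p < n.+1 | prime p) f p|
  <= C / d * n%:R `^ (- d).
  move=> n0 nm; rewrite (@big_cat_nat _ _ _ n.+1 0 m.+1) //= addrAC subrr add0r.
  apply: (le_trans (ler_norm_sum _ _ _)).
  apply: (@le_trans _ _ (\sum_(n.+1 <= p < m.+1) C * p%:R `^ (- (1 + d)))).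
    rewrite big_mkcond; apply: ler_sum => p _.
    by case: ifP => [/fC//|_]; rewrite mulr_ge0 ?powR_ge0.
  by rewrite -mulr_sumr -mulrA ler_wpM2l // sum_powR_tail.
have [||cu H] := @cvg_of_tail R
  (fun M => \sum_(0 <= p < M.+1 | prime p) f p) (fun n => C / d * n%:R `^ (- d)) 1.
- by move=> n m n0 nm; apply: tail.
- by move=> e e0; have [n n0 h] := powRN_small R (C / d) d e d0 e0; exists n.
have cS : cvgn (fun M => \sum_(0 <= p < M | prime p) f p).
  by apply/cvg_ex; case/cvg_ex: cu => l ul; exists l; rewrite -cvg_shiftS.
split=> // M M0.
have -> : prime_sum f = limn (fun M => \sum_(0 <= p < M.+1 | prime p) f p).
  apply/esym/cvg_lim => //.
  by rewrite (@cvg_shiftS _ (fun M => \sum_(0 <= p < M | prime p) f p)).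
exact: H.
Qed.

(** * Euler products of nonnegative multiplicative functions *)

(** One reindexing serves several bijections: splitting a prime power off a smooth number, n = a^h
    b, and, with [I] = 1 and a dummy first index, the multiples n = p m and n = p^k m. *)
Lemma sum_reindex_pairs (V : nmodType) (M I K : nat) (P : pred nat)
    (Q : nat -> nat -> bool) (phi : nat -> nat -> nat) (F : nat -> V) :
  (forall n, (n < M)%N -> P n ->
     exists i m, [/\ (i < I)%N, (m < K)%N, Q i m & phi i m = n]) ->
  (forall i m, (i < I)%N -> (m < K)%N -> Q i m ->
     (phi i m < M)%N && P (phi i m)) ->
  (forall i m i' m', Q i m -> Q i' m' -> phi i m = phi i' m' ->
     i = i' /\ m = m') ->
  \sum_(0 <= n < M | P n) F n =
  \sum_(0 <= i < I) \sum_(0 <= m < K | Q i m) F (phi i m).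
Proof.
move=> Psur Pimg inj.
under [RHS]eq_bigr => i _ do rewrite -big_filter.
rewrite -big_allpairs_dep -[LHS]big_filter; apply: perm_big; apply: uniq_perm.
- by rewrite filter_uniq // iota_uniq.
- apply: allpairs_uniq_dep => [|i _|]; first exact: iota_uniq.
    by rewrite filter_uniq // iota_uniq.
  move=> x y /allpairsPdep[i [m [_ + ->]]] /allpairsPdep[i' [m' [_ + ->]]] /=.
  by rewrite !mem_filter => /andP[q _] /andP[q' _] /(inj _ _ _ _ q q')[-> ->].
- move=> n; rewrite mem_filter mem_index_iota; apply/andP/allpairsPdep.
    case=> Pn nM; have [i [m [iI mK q <-]]] := Psur n nM Pn.
    by exists i, m; rewrite mem_filter !mem_index_iota q.
  case=> i [m [+ + ->]]; rewrite mem_filter !mem_index_iota => iI /andP[q mK].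
  by have /andP[] := Pimg i m iI mK q.
Qed.

(** [A] is tested only at positive exponents, so 1 always belongs. Both the h-full numbers ([A] =
    [leq h]) and the cofactors b are instances, and [full_setMp] makes both indicators
    multiplicative. *)
Definition full_set (A : pred nat) (n : nat) : bool :=
  (0 < n)%N && all (fun p => A (logn p n)) (primes n).

Definition smooth (N n : nat) : bool := (0 < n)%N && all (fun p => p < N)%N (primes n).

Lemma full_setMp (A : pred nat) (p i m : nat) : prime p -> coprime p m ->
  full_set A (p ^ i * m) = ((i == 0)%N || A i) && full_set A m.
Proof.
move=> pp cpm; have p0 := prime_gt0 pp.
have [->|m0] := posnP m; first by rewrite /full_set muln0 andbF.
rewrite /full_set muln_gt0 expn_gt0 p0 m0 /=.
have lp : logn p (p ^ i * m) = i.
  by rewrite lognM ?expn_gt0 ?p0 // pfactorK // logn_coprime ?addn0.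
have lq q : prime q -> q != p -> logn q (p ^ i * m) = logn q m.
  move=> pq qp; rewrite lognM ?expn_gt0 ?p0 // lognX logn_prime //.
  by rewrite (negbTE qp) muln0.
have npm : p \notin primes m by rewrite mem_primes pp m0 /= -prime_coprime.
apply/allP/andP => [H|[iA /allP H] q].
  split.
    have [//|i0 /=] := posnP i; rewrite -{1}lp; apply: H.
    by rewrite mem_primes pp muln_gt0 expn_gt0 p0 m0 dvdn_mulr // dvdn_exp.
  apply/allP => q qm; rewrite -lq.
  - by apply: H; rewrite primesM ?expn_gt0 ?p0 // qm orbT.
  - by move: qm; rewrite mem_primes => /and3P[].
  - by apply: contraNneq npm => <-.
rewrite primesM ?expn_gt0 ?p0 //; have [qp|qp] := eqVneq q p.
  rewrite qp (negbTE npm) orbF lp => ppi; case/orP: iA => // /eqP i0.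
  by rewrite i0 in ppi.
move=> Hq; have : q \in primes m.
  case/orP: Hq => //; have [->//|i0] := posnP i.
  by rewrite primesX // primes_prime // inE (negbTE qp).
move=> qm; rewrite lq ?H //; by move: qm; rewrite mem_primes => /and3P[].
Qed.

Lemma smooth_coprime (N m : nat) : prime N -> smooth N m -> coprime N m.
Proof.
move=> pN /andP[m0 /allP H]; rewrite prime_coprime //; apply/negP => Nm.
by have := H N; rewrite mem_primes pN m0 Nm ltnn => /(_ isT).
Qed.

Lemma smoothSp (N i m : nat) : prime N -> smooth N m -> smooth N.+1 (N ^ i * m).
Proof.
move=> pN /andP[m0 /allP H]; have N0 := prime_gt0 pN.
rewrite /smooth muln_gt0 expn_gt0 N0 m0 /=; apply/allP => q.
rewrite primesM ?expn_gt0 ?N0 // => /orP[|/H]; last by lia.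
have [->//|i0] := posnP i.
by rewrite primesX // primes_prime // inE => /eqP ->.
Qed.

Lemma smoothS (N n : nat) : ~~ prime N -> smooth N.+1 n = smooth N n.
Proof.
move=> pN; rewrite /smooth; congr (_ && _); apply: eq_in_all => q.
rewrite mem_primes ltnS [(q <= N)%N]leq_eqVlt => /and3P[pq _ _].
by have [qN|//] := eqVneq q N; rewrite -qN pq in pN.
Qed.

Lemma smooth0 (n : nat) : smooth 0 n = (n == 1%N).
Proof.
have [->//|n1] := eqVneq n 1%N.
apply/negP => /andP[n0 H]; case E: (primes n) H => [|//] _.
by move/eqP: E; rewrite primes_eq0; lia.
Qed.

Lemma smooth_lt (N n : nat) : (0 < n)%N -> (n < N)%N -> smooth N n.
Proof.
move=> n0 nN; rewrite /smooth n0; apply/allP => p.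
by rewrite mem_primes => /and3P[_ _ /dvdn_leq]; move=> /(_ n0); lia.
Qed.

Lemma smooth_split (N n : nat) : prime N -> smooth N.+1 n ->
  exists i m, [/\ (i < n)%N, (0 < m <= n)%N, smooth N m & (N ^ i * m = n)%N].
Proof.
move=> pN /andP[n0 /allP H].
have [m cNm nE] := pfactor_coprime pN n0.
have m0 : (0 < m)%N by move: n0; rewrite nE muln_gt0 => /andP[].
exists (logn N n), m; split.
- by rewrite ltn_logl.
- by rewrite m0 {1}nE leq_pmulr // expn_gt0 prime_gt0.
- rewrite /smooth m0 /=; apply/allP => q qm.
  have /H : q \in primes n.
    by rewrite nE primesM ?expn_gt0 ?(prime_gt0 pN) // qm.
  rewrite ltnS leq_eqVlt => /orP[/eqP qN|//]; move: qm.
  by rewrite qN mem_primes m0 pN /= => Nm; move: cNm; rewrite prime_coprime // Nm.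
- by rewrite mulnC -nE.
Qed.

Lemma pfactor_mul_inj (p i m i' m' : nat) : prime p -> (0 < m)%N -> (0 < m')%N ->
  coprime p m -> coprime p m' -> (p ^ i * m = p ^ i' * m')%N -> i = i' /\ m = m'.
Proof.
move=> pp m0 m0' c c' E; have p0 := prime_gt0 pp.
have L j k : (0 < k)%N -> coprime p k -> logn p (p ^ j * k) = j.
  by move=> k0 ck; rewrite lognM ?expn_gt0 ?p0 // pfactorK // logn_coprime ?addn0.
have ii : i = i' by rewrite -(L i m) // E L.
by split=> //; move/eqP: E; rewrite ii eqn_pmul2l ?expn_gt0 ?p0 // => /eqP.
Qed.

Section EulerProduct.
Variables (R : realType) (g : nat -> R).
Hypothesis g_ge0 : forall n, 0 <= g n.
Hypothesis g1 : g 1 = 1.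
Hypothesis gM : forall p i m, prime p -> coprime p m ->
  g (p ^ i * m)%N = g (p ^ i)%N * g m.

(** Induction on N: for N prime, an (N+1)-smooth number is N^i m with m N-smooth, and dropping the
    constraint N^i m < M only enlarges a sum of nonnegative terms. *)
Lemma euler_upper (F : nat -> R) (N M : nat) :
  (forall p J, prime p -> \sum_(0 <= j < J) g (p ^ j)%N <= F p) ->
  \sum_(0 <= n < M | smooth N n) g n <= \prod_(0 <= p < N | prime p) F p.
Proof.
move=> gF; elim: N M => [|N IH] M.
  rewrite big_geq // (eq_bigl _ _ smooth0) big_mkcond /=.
  case: M => [|[|M]]; [by rewrite big_geq|by rewrite big_nat1|].
  by rewrite big_nat_recl // big_nat_recl // big1 ?addr0 ?add0r ?g1 //=.
have F0 p : prime p -> 0 <= F p.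
  by move=> /(gF p 0%N); rewrite big_geq.
rewrite [leRHS]big_mkcond big_nat_recr //= -big_mkcond /=.
case: ifPn => [pN|pN]; last by rewrite mulr1 (eq_bigl _ _ (fun n => smoothS N n pN)).
rewrite (@sum_reindex_pairs _ M M M _ (fun i m => smooth N m && (N ^ i * m < M)%N)
  (fun i m => N ^ i * m)%N).
- apply: (@le_trans _ _ (\sum_(0 <= i < M) g (N ^ i)%N * \prod_(0 <= p < N | prime p) F p)).
    apply: ler_sum => i _.
    rewrite [leLHS](eq_bigr (fun m => g (N ^ i)%N * g m)); last first.
      by move=> m /= /andP[sm _]; rewrite gM // smooth_coprime.
    rewrite -mulr_sumr ler_wpM2l //; apply: le_trans (IH M).
    by rewrite big_mkcondr; apply: ler_sum => n _; case: ifP.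
  rewrite -mulr_suml mulrC ler_wpM2l ?gF //.
  by apply: prodr_ge0 => p /F0.
- move=> n nM /(smooth_split _ _ pN)[i [m [im mn sm E]]]; exists i, m.
  by split=> //; [lia|lia|rewrite sm E].
- by move=> i m _ _ /andP[sm ->]; rewrite smoothSp.
- move=> i m i' m' /andP[s _] /andP[s' _]; apply: pfactor_mul_inj => //.
  + by case/andP: s.
  + by case/andP: s'.
  + exact: smooth_coprime.
  + exact: smooth_coprime.
Qed.

Lemma euler_lower (N J : nat) : exists M,
  \prod_(0 <= p < N | prime p) \sum_(0 <= j < J) g (p ^ j)%N
  <= \sum_(0 <= n < M | smooth N n) g n.
Proof.
elim: N => [|N [M IH]].
  exists 2%N; rewrite big_geq // (eq_bigl _ _ smooth0) big_mkcond /=.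
  by rewrite big_nat_recl // big_nat1 /= add0r g1.
rewrite big_mkcond big_nat_recr //= -big_mkcond /=.
case: ifPn => [pN|pN]; last first.
  by exists M; rewrite mulr1 (eq_bigl _ _ (fun n => smoothS N n pN)).
have N0 := prime_gt0 pN.
(* Each N^i m with i < J and m < M is below this bound; [P] singles out exactly these products among
   the smooth n. *)
exists (N ^ J * M).+1.
pose P n := [&& smooth N.+1 n, (logn N n < J)%N & (n %/ N ^ logn N n < M)%N].
apply: (@le_trans _ _ (\sum_(0 <= n < (N ^ J * M).+1 | P n) g n)); last first.
  by rewrite /P [leLHS]big_mkcondr; apply: ler_sum => n _; case: ifP.
rewrite [leRHS](@sum_reindex_pairs _ _ J M _ (fun i m => smooth N m)
  (fun i m => N ^ i * m)%N).
- rewrite mulrC; apply: (@le_trans _ _ (\sum_(0 <= i < J) g (N ^ i)%N *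
      \sum_(0 <= n < M | smooth N n) g n)).
    by rewrite -mulr_suml ler_wpM2l // sumr_ge0.
  apply: ler_sum => i _.
  rewrite [leRHS](eq_bigr (fun m => g (N ^ i)%N * g m)) -?mulr_sumr //.
  by move=> m sm; rewrite gM // smooth_coprime.
- move=> n nM /and3P[/(smooth_split _ _ pN)[i [m [im mn sm E]]]].
  have L : logn N n = i.
    rewrite -E lognM ?expn_gt0 ?N0 ?pfactorK //; last by lia.
    by rewrite logn_coprime ?addn0 // smooth_coprime.
  rewrite L -E mulKn ?expn_gt0 ?N0 // => iJ mM.
  by exists i, m.
- move=> i m iJ mM sm; have m0 : (0 < m)%N by case/andP: sm.
  have L : logn N (N ^ i * m) = i.
    rewrite lognM ?expn_gt0 ?N0 ?pfactorK //.
    by rewrite logn_coprime ?addn0 // smooth_coprime.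
  rewrite /P L mulKn ?expn_gt0 ?N0 // smoothSp // iJ mM !andbT ltnS.
  by rewrite leq_mul ?(ltnW mM) // leq_pexp2l // ltnW.
- move=> i m i' m' s s'; apply: pfactor_mul_inj => //.
  + by case/andP: s.
  + by case/andP: s'.
  + exact: smooth_coprime.
  + exact: smooth_coprime.
Qed.

Lemma euler_partial_ge (F : nat -> R) (N : nat) :
  (forall p J, prime p -> \sum_(0 <= j < J) g (p ^ j)%N <= F p) ->
  \sum_(1 <= n < N) g n <= \prod_(0 <= p < N | prime p) F p.
Proof.
move=> gF; apply: le_trans (@euler_upper F N N gF).
rewrite big_add1 /=; case: N => [|N]; first by rewrite !big_geq.
rewrite [leRHS]big_mkcond [leRHS]big_nat_recl //= add0r.
rewrite !big_mkord; apply: ler_sum => i _.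
by rewrite smooth_lt // ltnS ltn_ord.
Qed.

(** Together with [euler_partial_ge] this replaces the identity between sum and product: for
    nonnegative terms the two inequalities on finite truncations suffice, and no infinite sum is
    rearranged. The product of truncated local sums is bounded first; J tends to infinity last. *)
Lemma euler_prod_le (F : nat -> R) (B : R) (N : nat) :
  (forall p, prime p -> \sum_(0 <= j < J) g (p ^ j)%N @[J --> \oo] --> F p) ->
  (forall M, \sum_(1 <= n < M) g n <= B) ->
  \prod_(0 <= p < N | prime p) F p <= B.
Proof.
move=> gF gB.
have c : \prod_(0 <= p < N | prime p) \sum_(0 <= j < J) g (p ^ j)%N @[J --> \oo]
     --> \prod_(0 <= p < N | prime p) F p.
  elim: N => [|N IH].
    under eq_fun do rewrite big_geq //; rewrite big_geq //; exact: cvg_cst.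
  rewrite (big_mkcond _ F) big_nat_recr //= -big_mkcond.
  under eq_fun do rewrite big_mkcond big_nat_recr //= -big_mkcond /=.
  apply: cvgM => //; case: ifP => [/gF //|_]; exact: cvg_cst.
rewrite -(cvg_lim _ c) //; apply: limr_le; first by apply/cvg_ex; eexists; exact: c.
apply: nearW => J; have [M h] := euler_lower N J; apply: (le_trans h).
apply: le_trans (gB M); rewrite big_mkcond big_add1.
case: M {h} => [|M]; first by rewrite !big_geq.
rewrite big_nat_recl //= add0r !big_mkord; apply: ler_sum => i _.
by case: ifP.
Qed.
End EulerProduct.

(** * Chebyshev and Mertens estimates *)

Lemma primorial_dvd (a b X : nat) :
  (forall p, (a <= p < b)%N -> prime p -> (p %| X)%N) ->
  (\prod_(a <= p < b | prime p) p %| X)%N.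
Proof.
elim: b => [|b IH] H; first by rewrite big_geq.
have [ab|ab] := leqP a b; last by rewrite big_geq.
rewrite big_mkcond big_nat_recr //= -big_mkcond /=.
have IHb : (\prod_(a <= p < b | prime p) p %| X)%N.
  by apply: IH => p /andP[ap pb]; apply: H; rewrite ap ltnW.
case: ifPn => [pb|_]; last by rewrite muln1.
rewrite Gauss_dvd ?IHb ?H ?ab ?leqnn // big_seq_cond.
elim/big_rec: _ => [|p x]; first exact: coprime1n.
rewrite mem_index_iota coprimeMl => /andP[/andP[_ pltb] pp] ->; rewrite andbT.
by rewrite prime_coprime // dvdn_prime2 //; lia.
Qed.

Lemma prime_dvd_fact (p k : nat) : prime p -> (p %| k`!)%N -> (p <= k)%N.
Proof.
move=> pp; elim: k => [|k IH]; first by rewrite dvdn1 => /eqP p1; rewrite p1 in pp.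
by rewrite factS Euclid_dvdM // => /orP[/dvdn_leq ->//|/IH]; lia.
Qed.

(** The two equal middle coefficients both occur in the expansion of 2^(2m+1) = 2 * 4^m. *)
Lemma bin_odd_middle_le (m : nat) : ('C(m.*2.+1, m) <= 4 ^ m)%N.
Proof.
have h1 : (m < m.*2.+2)%N by lia.
have h2 : (m.+1 < m.*2.+2)%N by lia.
have := expnDn 1 1 m.*2.+1; rewrite addn1.
rewrite (bigD1 (Ordinal h1)) //= (bigD1 (Ordinal h2)) /=; last first.
  by rewrite -val_eqE /=; lia.
rewrite !exp1n !muln1.
have -> : 'C(m.*2.+1, m.+1) = 'C(m.*2.+1, m).
  by rewrite -bin_sub; [congr 'C(_, _); lia|lia].
have -> : (2 ^ m.*2.+1 = 2 * (2 ^ m) ^ 2)%N by rewrite expnS -muln2 expnM.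
move=> E.
rewrite -(leq_pmul2r (isT : 0 < 2)%N).
have -> : (4 ^ m * 2 = 2 * (2 ^ m) ^ 2)%N.
  by rewrite mulnC -expnM [(m * 2)%N]mulnC expnM.
by rewrite E; lia.
Qed.

(** Erdos's induction: for odd n = 2m+1 the primes from m+2 to n all divide C(n, m), which is at
    most 4^m, and the smaller primes are the case m+1. An even n > 2 adds no prime. *)
Lemma primorial_le (n : nat) : (\prod_(0 <= p < n.+1 | prime p) p <= 4 ^ n)%N.
Proof.
elim/ltn_ind: n => n IH.
have [n2|n3] := leqP n 2.
  by case: n n2 {IH} => [|[|[|]]] // _; rewrite /index_iota unlock.
have [on|en] := boolP (odd n); last first.
  rewrite big_mkcond big_nat_recr //= -big_mkcond /=.
  case: ifPn => [/even_prime[n2|on]|_]; [lia|by rewrite on in en|].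
  rewrite muln1; case: n n3 IH {en} => // n n3 IH.
  by apply: leq_trans (IH n _) _; rewrite // leq_exp2l.
have [m nE] : exists m, n = m.*2.+1.
  by exists n./2; rewrite -[LHS]odd_double_half on.
have m1 : (m.+1 < n)%N by lia.
rewrite (@big_cat_nat _ _ _ m.+2) //=; last by lia.
have D : (\prod_(m.+2 <= p < n.+1 | prime p) p %| 'C(n, m))%N.
  apply: primorial_dvd => p /andP[mp pn] pp.
  have : (p %| n`!)%N by rewrite dvdn_fact // (prime_gt0 pp) -ltnS.
  rewrite -(@bin_fact n m); last by lia.
  rewrite !Euclid_dvdM // => /or3P[//| |] /(prime_dvd_fact _ _ pp); lia.
apply: (@leq_trans (4 ^ m.+1 * 4 ^ m)); last first.
  by rewrite -expnD leq_exp2l //; lia.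
apply: leq_mul; first exact: IH.
apply: (leq_trans (dvdn_leq _ D)); first by rewrite bin_gt0; lia.
by rewrite nE bin_odd_middle_le.
Qed.

Lemma ln_prod (R : realType) (r : seq nat) (P : pred nat) (F : nat -> R) :
  (forall i, P i -> 0 < F i) ->
  ln (\prod_(i <- r | P i) F i) = \sum_(i <- r | P i) ln (F i).
Proof.
move=> F0; elim: r => [|i r IH]; first by rewrite !big_nil ln1.
rewrite !big_cons; case: ifP => // Pi.
by rewrite lnM ?posrE ?IH ?F0 // prodr_gt0.
Qed.

Lemma ln_nat_ge0 (R : realType) (n : nat) : 0 <= ln n%:R :> R.
Proof. by case: n => [|n]; [rewrite ln0|rewrite ln_ge0 // ler1n]. Qed.

Lemma theta_le (R : realType) (N : nat) :
  \sum_(0 <= p < N.+1 | prime p) ln p%:R <= N%:R * ln 4 :> R.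
Proof.
have e0 : (0 : R) < 4 by lra.
rewrite -ln_prod => [|p /prime_gt0]; last by rewrite ltr0n.
rewrite mulr_natl -lnXn // ler_ln ?posrE ?exprn_gt0 //; last first.
  by rewrite prodr_gt0 // => p /prime_gt0; rewrite ltr0n.
rewrite -natr_prod -natrX ler_nat; exact: primorial_le.
Qed.

Lemma ln_factor (R : realType) (n N : nat) : (0 < n)%N ->
  (forall p, prime p -> (p %| n)%N -> (p <= N)%N) ->
  ln n%:R = \sum_(0 <= p < N.+1 | prime p) (logn p n)%:R * ln p%:R :> R.
Proof.
move=> n0 nN; rewrite -{1}(partnT n0) /partn natr_prod ln_prod; last first.
  by move=> [|p] _; rewrite ltr0n expn_gt0 // lognE.
have pos p : (0 : R) < p%:R \/ logn p n = 0%N.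
  by case: p => [|p]; [right; rewrite lognE|left; rewrite ltr0n].
rewrite big_mkcond [RHS]big_mkcond.
have widen (f : nat -> R) (a b : nat) : (a <= b)%N ->
  (forall p, (a <= p)%N -> f p = 0) ->
  \sum_(0 <= p < a) f p = \sum_(0 <= p < b) f p.
  move=> ab f0; rewrite [RHS](@big_cat_nat _ _ _ a) //= [X in _ + X]big1_seq ?addr0 //.
  by move=> p; rewrite mem_index_iota => /andP[_ /andP[/f0]].
rewrite (widen _ n.+1 (n + N).+1) ?ltnS ?leq_addr //; last first.
  move=> p np /=; have -> : logn p n = 0%N.
    by rewrite lognE; case: ifP => // /and3P[_ _ /dvdn_leq]; lia.
  by rewrite expn0 ln1.
rewrite [RHS](widen _ N.+1 (n + N).+1) ?ltnS ?leq_addl //; last first.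
  move=> p Np; case: ifP => // pp; rewrite lognE pp n0 /=.
  by case: ifP => [/(nN _ pp)|]; [lia|rewrite mul0r].
apply: eq_bigr => p _ /=; case: ifPn => [pp|np].
  by rewrite natrX lnXn ?ltr0n ?prime_gt0 // mulr_natl.
by rewrite lognE (negbTE np) expn0 ln1.
Qed.

Lemma ln_fact_bounds (R : realType) (N : nat) :
  N%:R * ln (N%:R : R) - N%:R <= ln ((N`!)%:R : R) <= N%:R * ln (N%:R : R).
Proof.
elim: N => [|N /andP[IH1 IH2]]; first by rewrite fact0 ln1 !mul0r subrr lexx.
rewrite factS natrM lnM ?posrE ?ltr0n ?fact_gt0 //.
have [->|N0] := posnP N.
  by rewrite fact0 ln1 mulr0 addr0 lexx andbT; lra.
have NR : (0 : R) < N%:R by rewrite ltr0n.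
have N1R : (0 : R) < N.+1%:R by rewrite ltr0n.
have l1 : ln N.+1%:R - ln N%:R <= N%:R^-1 :> R.
  rewrite -ln_div ?posrE //; have := @ln_le_sub1 R (N.+1%:R / N%:R) (divr_gt0 N1R NR).
  by rewrite -natr1 mulrDl divff ?gt_eqF // mul1r; lrai.
have l2 : ln N%:R <= ln N.+1%:R :> R by rewrite ler_ln ?posrE // ler_nat.
have l3 : N%:R * (ln N.+1%:R - ln N%:R) <= 1 :> R.
  by apply: (le_trans (ler_wpM2l (ltW NR) l1)); rewrite mulfV ?gt_eqF.
rewrite -natr1 in l1 l2 l3 N1R *.
have l4 : N%:R * ln N%:R <= N%:R * ln (N%:R + 1) :> R by rewrite ler_wpM2l // ltW.
apply/andP; split; lra.
Qed.

Lemma sum_geo_le (R : realType) (p K : nat) : (1 < p)%N ->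
  \sum_(1 <= k < K) (p%:R ^+ k)^-1 <= (p%:R - 1)^-1 :> R.
Proof.
move=> p1; have pR : (1 : R) < p%:R by rewrite ltr1n.
case: K => [|K]; first by rewrite big_geq // invr_ge0; lra.
suff : \sum_(1 <= k < K.+1) (p%:R ^+ k)^-1 <= (p%:R - 1)^-1 * (1 - (p%:R ^+ K)^-1) :> R.
  move/le_trans; apply; rewrite ler_piMr //; first by rewrite invr_ge0; lra.
elim: K => [|K IH]; first by rewrite big_geq // expr0 invr1 subrr mulr0.
rewrite big_nat_recr //= (le_trans (lerD IH (lexx _))) // exprS.
have X0 : (0 : R) < p%:R ^+ K by rewrite exprn_gt0 // ltr0n; lia.
rewrite le_eqVlt; apply/orP; left; apply/eqP; field.
rewrite (gt_eqF X0) /=; apply/andP; split; apply: lt0r_neq0; lra.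
Qed.

Lemma prime_powR_sum_le (R : realType) (d : R) (K : nat) : 0 < d ->
  \sum_(0 <= p < K | prime p) p%:R `^ (- (1 + d)) <= d^-1.
Proof.
move=> d0; have := @sum_powR_tail R 1 K d isT d0; rewrite powR1 mulr1.
apply: le_trans.
have [K2|K2] := leqP K 2.
  rewrite big_nat_cond big_pred0 ?sumr_ge0 // => p.
  by apply/negbTE/negP => /andP[/andP[_ pK] /prime_gt1]; lia.
rewrite [leLHS](@big_cat_nat _ _ _ 2) ?(ltnW K2) //=.
rewrite [X in X + _]big_nat_cond [X in X + _]big_pred0 ?add0r; last first.
  by move=> p; apply/negbTE/negP => /andP[/andP[_ pK] /prime_gt1]; lia.
rewrite big_mkcond; apply: ler_sum => p _; case: ifP => // _; exact: powR_ge0.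
Qed.

Lemma ln_le_powR (R : realType) (x d : R) : 0 < x -> 0 < d -> ln x <= d^-1 * x `^ d.
Proof.
move=> x0 d0; rewrite ler_pdivlMl // -ln_powR.
have := @ln_le_sub1 R (x `^ d) (powR_gt0 _ x0); lra.
Qed.

(** By ln p <= 2 sqrt p and p - 1 >= p/2 each term is at most 4 p^(-3/2), and these powers sum to at
    most 2; hence 8. *)
Lemma prime_lnp_sum_le (R : realType) (K : nat) :
  \sum_(0 <= p < K | prime p) ln p%:R / (p%:R * (p%:R - 1)) <= 8 :> R.
Proof.
apply: (@le_trans _ _ (4 * \sum_(0 <= p < K | prime p) p%:R `^ (- (1 + 2^-1)))); last first.
  by have := @prime_powR_sum_le R 2^-1 K ltac:(lra); rewrite invrK; lra.
rewrite mulr_sumr; apply: ler_sum => p pp.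
have p2 : (2 : R) <= p%:R by rewrite ler_nat prime_gt1.
have p0 : (0 : R) < p%:R by lra.
have l := @ln_le_powR R p%:R 2^-1 p0 ltac:(lra).
rewrite ler_pdivrMr; last by rewrite mulr_gt0 //; lra.
apply: (le_trans l); rewrite invrK powRN powRD; last by rewrite (gt_eqF p0) implybT.
rewrite powRr1 ?(ltW p0) // powR12_sqrt ?(ltW p0) //.
have s0 : 0 < Num.sqrt p%:R :> R by rewrite sqrtr_gt0.
have := sqr_sqrtr (ltW p0); set s := Num.sqrt _ in s0 * => sE; rewrite -{}sE in p2 *.
have -> : 4 * (s ^+ 2 * s)^-1 * (s ^+ 2 * (s ^+ 2 - 1)) = 4 * (s ^+ 2 - 1) / s.
  by field; rewrite gt_eqF.
by rewrite ler_pdivlMr //; nra.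
Qed.

(** Legendre's formula compared with ln N! = N ln N + O(N). For the upper bound, the exponent of p
    is at least N/p - 1 and the loss is the Chebyshev sum of [theta_le]. For the lower bound, it is
    at most N/(p-1), and the excess over N/p is the sum in [prime_lnp_sum_le]. The constant 9 is 1 +
    8; the upper side needs only ln 4. *)
Lemma mertens1 (R : realType) : exists C : R, forall N, (0 < N)%N ->
  `|\sum_(0 <= p < N.+1 | prime p) ln p%:R / p%:R - ln N%:R| <= C.
Proof.
exists 9 => N N0; have NR : (0 : R) < N%:R by rewrite ltr0n.
have /andP[fl fu] := @ln_fact_bounds R N.
have E : ln (N`!)%:R = \sum_(0 <= p < N.+1 | prime p) (logn p N`!)%:R * ln p%:R :> R.
  by apply: ln_factor; [exact: fact_gt0|move=> p; exact: prime_dvd_fact].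
have th := @theta_le R N.
have l4 : ln 4 <= 3 :> R by have := @ln_le_sub1 R 4 ltac:(lra); lra.
have U : N%:R * \sum_(0 <= p < N.+1 | prime p) ln p%:R / p%:R <=
    ln (N`!)%:R + N%:R * ln 4 :> R.
  rewrite -lerBlDr (le_trans (lerB (lexx _) th)) // E mulr_sumr -sumrB.
  apply: ler_sum => p pp; have p0 := prime_gt0 pp.
  have pR : (0 : R) < p%:R by rewrite ltr0n.
  have : (N %/ p <= logn p N`!)%N.
    rewrite logn_fact // big_nat_recl // expn1 leq_addr //.
  rewrite -(@ler_nat R) => h.
  have h2 : N%:R / p%:R - 1 <= (N %/ p)%:R :> R.
    rewrite lerBlDr natr1 ler_pdivrMr // -natrM ler_nat.
    by rewrite {1}(divn_eq N p) mulSn addnC leq_add2r ltnW // ltn_mod.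
  have := ler_wpM2r (@ln_nat_ge0 R p) (le_trans h2 h); lra.
have L : ln (N`!)%:R <= N%:R * (\sum_(0 <= p < N.+1 | prime p) ln p%:R / p%:R + 8) :> R.
  apply: (@le_trans _ _ (N%:R * (\sum_(0 <= p < N.+1 | prime p) ln p%:R / p%:R +
    \sum_(0 <= p < N.+1 | prime p) ln p%:R / (p%:R * (p%:R - 1))))); last first.
    by rewrite ler_wpM2l ?(ltW NR) // lerD2l prime_lnp_sum_le.
  rewrite E -big_split mulr_sumr /=; apply: ler_sum => p pp.
  have p1 : (1 : R) < p%:R by rewrite ltr1n prime_gt1.
  have -> : ln p%:R / p%:R + ln p%:R / (p%:R * (p%:R - 1)) = (p%:R - 1)^-1 * ln p%:R :> R.
    by field; apply/andP; split; apply: lt0r_neq0; lra.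
  rewrite mulrA ler_wpM2r ?ln_nat_ge0 // logn_fact // natr_sum.
  apply: (@le_trans _ _ (\sum_(1 <= k < N.+1) N%:R * (p%:R ^+ k)^-1)).
    apply: ler_sum => k _; rewrite ler_pdivlMr ?exprn_gt0 //; last lra.
    by rewrite -natrX -natrM ler_nat leq_trunc_div.
  by rewrite -mulr_sumr ler_wpM2l ?(ltW NR) // sum_geo_le // prime_gt1.
move: U L; set S := \sum_(_ <= _ < _ | _) _ => U L.
have u : S <= ln N%:R + ln 4 by rewrite -(ler_pM2l NR); lra.
have l : ln N%:R - 1 <= S + 8 by rewrite -(ler_pM2l NR); lra.
rewrite ler_norml; apply/andP; split; lra.
Qed.

Lemma ln2_bounds (R : realType) : 2^-1 <= ln (2 : R) <= 1.
Proof.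
have := @ln_ge_subV R 2 ltac:(lra); have := @ln_le_sub1 R 2 ltac:(lra) => h1 h2.
by apply/andP; split; lra.
Qed.

Lemma ln_succ_bounds (R : realType) (n : nat) : (0 < n)%N ->
  n.+1%:R^-1 <= ln n.+1%:R - ln (n%:R : R) <= n%:R^-1.
Proof.
move=> n0; have nR : (0 : R) < n%:R by rewrite ltr0n.
have n1R : (0 : R) < n.+1%:R by rewrite ltr0n.
have q0 := divr_gt0 n1R nR.
rewrite -ln_div ?posrE //; have := ln_ge_subV _ _ q0; have := ln_le_sub1 _ _ q0.
have -> : n.+1%:R / n%:R - 1 = n%:R^-1 :> R.
  by rewrite -natr1; field; rewrite gt_eqF.
rewrite invf_div; have -> : 1 - n%:R / n.+1%:R = n.+1%:R^-1 :> R.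
  by rewrite -natr1; field; apply: lt0r_neq0; lra.
by move=> -> ->.
Qed.

Lemma harmonic_ln (R : realType) (N : nat) : (0 < N)%N ->
  `|series (@harmonic R) N - ln N%:R - euler_gamma R| <= N%:R^-1.
Proof.
move=> N0; rewrite -[leRHS]mul1r.
have [|_ H] := @cvg_rate R (fun n => series (@harmonic R) n - ln n%:R) 1; last exact: H.
move=> n n0; have nR : (0 : R) < n%:R by rewrite ltr0n.
have /andP[h1 h2] := @ln_succ_bounds R n n0.
rewrite /series /= big_nat_recr //= /harmonic -natr1 divr_mul_succ //.
move: h1 h2; rewrite -natr1 => h1 h2.
rewrite ler_norml; apply/andP; split; lrai.
Qed.

(* Primes are summed over dyadic ranges, so that the main term is a harmonic
   number; [c] is identified in [mertens_constE]. *)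
Lemma mertens2 (R : realType) : exists c C : R, forall N, (0 < N)%N ->
  `|\sum_(0 <= p < 2 ^ N | prime p) p%:R^-1 - series harmonic N - c| <= C / N%:R.
Proof.
have [C0 M1] := mertens1 R.
set l : R := ln 2; have /andP[lge lle] : 2^-1 <= l <= 1 := ln2_bounds R.
have l0 : 0 < l by lra.
pose P N : R := \sum_(0 <= p < 2 ^ N | prime p) p%:R^-1.
pose L N : R := \sum_(0 <= p < 2 ^ N | prime p) ln p%:R / p%:R.
pose r N : R := L N - N%:R * l.
have lX N : ln (2 ^ N)%:R = N%:R * l :> R by rewrite natrX lnXn // mulr_natl.
have rC N : (0 < N)%N -> `|r N| <= C0 + 1.
  case: N => // N _; have E : (2 ^ N.+1 = (2 ^ N.+1).-1.+1)%N.
    by rewrite prednK // expn_gt0.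
  have pos : (2 ^ N <= (2 ^ N.+1).-1)%N.
    by rewrite -ltnS -E ltn_exp2l.
  have pos1 : (0 < 2 ^ N)%N by rewrite expn_gt0.
  have := M1 _ (leq_trans pos1 pos); rewrite -E -/(L N.+1).
  have h1 : ln (2 ^ N)%:R <= ln (2 ^ N.+1).-1%:R :> R.
    by rewrite ler_ln ?posrE ?ltr0n ?ler_nat //; lia.
  have h2 : ln (2 ^ N.+1).-1%:R <= ln (2 ^ N.+1)%:R :> R.
    by rewrite ler_ln ?posrE ?ltr0n ?ler_nat //; lia.
  rewrite !lX -natr1 in h1 h2; rewrite /r -natr1 !ler_norml => /andP[a1 a2].
  apply/andP; split; lra.
have step (f : nat -> R) N : \sum_(0 <= p < 2 ^ N.+1 | prime p) f p =
    \sum_(0 <= p < 2 ^ N | prime p) f p + \sum_(2 ^ N <= p < 2 ^ N.+1 | prime p) f p.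
  by rewrite (@big_cat_nat _ _ _ (2 ^ N)) //= leq_exp2l.
(* Let a and b be the sums of 1/p and ln p / p over a bucket. Then N l a <= b <= (N+1) l a and b = l
   + r(N+1) - r(N), so a is about 1/(N+1) plus a difference of values of r over (N+1) l. Subtracting
   r(N)/(N l) absorbs that difference, which is only O(1/N), and leaves increments O(1/N^2) as
   [cvg_rate] requires. *)
pose u N := P N - series harmonic N - r N / (N%:R * l).
have [|cu H] := @cvg_rate R u ((l + 3 * (C0 + 1)) / l).
  move=> N N0; have NR : (0 : R) < N%:R by rewrite ltr0n.
  have r1 := rC N N0; have r2 := rC N.+1 isT.
  pose a : R := \sum_(2 ^ N <= p < 2 ^ N.+1 | prime p) p%:R^-1.
  pose b : R := \sum_(2 ^ N <= p < 2 ^ N.+1 | prime p) ln p%:R / p%:R.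
  have Pa : P N.+1 = P N + a by exact: step.
  have Lb : L N.+1 = L N + b by exact: step.
  have ab1 : N%:R * l * a <= b.
    rewrite /a /b mulr_sumr big_seq_cond [leRHS]big_seq_cond.
    apply: ler_sum => p; rewrite mem_index_iota => /andP[/andP[pl pu] pp].
    rewrite ler_wpM2r ?invr_ge0 // -lX ler_ln ?posrE ?ltr0n ?ler_nat //.
      by rewrite expn_gt0.
    exact: prime_gt0.
  have ab2 : b <= N.+1%:R * l * a.
    rewrite /a /b mulr_sumr big_seq_cond [leRHS]big_seq_cond.
    apply: ler_sum => p; rewrite mem_index_iota => /andP[/andP[pl pu] pp].
    rewrite ler_wpM2r ?invr_ge0 // -lX ler_ln ?posrE ?ltr0n ?ler_nat //.
    + exact: ltnW.
    + exact: prime_gt0.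
    + by rewrite expn_gt0.
  have bE : b = l + r N.+1 - r N by rewrite /r Lb -natr1; lra.
  have uE : u N.+1 - u N = a - N.+1%:R^-1 - r N.+1 / (N.+1%:R * l) + r N / (N%:R * l).
    by rewrite /u Pa /series /= big_nat_recr //= /harmonic; lrai.
  rewrite -natr1 in ab2 uE *.
  have l1 := divr_mul_succ _ 1 _ NR.
  have -> : u N.+1 - u N = (a * (N%:R + 1) * l - b + r N / N%:R) / ((N%:R + 1) * l).
    rewrite uE bE; field.
    by rewrite !(gt_eqF NR, gt_eqF l0) /= !andbT; apply: lt0r_neq0; lra.
  have N1 : 0 < N%:R + 1 :> R by lra.
  rewrite normrM (ger0_norm (x := (_ * _)^-1)); last by rewrite invr_ge0 mulr_ge0 // ltW.
  rewrite ler_pdivrMr ?mulr_gt0 //.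
  have -> : (l + 3 * (C0 + 1)) / l / (N%:R * (N%:R + 1)) * ((N%:R + 1) * l) =
            (l + 3 * (C0 + 1)) / N%:R.
    field.
    by rewrite !(gt_eqF NR, gt_eqF l0) /= !andbT; apply: lt0r_neq0; lra.
  rewrite ler_pdivlMr // -[X in _ * X <= _](ger0_norm (ltW NR)) -normrM mulrDl divfK ?gt_eqF //.
  have : `|(a * (N%:R + 1) * l - b) * N%:R| <= l + 2 * (C0 + 1).
    rewrite ger0_norm; last by rewrite mulr_ge0 ?(ltW NR) //; lra.
    move: r1 r2; rewrite !ler_norml => /andP[r1 _] /andP[_ r2].
    apply: (@le_trans _ _ b); last lra.
    apply: le_trans (ab1).
    have : (a * (N%:R + 1) * l - b) <= a * l by lra.
    by move/(ler_wpM2r (ltW NR)) => h; lra.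
  move=> h; apply: (le_trans (ler_normD _ _)); lra.
exists (limn u), ((l + 3 * (C0 + 1)) / l + (C0 + 1) / l) => N N0.
have NR : (0 : R) < N%:R by rewrite ltr0n.
have := H N N0; rewrite /u -/(P N).
have : `|r N / (N%:R * l)| <= (C0 + 1) / l / N%:R.
  rewrite normrM (ger0_norm (x := (_ * _)^-1)); last by rewrite invr_ge0 mulr_ge0 // ltW.
  have -> : (C0 + 1) / l / N%:R = (C0 + 1) / (N%:R * l).
    by field; rewrite !(gt_eqF NR, gt_eqF l0).
  by rewrite ler_wpM2r ?rC // invr_ge0 mulr_ge0 // ltW.
rewrite [_ / N%:R in X in _ -> _ -> X]mulrDl.
set x := r N / _; set y := P N - _ - _ => h1 h2.
have -> : P N - series harmonic N - limn u = y - limn u + x by rewrite /y /x; lra.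
apply: (le_trans (ler_normD _ _)); exact: lerD.
Qed.

(** * The constant in Mertens' theorem *)

Lemma is_derive_log_partial (R : realType) (N : nat) (x : R) :
  is_derive x 1 (fun y : R => \sum_(0 <= k < N) y ^+ k.+1 / k.+1%:R)
    (\sum_(0 <= k < N) x ^+ k).
Proof.
elim: N => [|N IH].
  rewrite big_geq //; under eq_fun do rewrite big_geq //; exact: is_derive_cst.
rewrite big_nat_recr //=; under eq_fun do rewrite big_nat_recr //=.
have D : is_derive x 1 (fun y : R => y ^+ N.+1 / N.+1%:R) (x ^+ N).
  have -> : (fun y : R => y ^+ N.+1 / N.+1%:R) =
            N.+1%:R^-1 *: ((id : R -> R) ^+ N.+1).
    by apply/funext => y; rewrite mulrC !fctE.
  apply: is_derive_eq.
  by rewrite /= /GRing.scale /= mulr1 mulKf // pnatr_eq0.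
exact: is_deriveD.
Qed.

(** The difference between - ln(1 - y) and the partial sum vanishes at 0 and has derivative
    y^N/(1-y); the mean value theorem on [0, z] gives both bounds on the remainder. *)
Lemma log_series_bounds (R : realType) (z : R) (N : nat) : 0 < z -> z < 1 ->
  \sum_(0 <= k < N) z ^+ k.+1 / k.+1%:R <= - ln (1 - z)
  <= \sum_(0 <= k < N) z ^+ k.+1 / k.+1%:R + z ^+ N.+1 / (1 - z).
Proof.
move=> z0 z1.
pose f y : R := - ln (1 - y) - \sum_(0 <= k < N) y ^+ k.+1 / k.+1%:R.
have fD x : x \in `[0, z] -> is_derive x 1 f (x ^+ N / (1 - x)).
  rewrite in_itv /= => /andP[x0 xz].
  have d1 : is_derive x 1 (fun y : R => - ln (1 - y)) (1 - x)^-1.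
    have d0 : is_derive x (1 : R) (fun y : R => 1 - y) (- 1).
      by apply: is_derive_eq; lra.
    have x1 : 0 < 1 - x by lra.
    have dl := @is_derive1_comp R (@ln R) (fun y => 1 - y) x _ _ (is_derive1_ln x1) d0.
    by apply: is_derive_eq; rewrite mulrN1 opprK.
  have d2 := is_derive_log_partial R N x.
  apply: is_derive_eq.
  have x1 : x != 1 by rewrite lt_eqF //; lra.
  have := @geometric_seriesE R 1 x x1 => /(congr1 (fun u => u N)) /=.
  rewrite /series /= /geometric /=; under eq_bigr do rewrite mul1r; move=> ->.
  by rewrite mul1r; field; apply: lt0r_neq0; lra.
have f0 : f 0 = 0.
  rewrite /f subr0 ln1 oppr0 big1 ?subr0 // => k _.
  by rewrite expr0n mul0r.
have fd x : x \in `]0, z[ -> is_derive x 1 f (x ^+ N / (1 - x)).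
  by move=> xz; apply: fD; apply: subset_itv_oo_cc xz.
have fc : {within `[0, z], continuous f}.
  by apply: derivable_within_continuous => x /fD d; exact: ex_derive.
have [c] := MVT_segment (ltW z0) fd fc.
rewrite in_itv /= => /andP[c0 cz]; rewrite f0 !subr0 => E.
have c1 : 0 < 1 - c by lra.
have h0 : 0 <= f z by rewrite E mulr_ge0 ?(ltW z0) // divr_ge0 ?exprn_ge0 // ltW.
have h1 : f z <= z ^+ N.+1 / (1 - z).
  rewrite E exprSr [leRHS]mulrAC ler_wpM2r ?(ltW z0) //.
  apply: ler_pM => //; [exact: exprn_ge0|by rewrite invr_ge0 ltW| |].
    by rewrite lerXn2r // nnegrE ltW.
  by rewrite lef_pV2 ?posrE; lra.
by move: h0 h1; rewrite /f => h0 h1; apply/andP; split; lra.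
Qed.

Lemma zeta_partial_le (R : realType) (d : R) (N : nat) : 0 < d ->
  \sum_(1 <= n < N) n%:R `^ (- (1 + d)) <= 1 + d^-1.
Proof.
move=> d0; have [N1|N1] := leqP N 1; first by rewrite big_geq // addr_ge0 // invr_ge0 ltW.
rewrite big_ltn // powR1 lerD2l.
by have := @sum_powR_tail R 1 N d isT d0; rewrite powR1 mulr1.
Qed.

Lemma zeta_partial_ge (R : realType) (d : R) (N : nat) : 0 < d -> (0 < N)%N ->
  d^-1 * (1 - N%:R `^ (- d)) <= \sum_(1 <= n < N) n%:R `^ (- (1 + d)).
Proof.
move=> d0 N0; rewrite ler_pdivrMl // mulr_sumr.
have : \sum_(1 <= n < N) - (n.+1%:R `^ (- d) - n%:R `^ (- d)) <=
       \sum_(1 <= n < N) d * n%:R `^ (- (1 + d)).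
  rewrite !big_seq; apply: ler_sum => n; rewrite mem_index_iota => /andP[n0 _].
  by rewrite opprB; apply: powRNDiff_le => //; apply: ltW.
by rewrite sumrN telescope_sumr // powR1 opprB.
Qed.

Lemma powRN_le_inv (R : realType) (p : nat) (d : R) : (0 < p)%N -> 0 <= d ->
  p%:R `^ (- (1 + d)) <= p%:R^-1.
Proof.
move=> p0 d0; rewrite -powR_inv1 //; apply: ler_powR; first by rewrite ler1n.
lra.
Qed.

Lemma invp_le_half (R : realType) (p : nat) : prime p -> p%:R^-1 <= 2^-1 :> R.
Proof.
by move=> pp; rewrite lef_pV2 ?posrE ?ltr0n ?ler_nat ?prime_gt1 ?prime_gt0.
Qed.

Lemma natrX_powR (R : realType) (s : R) (p j : nat) :
  (p ^ j)%:R `^ s = (p%:R `^ s) ^+ j.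
Proof.
rewrite natrX -(powR_mulrn j (ler0n R p)) -(powR_mulrn j (powR_ge0 p%:R s)).
by rewrite powRAC.
Qed.

Section EulerZeta.
Variables (R : realType) (d : R).
Hypothesis d0 : 0 < d.
Let g (n : nat) : R := if n == 0%N then 0 else n%:R `^ (- (1 + d)).
Let x (p : nat) : R := p%:R `^ (- (1 + d)).

Let gE n : (0 < n)%N -> g n = n%:R `^ (- (1 + d)).
Proof. by case: n. Qed.

Let x_bounds p : prime p -> 0 < x p <= 2^-1.
Proof.
move=> pp; rewrite powR_gt0 ?ltr0n ?prime_gt0 //=.
exact: le_trans (powRN_le_inv _ _ _ (prime_gt0 pp) (ltW d0)) (invp_le_half _ _ pp).
Qed.

Let g_ge0 n : 0 <= g n.
Proof. by rewrite /g; case: eqP => // _; exact: powR_ge0. Qed.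

Let g1 : g 1 = 1.
Proof. by rewrite /g /= powR1. Qed.

Let gM p i m : prime p -> coprime p m -> g (p ^ i * m)%N = g (p ^ i)%N * g m.
Proof.
move=> pp _; rewrite /g muln_eq0; case: eqP => [->|_]; first by rewrite mul0r.
by case: eqP => _ /=; rewrite ?mulr0 // natrM powRM.
Qed.

Let g_geo p : prime p ->
  \sum_(0 <= j < J) g (p ^ j)%N @[J --> \oo] --> (1 - x p)^-1.
Proof.
move=> pp; have /andP[xp0 xp2] := x_bounds p pp.
have E J : \sum_(0 <= j < J) g (p ^ j)%N = series (geometric 1 (x p)) J.
  apply: eq_bigr => j _; rewrite gE ?expn_gt0 ?prime_gt0 // /geometric /= mul1r.
  exact: natrX_powR.
have xn : `|x p| < 1 by rewrite ger0_norm; lra.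
by have := @cvg_geometric_series R 1 (x p) xn; rewrite mul1r (funext E).
Qed.

Let lnprod N : ln (\prod_(0 <= p < N | prime p) (1 - x p)^-1) =
  \sum_(0 <= p < N | prime p) - ln (1 - x p).
Proof.
rewrite ln_prod => [|p /x_bounds /andP[a b]]; last by rewrite invr_gt0; lra.
by apply: eq_bigr => p /x_bounds /andP[a b]; rewrite lnV // posrE; lra.
Qed.

Let prod_gt0 N : 0 < \prod_(0 <= p < N | prime p) (1 - x p)^-1.
Proof.
by apply: prodr_gt0 => p /x_bounds /andP[a b]; rewrite invr_gt0; lra.
Qed.

(** With [euler_zeta_ge], once N is large the logarithm of the Euler product of zeta(1 + d) lies
    between ln(1/d), up to a vanishing error, and ln(1 + 1/d). This is all that is needed of the
    pole at 1. *)
Lemma euler_zeta_le (N : nat) :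
  \sum_(0 <= p < N | prime p) - ln (1 - p%:R `^ (- (1 + d))) <= ln (1 + d^-1).
Proof.
rewrite -lnprod ler_ln ?posrE //; last by rewrite addr_gt0 // invr_gt0.
apply: (@euler_prod_le R g g_ge0 g1 gM (fun p => (1 - x p)^-1) _ N g_geo) => M.
have -> : \sum_(1 <= n < M) g n = \sum_(1 <= n < M) n%:R `^ (- (1 + d)).
  by apply: eq_big_nat => n /andP[n0 _]; rewrite gE.
exact: zeta_partial_le.
Qed.

Lemma euler_zeta_ge (N : nat) : (1 < N)%N ->
  ln (d^-1 * (1 - N%:R `^ (- d))) <=
  \sum_(0 <= p < N | prime p) - ln (1 - p%:R `^ (- (1 + d))).
Proof.
move=> N1; rewrite -lnprod ler_ln ?posrE //; last first.
  have NR : (1 : R) < N%:R by rewrite ltr1n.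
  rewrite mulr_gt0 ?invr_gt0 // subr_gt0 powR_expR; last lra.
  by rewrite expR_lt1 mulNr oppr_lt0 mulr_gt0 // ln_gt0.
apply: (le_trans (zeta_partial_ge _ _ _ d0 (ltnW N1))).
have -> : \sum_(1 <= n < N) n%:R `^ (- (1 + d)) = \sum_(1 <= n < N) g n.
  by apply: eq_big_nat => n /andP[n0 _]; rewrite gE.
apply: (@euler_partial_ge R g g_ge0 g1 gM (fun p => (1 - x p)^-1)) => p J pp.
have c := g_geo p pp; rewrite -(cvg_lim _ c) //.
apply: nondecreasing_cvgn_le; last by apply/cvg_ex; eexists; exact: c.
by apply/nondecreasing_seqP => n; rewrite big_nat_recr //= lerDl.
Qed.
End EulerZeta.

Lemma bucket_recr (V : nmodType) (f : nat -> V) (N : nat) :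
  \sum_(0 <= p < 2 ^ N.+1 | prime p) f p =
  \sum_(0 <= p < 2 ^ N | prime p) f p + \sum_(2 ^ N <= p < 2 ^ N.+1 | prime p) f p.
Proof. by rewrite (@big_cat_nat _ _ _ (2 ^ N)) //= leq_exp2l. Qed.

Lemma ler_bucket (R : realType) (f g : nat -> R) (N : nat) :
  (forall p, prime p -> N%:R * ln 2 <= ln (p%:R : R) -> ln p%:R <= N.+1%:R * ln (2 : R) ->
     (2 ^ N <= p)%N -> f p <= g p) ->
  \sum_(2 ^ N <= p < 2 ^ N.+1 | prime p) f p <=
  \sum_(2 ^ N <= p < 2 ^ N.+1 | prime p) g p.
Proof.
move=> fg; rewrite big_seq_cond [leRHS]big_seq_cond.
apply: ler_sum => p; rewrite mem_index_iota => /andP[/andP[pl pu] pp].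
have p0 : (0 : R) < p%:R by rewrite ltr0n prime_gt0.
have lX M : ln (2 ^ M)%:R = M%:R * ln 2 :> R.
  by rewrite natrX lnXn // mulr_natl.
by apply: fg => //; rewrite -lX ler_ln ?posrE // ?ltr0n ?expn_gt0 // ler_nat // ltnW.
Qed.

(** The logarithm without its linear part. Over x = 1/p it sums absolutely, to the prime sum in the
    Mertens constant; over x = p^(-(1+d)) it links the logarithm of the Euler product with the sum
    of the x themselves. *)
Definition lnphi {R : realType} (x : R) : R := ln (1 - x) + x.

(** The derivative of [lnphi] is -x/(1-x), of absolute value at most 2x up to x = 1/2; two logarithm
    inequalities do the work of the derivative. With x = 1/p and y = p^(-(1+d)) this controls the
    effect of d. *)
Lemma lnphi_diff (R : realType) (x y : R) : 0 <= y -> y <= x -> x <= 2^-1 ->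
  0 <= lnphi y - lnphi x <= 2 * x * (x - y).
Proof.
move=> y0 yx x2; have x1 : 0 < 1 - x by lra.
have y1 : 0 < 1 - y by lra.
have xy : 0 < (1 - y) / (1 - x) by rewrite divr_gt0.
have := ln_le_sub1 _ _ xy; have := ln_ge_subV _ _ xy.
rewrite ln_div ?posrE // invf_div.
have -> : 1 - (1 - x) / (1 - y) = (x - y) / (1 - y) by field; apply: lt0r_neq0; lra.
have -> : (1 - y) / (1 - x) - 1 = (x - y) / (1 - x) by field; apply: lt0r_neq0; lra.
have h1 : x - y <= (x - y) / (1 - y) by rewrite ler_pdivlMr //; nra.
have h2 : (x - y) / (1 - x) <= (x - y) + 2 * x * (x - y).
  have : 0 <= x * (x - y) * (1 - 2 * x) by rewrite !mulr_ge0 //; lra.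
  by rewrite ler_pdivrMr //; lra.
by rewrite /lnphi => h3 h4; apply/andP; split; lra.
Qed.

Lemma lnphi_invp_bound (R : realType) (p : nat) : prime p ->
  `|lnphi p%:R^-1| <= 2 * p%:R `^ (- (1 + 1)) :> R.
Proof.
move=> pp; have := @lnphi_diff R p%:R^-1 0 (lexx _) ltac:(by rewrite invr_ge0) (invp_le_half R p pp).
rewrite {1 3}/lnphi subr0 ln1 addr0 sub0r => /andP[h1 h2].
rewrite -normrN ger0_norm // (le_trans h2) // subr0.
by rewrite powRN -[1 + 1]/(2%:R) powR_mulrn // -mulrA -expr2 exprVn.
Qed.

Section MertensConstant.
Variables (R : realType) (c C : R).
Let P N : R := \sum_(0 <= p < 2 ^ N | prime p) p%:R^-1.
Let H := series (@harmonic R).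
Hypothesis PHc : forall N, (0 < N)%N -> `|P N - H N - c| <= C / N%:R.
Let G : R := prime_sum (fun p => lnphi p%:R^-1).
Let GN N : R := \sum_(0 <= p < 2 ^ N | prime p) lnphi p%:R^-1.
Let l : R := ln 2.

Let lnphi_le0 p : prime p -> lnphi p%:R^-1 <= 0 :> R.
Proof.
move=> pp; have := @lnphi_diff R p%:R^-1 0 (lexx _) ltac:(by rewrite invr_ge0) (invp_le_half R p pp).
by rewrite {1}/lnphi subr0 ln1 addr0 sub0r oppr_ge0 => /andP[].
Qed.

Let GN_le0 N : GN N <= 0.
Proof. by rewrite /GN; apply: sumr_le0 => p /lnphi_le0. Qed.

Let GN_close N : (0 < N)%N -> `|G - GN N| <= 2 / N%:R.
Proof.
move=> N0.
have [_ T] := @prime_sum_tail R (fun p => lnphi p%:R^-1) 2 1 ltac:(lra) (@lnphi_invp_bound R).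
have h : (N < 2 ^ N)%N by exact: ltn_expl.
have := T (2 ^ N).-1 ltac:(lia); rewrite prednK ?expn_gt0 // divr1.
move/le_trans; apply; rewrite powR_inv1 // ler_wpM2l // lef_pV2 ?posrE ?ltr0n //; last lia.
by rewrite ler_nat; lia.
Qed.

Section FixedExponent.
Variable d : R.
Hypothesis d0 : 0 < d.
Let t : R := d * l.
Let z : R := expR (- t).
Let X N : R := \sum_(0 <= n < N) (P n.+1 - P n) * z ^+ n.+1.
Let K N : R := \sum_(0 <= n < N) z ^+ n.+1 / n.+1%:R.
Let Y N : R := \sum_(0 <= p < 2 ^ N | prime p) p%:R `^ (- (1 + d)).
Let Lam : R := - ln (1 - z).
Let e N : R := P N - H N - c.

Let l0 : 0 < l. Proof. by have /andP[] := ln2_bounds R; rewrite /l; lra. Qed.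
Let t0 : 0 < t. Proof. exact: mulr_gt0. Qed.
Let z0 : 0 < z. Proof. exact: expR_gt0. Qed.
Let z1 : z < 1. Proof. by rewrite expR_lt1 oppr_lt0. Qed.
Let zX N : z ^+ N = expR (- (N%:R * t)).
Proof. by rewrite /z -expRM_natl mulrN. Qed.
Let zX_le1 N : z ^+ N <= 1. Proof. by rewrite exprn_ile1 // ltW ?z0 ?z1. Qed.
Let zX_le N : (0 < N)%N -> z ^+ N <= (N%:R * t)^-1.
Proof.
move=> N0; have NR : (0 : R) < N%:R by rewrite ltr0n.
have Nt : 0 < N%:R * t by rewrite mulr_gt0.
rewrite zX expRN lef_pV2 ?posrE ?expR_gt0 //.
by have := expR_ge1Dx (N%:R * t); lra.
Qed.

Let e0 : e 0 = - c.
Proof.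
by rewrite /e /P /H expn0 big_mkcond big_nat1 /= /series /= big_geq // subrr sub0r.
Qed.

(** Summation by parts against the error [e]. Since [e 0] is -c, the term n = 0 turns c into c -
    (1-z) c = c z, the quantity estimated in [XK]. The other terms are at most C z^n / n, whence the
    factor (1-z) Lam there. *)
Let XK_abel N : X N - K N = e N * z ^+ N + c + (1 - z) * \sum_(0 <= n < N) e n * z ^+ n.
Proof.
elim: N => [|N IH].
  rewrite [X 0]big_geq // [K 0]big_geq // big_geq // e0; lra.
have -> : X N.+1 = X N + (P N.+1 - P N) * z ^+ N.+1 by rewrite /X big_nat_recr.
have -> : K N.+1 = K N + z ^+ N.+1 / N.+1%:R by rewrite /K big_nat_recr.
rewrite big_nat_recr //=.
have HN : H N.+1 = H N + N.+1%:R^-1 by rewrite /H /series /= big_nat_recr.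
have -> : X N + (P N.+1 - P N) * z ^+ N.+1 - (K N + z ^+ N.+1 / N.+1%:R) =
  X N - K N + (e N.+1 - e N) * z ^+ N.+1 by rewrite /e HN; lrai.
by rewrite IH exprS; lra.
Qed.

Let C0 : 0 <= C.
Proof. by have := PHc 1 isT; rewrite divr1; apply: le_trans. Qed.

Let K_Lam N : K N <= Lam <= K N + z ^+ N.+1 / (1 - z).
Proof. exact: log_series_bounds. Qed.

Let XK N : (0 < N)%N -> `|X N - K N - c * z| <= C / N%:R + C * ((1 - z) * Lam).
Proof.
case: N => // N _; rewrite XK_abel big_nat_recl // expr0 mulr1.
rewrite e0.
set S := \sum_(0 <= i < N) _.
have -> : e N.+1 * z ^+ N.+1 + c + (1 - z) * (- c + S) - c * z =
  e N.+1 * z ^+ N.+1 + (1 - z) * S by lra.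
have zpos : 0 < 1 - z by have := z1; lra.
apply: (le_trans (ler_normD _ _)); apply: lerD.
  rewrite normrM (ger0_norm (x := z ^+ _)) ?exprn_ge0 ?(ltW z0) //.
  by rewrite -[leRHS]mulr1 ler_pM ?PHc // ?exprn_ge0 ?(ltW z0).
rewrite normrM (ger0_norm (ltW zpos)) mulrCA ler_wpM2l ?(ltW zpos) //.
have /andP[KL _] := K_Lam N.
apply: (@le_trans _ _ (C * K N)); last by rewrite ler_wpM2l.
rewrite /S /K mulr_sumr (le_trans (ler_norm_sum _ _ _)) //; apply: ler_sum => n _.
rewrite normrM (ger0_norm (x := z ^+ _)) ?exprn_ge0 ?(ltW z0) // mulrCA mulrC.
by rewrite ler_wpM2l ?exprn_ge0 ?(ltW z0) // PHc.
Qed.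

Let powRp p : prime p -> p%:R `^ (- (1 + d)) = p%:R^-1 * expR (- (d * ln p%:R)).
Proof.
move=> pp; have p0 : (0 : R) < p%:R by rewrite ltr0n prime_gt0.
rewrite opprD powRD; last by rewrite (gt_eqF p0) implybT.
by rewrite powR_inv1 ?(ltW p0) // powR_expR // mulNr.
Qed.

(** Here z = 2^(-d). For 2^n <= p < 2^(n+1) the factor p^(-d) lies between z^(n+1) and z^n, so
    replacing it by z^(n+1) costs at most a factor z. *)
Let XY N : z * Y N <= X N <= Y N.
Proof.
elim: N => [|N /andP[IH1 IH2]].
  by rewrite /X /Y expn0 big_mkcond big_nat1 /= big_geq // mulr0 lexx.
have -> : X N.+1 = X N + (P N.+1 - P N) * z ^+ N.+1 by rewrite /X big_nat_recr.
have YE : Y N.+1 = Y N + \sum_(2 ^ N <= p < 2 ^ N.+1 | prime p) p%:R `^ (- (1 + d)).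
  exact: bucket_recr.
have -> : P N.+1 - P N = \sum_(2 ^ N <= p < 2 ^ N.+1 | prime p) p%:R^-1.
  by rewrite /P bucket_recr addrAC subrr add0r.
rewrite YE mulrDr mulr_suml; apply/andP; split; apply: lerD => //;
  rewrite ?mulr_sumr; apply: ler_bucket => p pp h1 h2 _; rewrite powRp // ?[z * _]mulrCA;
  rewrite ler_wpM2l ?invr_ge0 // zX /t.
- rewrite /z -expRD ler_expR; have := ler_wpM2l (ltW d0) h1; rewrite -natr1 /t /l; lra.
- by rewrite ler_expR; have := ler_wpM2l (ltW d0) h2; rewrite /l; lra.
Qed.

Let YZ N : Y N = \sum_(0 <= p < 2 ^ N | prime p) - ln (1 - p%:R `^ (- (1 + d)))
               + \sum_(0 <= p < 2 ^ N | prime p) lnphi (p%:R `^ (- (1 + d))).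
Proof. by rewrite -big_split /=; apply: eq_bigr => p _; rewrite /lnphi addKr. Qed.

Let lnphi_pair p : prime p ->
  0 <= lnphi (p%:R `^ (- (1 + d))) - lnphi p%:R^-1
    <= 2 * d * (ln p%:R / (p%:R * (p%:R - 1))).
Proof.
move=> pp; have p2 : (2 : R) <= p%:R by rewrite ler_nat prime_gt1.
have p0 : (0 : R) < p%:R by lra.
have /andP[-> h] := @lnphi_diff R _ _ (powR_ge0 _ _)
  (powRN_le_inv _ _ _ (prime_gt0 pp) (ltW d0)) (invp_le_half _ _ pp).
apply: (le_trans h); rewrite powRp //.
have := expR_ge1Dx (- (d * ln p%:R)); set E := expR _ => hE.
have L0 := @ln_nat_ge0 R p; have i0 : 0 < p%:R^-1 :> R by rewrite invr_gt0.
apply: (@le_trans _ _ (2 * d * ln p%:R * p%:R^-1 * p%:R^-1)).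
  have : p%:R^-1 * (1 - E) <= p%:R^-1 * (d * ln p%:R) by rewrite ler_wpM2l ?(ltW i0) //; lra.
  move/(ler_wpM2l (ltW i0)); lra.
rewrite -[leLHS]mulrA -invfM [leRHS]mulrA ler_wpM2l //.
  by rewrite !mulr_ge0 // ltW.
by rewrite lef_pV2 ?posrE ?mulr_gt0 //; nra.
Qed.

Let Z_pair N : GN N <= \sum_(0 <= p < 2 ^ N | prime p) lnphi (p%:R `^ (- (1 + d)))
   <= GN N + 16 * d.
Proof.
apply/andP; split.
  by apply: ler_sum => p /lnphi_pair /andP[]; rewrite subr_ge0.
apply: (@le_trans _ _ (GN N + 2 * d * \sum_(0 <= p < 2 ^ N | prime p)
    ln p%:R / (p%:R * (p%:R - 1)))).
  rewrite mulr_sumr -big_split /=; apply: ler_sum => p /lnphi_pair /andP[_]; lra.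
rewrite lerD2l; have := @prime_lnp_sum_le R (2 ^ N).
by move/(ler_wpM2l (ltW d0)); lra.
Qed.

(* [N] tends to infinity with [d] fixed: every term depending on [N] is
   O(1/N). *)
Lemma mertens_const_le :
  c * z <= ln (1 + d^-1) - Lam + G + 16 * d + C * ((1 - z) * Lam).
Proof.
have zpos : 0 < 1 - z by have := z1; lra.
apply: (@le_of_le_inv R _ _ (C + 2 + (t * (1 - z))^-1) 0) => n _.
set N := n.+1; have NR : (0 : R) < N%:R by rewrite ltr0n.
have := XK N isT; rewrite ler_norml => /andP[h1 _].
have /andP[_ h2] := XY N; have h3 := YZ N; have /andP[_ h4] := Z_pair N.
have h5 := euler_zeta_le R d d0 (2 ^ N).
have := GN_close N isT; rewrite ler_norml => /andP[h6 _].
have /andP[_ h7] := K_Lam N.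
have h8 : z ^+ N.+1 / (1 - z) <= (t * (1 - z))^-1 / N%:R.
  rewrite ler_pdivrMr // (le_trans (zX_le N.+1 isT)) //.
  have -> : (t * (1 - z))^-1 / N%:R * (1 - z) = (N%:R * t)^-1.
    by field; rewrite !(gt_eqF t0, gt_eqF NR, gt_eqF zpos).
  rewrite lef_pV2 ?posrE ?mulr_gt0 ?ltr0n // ler_wpM2r ?(ltW t0) //.
  by rewrite ler_nat.
rewrite [(C + 2 + _) / _]mulrDl [(C + 2) / _]mulrDl.
by move: h1 h2 h3 h4 h5 h6 h7 h8; lra.
Qed.

(** The reverse bound has an extra loss: from below only z Y <= X holds, and the missing (1-z) Y is
    paid for by the upper bound on Y. *)
Lemma mertens_const_ge :
  ln d^-1 - Lam + G - (1 - z) * (ln (1 + d^-1) + 16 * d) - C * ((1 - z) * Lam)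
  <= c * z.
Proof.
have zpos : 0 < 1 - z by have := z1; lra.
(* For such n, N t >= 2 and z^N <= 1/(N t) <= 1/2, which keeps 1 - z^N away from 0 in the lower
   bound for the Euler product. *)
apply: (@le_of_le_inv R _ _ (C + 2 + 2 * t^-1) (Num.truncn (2 * t^-1)).+1) => n nn.
set N := n.+1; have NR : (0 : R) < N%:R by rewrite ltr0n.
have := XK N isT; rewrite ler_norml => /andP[_ h1].
have /andP[h2 _] := XY N; have h3 := YZ N; have /andP[h4 h4'] := Z_pair N.
have h5 := euler_zeta_le R d d0 (2 ^ N).
have h5' := euler_zeta_ge R d d0 (2 ^ N) ltac:(by rewrite -{1}(expn0 2) ltn_exp2l).
have := GN_close N isT; rewrite ler_norml => /andP[_ h6].
have /andP[h7 _] := K_Lam N; have h9 := GN_le0 N.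
have zN := zX_le N isT.
have vE : (2 ^ N)%:R `^ (- d) = z ^+ N.
  rewrite zX powR_expR ?ltr0n ?expn_gt0 // natrX lnXn // /t /l -mulr_natl.
  by congr expR; lra.
have v2 : z ^+ N <= 2^-1.
  apply: (le_trans zN); rewrite lef_pV2 ?posrE ?mulr_gt0 // -ler_pdivrMr //.
  have /ltW := truncnS_gt (2 * t^-1); move/le_trans; apply.
  by rewrite ler_nat leqW.
have v0 : 0 < z ^+ N by rewrite exprn_gt0.
have h8 : ln d^-1 - 2 / (N%:R * t) <= ln (d^-1 * (1 - (2 ^ N)%:R `^ (- d))).
  rewrite vE lnM ?posrE ?invr_gt0 //; last lra.
  rewrite lerD2l; have v1 : 0 < 1 - z ^+ N by lra.
  have := ln_ge_subV _ _ v1; apply: le_trans.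
  have -> : 1 - (1 - z ^+ N)^-1 = - (z ^+ N / (1 - z ^+ N)) by field; apply: lt0r_neq0.
  rewrite lerN2 ler_pdivrMr //.
  apply: (le_trans zN); move: zN v2 v0; set q := _^-1; set y := z ^+ N => zN v2 v0.
  have : 0 <= q * (1 - 2 * y) by rewrite mulr_ge0 //; lra.
  by lra.
have h10 : 2 / (N%:R * t) = 2 * t^-1 / N%:R by field; rewrite (gt_eqF t0) (gt_eqF NR).
have h11 : (1 - z) * Y N <= (1 - z) * (ln (1 + d^-1) + 16 * d).
  by rewrite ler_wpM2l ?(ltW zpos) //; lra.
rewrite [(C + 2 + _) / _]mulrDl [(C + 2) / _]mulrDl; rewrite h10 in h8.
set q := 2 * t^-1 / N%:R in h8 *.
by move: h1 h2 h3 h4 h5' h6 h7 h8 h11; lra.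
Qed.
End FixedExponent.
End MertensConstant.

Lemma ln_invn2_le (R : realType) (n : nat) :
  let w : R := n.+1%:R^-1 in 0 <= - ln (w ^+ 2) /\ w ^+ 2 * (- ln (w ^+ 2)) <= 2 * w.
Proof.
move=> w; have n1 : (0 : R) < n.+1%:R by rewrite ltr0n.
have w0 : 0 < w by rewrite invr_gt0.
have -> : - ln (w ^+ 2) = 2 * ln n.+1%:R.
  by rewrite lnXn // /w lnV ?posrE // -mulr_natl; lra.
have L0 := @ln_nat_ge0 R n.+1; split; first by rewrite mulr_ge0.
have L1 := @ln_le_sub1 R n.+1%:R n1.
have : w * ln n.+1%:R <= 1.
  by rewrite mulrC ler_pdivrMr // mul1r; lra.
by move/(ler_wpM2l (ltW w0)); rewrite expr2; lra.
Qed.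

(* [d ln 2] runs through [1/(n+1)^2], which makes all errors O(1/(n+1)). *)
Lemma mertens_constE (R : realType) (c C : R) :
  (forall N, (0 < N)%N ->
     `|\sum_(0 <= p < 2 ^ N | prime p) p%:R^-1 - series harmonic N - c| <= C / N%:R) ->
  c = ln (ln 2) + prime_sum (fun p => ln (1 - p%:R^-1) + p%:R^-1).
Proof.
move=> PHc; set G := prime_sum _.
have C0 : 0 <= C by have := PHc 1%N isT; rewrite divr1; apply: le_trans.
set l : R := ln 2; have /andP[lge lle] : 2^-1 <= l <= 1 := ln2_bounds R.
have l0 : 0 < l by lra.
have lnl0 : ln l <= 0 by rewrite ln_le0.
(* With w = 1/(n+1), the 40 covers 17 d <= 34 w on the upper side and 36 w + t <= 37 w on the lower
   one. The summand |c| pays for replacing c z by c, and 3 C for the term C (1-z) Lam. *)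
suff B n : `|c - (ln l + G)| <= (40 + `|c| + 3 * C) / n.+1%:R.
  apply/eqP; rewrite -subr_eq0 -normr_le0.
  apply: (@le_of_le_inv R _ _ (40 + `|c| + 3 * C) 0) => n _.
  by rewrite add0r; exact: B.
set w : R := n.+1%:R^-1; have [lam0 tlam] := ln_invn2_le R n.
rewrite -/w in lam0 tlam; set t := w ^+ 2 in lam0 tlam; set lam := - ln t in lam0 tlam.
have w0 : 0 < w by rewrite invr_gt0.
have w1 : w <= 1 by rewrite invf_le1 // ler1n.
have t0 : 0 < t by rewrite exprn_gt0.
have tw : t <= w by rewrite /t expr2 ler_piMr // ltW.
have t1 : t <= 1 by lra.
have d0 : 0 < t / l by rewrite divr_gt0.
have d2t : t / l <= 2 * t.
  rewrite ler_pdivrMr //; have : t * (1 - 2 * l) <= 0 by rewrite mulr_ge0_le0 ?(ltW t0) //; lra.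
  lra.
have := mertens_const_le R c C PHc _ d0; have := mertens_const_ge R c C PHc _ d0.
rewrite -/l divfK ?gt_eqF //.
set z := expR (- t); set Lam := - ln (1 - z).
have -> : prime_sum (fun p => lnphi p%:R^-1) = G by [].
have z0 : 0 < z by exact: expR_gt0.
have zt : 1 - z <= t by have := expR_ge1Dx (- t); rewrite -/z; lra.
have zt' : t / (1 + t) <= 1 - z.
  have : z <= (1 + t)^-1.
    rewrite /z expRN lef_pV2 ?posrE ?expR_gt0 ?expR_ge1Dx //; lra.
  have -> : t / (1 + t) = 1 - (1 + t)^-1 by field; apply: lt0r_neq0; lra.
  lra.
have t1p : 0 < 1 + t by lra.
have zpos : 0 < 1 - z by apply: lt_le_trans zt'; rewrite divr_gt0.
have Lam_ge : lam <= Lam by rewrite lerN2 ler_ln ?posrE.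
have Lam_le : Lam <= lam + t.
  have : ln (t / (1 + t)) <= ln (1 - z) by rewrite ler_ln ?posrE ?divr_gt0.
  rewrite ln_div ?posrE //; have := @ln_le_sub1 R (1 + t) t1p.
  rewrite /Lam /lam; lra.
set d := t / l in d0 d2t *.
have lnd : ln d^-1 = lam + ln l.
  by rewrite lnV ?posrE // /d ln_div ?posrE // /lam; lra.
have lnd1 : ln (1 + d^-1) <= d + lam + ln l.
  have -> : 1 + d^-1 = (1 + d) / d by field; rewrite gt_eqF.
  rewrite ln_div ?posrE //; last lra.
  have := @ln_le_sub1 R (1 + d) ltac:(lra).
  by move: lnd; rewrite lnV ?posrE //; lra.
have cz : `|c - c * z| <= `|c| * w.
  rewrite -{1}[c]mulr1 -mulrBr normrM ler_wpM2l // ger0_norm ?(ltW zpos) //; lra.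
have CL : C * ((1 - z) * Lam) <= C * (3 * w).
  rewrite ler_wpM2l //; apply: (@le_trans _ _ (t * (lam + t))).
    by rewrite ler_pM // ?(ltW zpos) //; lra.
  rewrite mulrDr; have : t * t <= 1 * w by rewrite ler_pM // ltW.
  lra.
have zW : (1 - z) * (ln (1 + d^-1) + 16 * d) <= 36 * w.
  apply: (@le_trans _ _ ((1 - z) * (34 * t + lam))).
    rewrite ler_wpM2l ?(ltW zpos) //; lra.
  apply: (@le_trans _ _ (t * (34 * t + lam))).
    by rewrite ler_wpM2r //; lra.
  have : t * t <= 1 * w by rewrite ler_pM // ltW.
  lra.
rewrite lnd => hge hle.
have -> : (40 + `|c| + 3 * C) / n.+1%:R = 40 * w + `|c| * w + C * (3 * w) by rewrite /w; lrai.
move: cz; rewrite ler_norml => /andP[cz1 cz2].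
rewrite ler_norml; apply/andP; split; lra.
Qed.

(** * Convolution of harmonic-like sequences *)

Lemma harmonic_le (R : realType) (N : nat) : (0 < N)%N ->
  series (@harmonic R) N <= 1 + ln N%:R.
Proof.
case: N => // N _; elim: N => [|N IH].
  by rewrite /series /= big_nat1 /harmonic /= invr1 ln1 addr0.
have /andP[h _] := @ln_succ_bounds R N.+1 isT.
rewrite /series /= big_nat_recr //=; move: IH; rewrite /series /=.
rewrite /harmonic /=; lrai.
Qed.

Lemma harmonic_ge1 (R : realType) (N : nat) : (0 < N)%N -> 1 <= series (@harmonic R) N.
Proof.
case: N => // N _; rewrite /series /= big_nat_recl // /harmonic /= invr1 lerDl.
by rewrite sumr_ge0.
Qed.

Lemma zeta2_rate (R : realType) (N : nat) : (0 < N)%N ->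
  `|\sum_(0 <= k < N) (k.+1%:R ^- 2) - zeta 2| <= N%:R^-1 :> R.
Proof.
move=> N0; rewrite -[leRHS]mul1r.
have E n : \sum_(0 <= k < n) (k.+1%:R ^- 2) =
    series (fun n : nat => (n.+1%:R `^ (2 : R))^-1) n.
  by apply: eq_bigr => k _; rewrite powR_mulrn.
rewrite E; have [|_ H] := @cvg_rate R (series (fun n : nat => (n.+1%:R `^ (2 : R))^-1)) 1;
  last exact: H.
move=> n n0; have nR : (0 : R) < n%:R by rewrite ltr0n.
rewrite /series /= big_nat_recr //= addrAC subrr add0r powR_mulrn // ger0_norm; last first.
  by rewrite invr_ge0 exprn_ge0.
rewrite div1r lef_pV2 ?posrE ?mulr_gt0 ?exprn_gt0 ?ltr0n // expr2.
by rewrite ler_wpM2r // ler_nat.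
Qed.

(* Convolutions are written with the increments of one sequence and the
   partial sums of the other: the i-th increment [B i.+1 - B i] is the
   (i+1)-st term. *)
Lemma conv_increment (R : realType) (b B : nat -> R) (N : nat) : B 0%N = 0 ->
  \sum_(0 <= i < N.+1) b i * B (N.+1 - i.+1)%N - \sum_(0 <= i < N) b i * B (N - i.+1)%N =
  \sum_(0 <= i < N) b i * (B (N - i.+1).+1 - B (N - i.+1)%N).
Proof.
move=> B0; rewrite big_nat_recr //= subnn B0 mulr0 addr0 -sumrB.
apply: eq_big_nat => i /andP[_ iN]; rewrite mulrBr.
by congr (_ * B _ - _); rewrite subSS -subSn.
Qed.

(** Commutativity of convolution, by induction on N: raising N adds the convolution of the two
    sequences of increments, symmetric under reversal of the index. It allows the two factors to be
    replaced by harmonic numbers one after the other. *)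
Lemma conv_symm (R : realType) (B B' : nat -> R) (N : nat) :
  B 0%N = 0 -> B' 0%N = 0 ->
  \sum_(0 <= i < N) (B i.+1 - B i) * B' (N - i.+1)%N =
  \sum_(0 <= i < N) (B' i.+1 - B' i) * B (N - i.+1)%N.
Proof.
move=> B0 B0'; elim: N => [|N IH]; first by rewrite !big_geq.
have h1 := conv_increment R (fun i => B i.+1 - B i) B' N B0'.
have h2 := conv_increment R (fun i => B' i.+1 - B' i) B N B0.
have h3 : \sum_(0 <= i < N) (B i.+1 - B i) * (B' (N - i.+1).+1 - B' (N - i.+1)%N) =
  \sum_(0 <= i < N) (B' i.+1 - B' i) * (B (N - i.+1).+1 - B (N - i.+1)%N).
  rewrite big_nat_rev /=; apply: eq_big_nat => i /andP[_ iN]; rewrite mulrC add0n.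
  by have -> : (N - (N - i.+1).+1 = i)%N by lia.
by rewrite -(subrK (\sum_(0 <= i < N) (B i.+1 - B i) * B' (N - i.+1)%N) (\sum_(0 <= i < N.+1) _))
  h1 h3 IH -h2 subrK.
Qed.

(** Partial fractions: 1/(ij) = (1/i + 1/j)/(i + j), with i + j = N + 1 throughout. *)
Lemma sum_inv_pair (R : realType) (N : nat) :
  \sum_(0 <= i < N) (i.+1%:R * (N - i)%:R)^-1 = 2 * series harmonic N / N.+1%:R :> R.
Proof.
have -> : \sum_(0 <= i < N) (i.+1%:R * (N - i)%:R)^-1 =
  \sum_(0 <= i < N) (i.+1%:R^-1 + (N - i)%:R^-1) / N.+1%:R :> R.
  apply: eq_big_nat => i /andP[_ iN].
  have a0 : (0 : R) < i.+1%:R by rewrite ltr0n.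
  have b0 : (0 : R) < (N - i)%:R by rewrite ltr0n subn_gt0.
  have -> : N.+1%:R = i.+1%:R + (N - i)%:R :> R by rewrite -natrD; congr _%:R; lia.
  move: (i.+1%:R : R) ((N - i)%:R : R) a0 b0 => x y a0 b0; field.
  by apply/and3P; split; apply: lt0r_neq0; lra.
rewrite -mulr_suml big_split /=.
have -> : \sum_(0 <= i < N) (N - i)%:R^-1 = series harmonic N :> R.
  rewrite big_nat_rev /=; apply: eq_big_nat => i /andP[_ iN]; rewrite add0n /harmonic /=.
  by have -> : (N - (N - i.+1) = i.+1)%N by lia.
by rewrite -[X in X + _]/(series harmonic N) mulr_natl.
Qed.

(** Raising N by one adds 2 H_N/(N+1) to the left side, and this is H_(N+1)^2 - H_N^2 -
    1/(N+1)^2. *)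
Lemma conv_harmonic (R : realType) (N : nat) :
  \sum_(0 <= i < N) i.+1%:R^-1 * series harmonic (N - i.+1)%N =
  series harmonic N ^+ 2 - \sum_(0 <= k < N) k.+1%:R ^- 2 :> R.
Proof.
elim: N => [|N IH]; first by rewrite /series /= !big_geq // expr0n subrr.
have H0 : series (@harmonic R) 0 = 0 by rewrite /series /= big_geq.
have := conv_increment R (fun i => i.+1%:R^-1) (series harmonic) N H0.
have -> : \sum_(0 <= i < N) i.+1%:R^-1 *
    (series harmonic (N - i.+1)%N.+1 - series harmonic (N - i.+1)%N) =
    \sum_(0 <= i < N) (i.+1%:R * (N - i)%:R)^-1 :> R.
  apply: eq_big_nat => i /andP[_ iN]; rewrite /series /= big_nat_recr //= addrAC subrr add0r.
  by rewrite /harmonic /= invfM; congr (_ * _%:R^-1); lia.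
rewrite sum_inv_pair IH => /eqP; rewrite subr_eq => /eqP ->.
have -> : series harmonic N.+1 = series harmonic N + N.+1%:R^-1 :> R.
  by rewrite /series /= big_nat_recr.
by rewrite big_nat_recr //= -exprVn; lrai.
Qed.

Section Convolution.
Variables (R : realType) (A : nat -> R) (c C : R).
Let H := series (@harmonic R).
Hypothesis A0 : A 0%N = 0.
Hypothesis A_incr : forall n, A n <= A n.+1.
Hypothesis AHc : forall N, (0 < N)%N -> `|A N - H N - c| <= C / N%:R.
Let E N := A N - H N - c.
(** Makes the bound on [E] valid at N = 0 as well, with N + 1 in the denominator: [E 0] is -c, and
    1/N <= 2/(N+1). *)
Let C1 := 2 * C + `|c|.

Let C0 : 0 <= C.
Proof. by have := AHc 1%N isT; rewrite divr1; apply: le_trans. Qed.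

Let H0 : H 0%N = 0. Proof. by rewrite /H /series /= big_geq. Qed.
Let HS n : H n.+1 - H n = n.+1%:R^-1.
Proof. by rewrite /H /series /= big_nat_recr //= addrAC subrr add0r. Qed.

Let E_le N : `|E N| <= C1 / N.+1%:R.
Proof.
case: N => [|N].
  by rewrite /E A0 H0 subrr sub0r normrN divr1 /C1; have := C0; lra.
apply: (le_trans (AHc N.+1 isT)); rewrite ler_pdivrMr ?ltr0n // mulrAC.
rewrite ler_pdivlMr ?ltr0n // /C1 -!natr1.
have := ler0n R N; set x := N%:R => x0.
have := C0 => h; have := normr_ge0 c => h2; nra.
Qed.

Lemma increment_le n : A n.+1 - A n <= (1 + 2 * C1) / n.+1%:R.
Proof.
have := E_le n; have := E_le n.+1; rewrite !ler_norml => /andP[_ h1] /andP[h2 _].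
have n1 : (0 : R) < n.+1%:R by rewrite ltr0n.
have C10 : 0 <= C1 by rewrite /C1 addr_ge0 // mulr_ge0.
have h3 : C1 / n.+2%:R <= C1 / n.+1%:R.
  by rewrite ler_wpM2l // lef_pV2 ?posrE ?ltr0n // ler_nat.
have -> : A n.+1 - A n = n.+1%:R^-1 + E n.+1 - E n by rewrite -HS /E; lra.
by rewrite mulrDl div1r; lrai.
Qed.

(** Exchanges [A] for [H] + c in the second factor; the errors C1/(N-i) against K/(i+1) are summed
    by [sum_inv_pair]. It is applied to the increments of [A], then, after [conv_symm], to
    1/(i+1). *)
Let conv_err (b : nat -> R) (K : R) N : (forall i, 0 <= b i) ->
  (forall i, b i <= K / i.+1%:R) ->
  `|\sum_(0 <= i < N) b i * A (N - i.+1)%N -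
    (\sum_(0 <= i < N) b i * H (N - i.+1)%N + c * \sum_(0 <= i < N) b i)|
  <= K * C1 * (2 * H N / N.+1%:R).
Proof.
move=> b0 bK; rewrite mulr_sumr -big_split /= -sumrB.
apply: (le_trans (ler_norm_sum _ _ _)); rewrite -sum_inv_pair mulr_sumr.
rewrite big_nat [leRHS]big_nat; apply: ler_sum => i /andP[_ iN].
have -> : b i * A (N - i.+1)%N - (b i * H (N - i.+1)%N + c * b i) = b i * E (N - i.+1)%N.
  by rewrite /E; lra.
rewrite normrM (ger0_norm (b0 i)).
have := E_le (N - i.+1)%N; have -> : (N - i.+1).+1 = (N - i)%N by lia.
move=> h; have -> : K * C1 / (i.+1%:R * (N - i)%:R) = K / i.+1%:R * (C1 / (N - i)%:R).
  by rewrite invfM; lrai.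
by apply: ler_pM => //; exact: bK.
Qed.

Lemma conv_asymp : exists D, forall N, (0 < N)%N ->
  `|\sum_(0 <= i < N) (A i.+1 - A i) * A (N - i.+1)%N
    - ((ln N%:R + (euler_gamma R + c)) ^+ 2 - zeta 2)| <= D * (1 + ln N%:R) / N%:R.
Proof.
set g := euler_gamma R.
have C10 : 0 <= C1 by rewrite /C1 addr_ge0 // mulr_ge0.
exists ((1 + 2 * C1) * C1 * 2 + C1 * 2 + `|c| * C + 1 + (2 + `|g| + 2 * `|c|) + `|g|) => N N0.
have NR : (0 : R) < N%:R by rewrite ltr0n.
have e1 := conv_err (fun i => A i.+1 - A i) _ N (fun i => ltac:(by rewrite subr_ge0)) increment_le.
have e2 := conv_err (fun i => i.+1%:R^-1) 1 N (fun i => ltac:(by rewrite invr_ge0))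
  (fun i => ltac:(by rewrite div1r)).
have e3 := zeta2_rate R N N0; have e4 := harmonic_ln R N N0; have e5 := AHc N N0.
have e6 := conv_harmonic R N.
have sA : \sum_(0 <= i < N) (A i.+1 - A i) = A N by rewrite telescope_sumr // A0 subr0.
have sH : \sum_(0 <= i < N) i.+1%:R^-1 = H N :> R by [].
have symm : \sum_(0 <= i < N) (A i.+1 - A i) * H (N - i.+1)%N =
    \sum_(0 <= i < N) i.+1%:R^-1 * A (N - i.+1)%N.
  by rewrite (conv_symm R A H N A0 H0); apply: eq_bigr => i _; rewrite HS.
rewrite sA symm in e1; rewrite sH e6 in e2.
move: e1 e2 e3 e4; rewrite -/H -/g.
set S := \sum_(0 <= i < N) (A _ - _) * _; set T := \sum_(0 <= i < N) _^-1 * _.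
set Z := \sum_(0 <= i < N) _ ^- 2; set L := ln N%:R.
move=> e1 e2 e3 e4.
have L0 : 0 <= L by exact: ln_nat_ge0.
have H1 : H N <= 1 + L by exact: harmonic_le.
have H0' : 1 <= H N by exact: harmonic_ge1.
set W := (1 + L) / N%:R.
have v0 : 0 < N%:R^-1 :> R by rewrite invr_gt0.
have W0 : N%:R^-1 <= W by rewrite /W ler_peMl ?(ltW v0) //; lra.
have HW : 2 * H N / N.+1%:R <= 2 * W.
  rewrite /W -!mulrA ler_wpM2l // ler_pM // ?invr_ge0 //; first lra.
  by rewrite lef_pV2 ?posrE ?ltr0n // ler_nat.
have k1 : 0 <= (1 + 2 * C1) * C1 by rewrite mulr_ge0 // addr_ge0 // mulr_ge0.
have k2 : 0 <= 1 * C1 by rewrite mul1r.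
have f1 := le_trans e1 (ler_wpM2l k1 HW).
have f2 := le_trans e2 (ler_wpM2l k2 HW).
have f3 := le_trans e3 W0.
have f4 : `|c * (A N - H N - c)| <= `|c| * (C * W).
  rewrite normrM ler_wpM2l // (le_trans e5) // ler_wpM2l //.
have f5 : `|(H N - L - g) * (H N + L + g + 2 * c)| <= (2 + `|g| + 2 * `|c|) * W.
  have q : `|H N + L + g + 2 * c| <= (2 + `|g| + 2 * `|c|) * (1 + L).
    apply: (@le_trans _ _ (H N + L + `|g| + 2 * `|c|)).
      apply: (le_trans (ler_normD _ _)); rewrite normrM (ger0_norm (x := 2)) //.
      rewrite lerD2r (le_trans (ler_normD _ _)) // lerD2r ger0_norm //; lra.
    have : 0 <= `|g| * L by rewrite mulr_ge0.
    have : 0 <= `|c| * L by rewrite mulr_ge0.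
    lra.
  rewrite normrM; apply: (le_trans (ler_pM _ _ e4 q)) => //.
  by rewrite mulrC /W mulrA.
(* The first two brackets exchange [A] for [H] + c in one factor each, leaving H^2 - Z + c H + c A.
   The fourth term turns c A into c (H + c), and the fifth is (H + c)^2 - (L + g + c)^2. *)
have -> : S - ((L + (g + c)) ^+ 2 - zeta 2) = (S - (T + c * A N)) +
  (T - (H N ^+ 2 - Z + c * H N)) - (Z - zeta 2) + c * (A N - H N - c) +
  (H N - L - g) * (H N + L + g + 2 * c) by lra.
rewrite -mulrA -/W.
have := normr_ge0 g => g0.
have gW : 0 <= `|g| * W by rewrite mulr_ge0 //; lra.
move: f1 f2 f3 f4 f5; rewrite !ler_norml.
move=> /andP[f1 f1'] /andP[f2 f2'] /andP[f3 f3'] /andP[f4 f4'] /andP[f5 f5'].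
apply/andP; split; lra.
Qed.
End Convolution.

(** * Counting h-full numbers prime to given primes *)

(* The cofactors b in the decomposition n = a^h b of an h-full n. *)
Definition mid_full (h n : nat) : bool := full_set (fun e => (h < e < h.*2)%N) n.

Definition avoids (s : seq nat) (n : nat) : bool := all (fun p => ~~ (p %| n)%N) s.

Lemma hfull_full_set (h n : nat) : hfull h n = full_set (leq h) n.
Proof. by []. Qed.

Lemma full_setP (A : pred nat) (n : nat) :
  reflect ((0 < n)%N /\ forall p, prime p -> (p %| n)%N -> A (logn p n)) (full_set A n).
Proof.
apply: (iffP andP) => [[n0 /allP H]|[n0 H]]; split=> //.
  by move=> p pp pn; apply: H; rewrite mem_primes pp n0.
by apply/allP => p; rewrite mem_primes => /and3P[pp _]; exact: H.
Qed.

Lemma mid_full_hfull (h n : nat) : mid_full h n -> hfull h.+1 n.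
Proof.
move=> /full_setP[n0 H]; rewrite hfull_full_set; apply/full_setP; split=> // p pp pn.
by have /andP[] := H p pp pn.
Qed.

Lemma mid_full_logn (h n p : nat) : mid_full h n ->
  logn p n = 0%N \/ (h < logn p n < h.*2)%N.
Proof.
move=> /full_setP[n0 H]; have [->|] := posnP (logn p n); first by left.
rewrite logn_gt0 mem_primes => /and3P[pp _ pn]; right; exact: H.
Qed.

Lemma hfull_mul_mid (h a b : nat) : (0 < a)%N -> mid_full h b -> hfull h (a ^ h * b).
Proof.
move=> a0 Bb; have /full_setP[b0 _] := Bb.
rewrite hfull_full_set; apply/full_setP; split=> [|p pp].
  by rewrite muln_gt0 expn_gt0 a0 b0.
rewrite Euclid_dvdM // lognM ?expn_gt0 ?a0 // lognX.
have [lb|/andP[hb _]] := mid_full_logn _ _ p Bb; last first.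
  by move=> _; rewrite (leq_trans (ltnW hb)) // leq_addl.
rewrite lb addn0 => /orP[|pb].
  by rewrite Euclid_dvdX // => /andP[pa _]; rewrite leq_pmulr // logn_gt0 mem_primes pp a0.
have : (0 < logn p b)%N by rewrite logn_gt0 mem_primes pp b0.
by rewrite lb.
Qed.

(** The admissible exponents 0, h+1, ..., 2h-1 of b are pairwise incongruent modulo h, so b is
    determined prime by prime, and then a. *)
Lemma mid_full_uniq (h a b a' b' : nat) : (0 < h)%N -> (0 < a)%N -> (0 < a')%N ->
  mid_full h b -> mid_full h b' -> (a ^ h * b = a' ^ h * b')%N -> a = a' /\ b = b'.
Proof.
move=> h0 a0 a0' Bb Bb' E.
have /full_setP[b0 _] := Bb; have /full_setP[b0' _] := Bb'.
have bb : b = b'.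
  apply: eqn_from_log => // p.
  have := congr1 (logn p) E; rewrite !lognM ?expn_gt0 ?a0 ?a0' // !lognX.
  have := mid_full_logn _ _ p Bb; have := mid_full_logn _ _ p Bb'.
  move: (logn p a) (logn p a') (logn p b) (logn p b') => x y u v Hv Hu Exy.
  have [xy|xy|xy] := ltngtP x y; last by move: Exy; rewrite xy => /addnI.
  - have : (h * x.+1 <= h * y)%N by rewrite leq_mul2l xy orbT.
    have [y1|y1] := leqP y x.+1.
      have Ey : y = x.+1 by lia.
      by rewrite Ey mulnS in Exy; lia.
    have : (h * x.+2 <= h * y)%N by rewrite leq_mul2l y1 orbT.
    by rewrite !mulnS in Exy *; lia.
  - have [y1|y1] := leqP x y.+1.
      have Ex : x = y.+1 by lia.
      by rewrite Ex mulnS in Exy; lia.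
    have : (h * y.+2 <= h * x)%N by rewrite leq_mul2l y1 orbT.
    by rewrite !mulnS in Exy *; lia.
split=> //; move/eqP: E; rewrite bb eqn_pmul2r // eqn_exp2r // => /eqP //.
Qed.

Lemma hfull_decomp (h n : nat) : (0 < h)%N -> hfull h n ->
  exists a b, [/\ (0 < a)%N, mid_full h b & (a ^ h * b = n)%N].
Proof.
move=> h0; rewrite hfull_full_set => Hn.
have n0 : (0 < n)%N by case/andP: Hn.
have := smooth_lt n.+1 n n0 (ltnSn n); move: n.+1 => N.
elim: N n n0 Hn => [|N IH] n n0 Hn sn.
  exists 1%N, 1%N; split=> //; move: sn; rewrite smooth0 => /eqP ->.
  by rewrite exp1n.
have [pN|pN] := boolP (prime N); last by apply: IH; rewrite // -smoothS.
have [i [m [_ /andP[m0 _] sm E]]] := smooth_split _ _ pN sn.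
have cNm := smooth_coprime _ _ pN sm.
move: Hn; rewrite -E full_setMp // => /andP[iA Hm].
have [a [b [a0 Bb abm]]] := IH m m0 Hm sm.
have cNb : coprime N b by move: cNm; rewrite -abm coprimeMr => /andP[].
have N0 := prime_gt0 pN.
have iE := divn_eq i h; have rh := ltn_pmod i h0.
set j := (i %/ h)%N in iE; set r := (i %% h)%N in iE rh.
have [r0|r0] := posnP r.
  exists (N ^ j * a)%N, b; split=> //; first by rewrite muln_gt0 expn_gt0 N0.
  by rewrite expnMn -expnM -mulnA abm iE r0 addn0.
(* With remainder r > 0, one block of h is moved from a to b, so that the exponent h + r in b falls
   strictly between h and 2h. The block exists because i >= h. *)
have j0 : (0 < j)%N.
  by case: (posnP j) => // j0; move: iA iE; rewrite j0 => /orP[/eqP|]; lia.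
exists (N ^ j.-1 * a)%N, (N ^ (h + r) * b)%N; split.
- by rewrite muln_gt0 expn_gt0 N0.
- rewrite /mid_full full_setMp //; apply/andP; split=> //.
  by apply/orP; right; lia.
- rewrite expnMn -expnM -mulnA [(a ^ h * _)%N]mulnCA abm mulnA -expnD.
  by congr (_ ^ _ * _)%N; rewrite iE -{2}(prednK j0) mulSn; lia.
Qed.

Lemma rootXK (R : realType) (h : nat) (x : R) : (0 < h)%N -> 0 <= x ->
  (x `^ h%:R^-1) ^+ h = x.
Proof.
move=> h0 x0; rewrite -powR_mulrn ?powR_ge0 // -powRrM mulVf ?powRr1 //.
by rewrite pnatr_eq0 -lt0n.
Qed.

Lemma rootKX (R : realType) (h : nat) (x : R) : (0 < h)%N -> 0 <= x ->
  (x ^+ h) `^ h%:R^-1 = x.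
Proof.
move=> h0 x0; rewrite -powR_mulrn // -powRrM mulfV ?powRr1 //.
by rewrite pnatr_eq0 -lt0n.
Qed.

Lemma avoidsM (s : seq nat) (a b : nat) : all prime s ->
  avoids s (a * b) = avoids s a && avoids s b.
Proof.
move=> ps; rewrite /avoids -all_predI; apply: eq_in_all => p /(allP ps) pp /=.
by rewrite Euclid_dvdM // negb_or.
Qed.

Lemma avoidsX (s : seq nat) (a h : nat) : all prime s -> (0 < h)%N ->
  avoids s (a ^ h) = avoids s a.
Proof.
move=> ps h0; apply: eq_in_all => p /(allP ps) pp.
by rewrite Euclid_dvdX // h0 andbT.
Qed.

Lemma avoids_prime (s : seq nat) (p : nat) : all prime s -> prime p ->
  avoids s p = (p \notin s).
Proof.
move=> ps pp; apply/allP/idP => [H|pns q qs].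
  by apply/negP => /H; rewrite dvdnn.
rewrite dvdn_prime2 //; last exact: (allP ps).
by apply: contraNneq pns => <-.
Qed.

Section AvoidCount.
Variable R : realType.

Definition avoid_count (s : seq nat) (K : nat) : R :=
  \sum_(0 <= a < K.+1 | (0 < a)%N && avoids s a) 1.

Lemma avoid_count_cons (p : nat) (s : seq nat) (K : nat) :
  prime p -> all prime s -> p \notin s ->
  avoid_count (p :: s) K = avoid_count s K - avoid_count s (K %/ p).
Proof.
move=> pp ps pns; have p0 := prime_gt0 pp.
apply/eqP; rewrite eq_sym subr_eq; apply/eqP.
rewrite /avoid_count (bigID (fun a => p %| a)%N) /= addrC; congr (_ + _).
  by apply: eq_bigl => a; rewrite -andbA [avoids s a && _]andbC.
rewrite (@sum_reindex_pairs _ K.+1 1 (K %/ p).+1 _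
  (fun i m => [&& i == 0%N, 0 < m & avoids s m]%N) (fun i m => p * m)%N).
- by rewrite big_nat1; apply: eq_bigl => m.
- move=> n nK /andP[/andP[n0 an] /dvdnP[m nE]]; exists 0%N, m; split=> //.
  + by rewrite ltnS leq_divRL // -nE.
  + move: an n0; rewrite nE avoidsM // muln_gt0 => /andP[-> _] /andP[-> _] //.
  + by rewrite nE mulnC.
- move=> i m _ mK /and3P[_ m0 am]; rewrite ltnS mulnC -leq_divRL // -ltnS mK /=.
  by rewrite muln_gt0 m0 p0 avoidsM // am avoids_prime // pns dvdn_mull.
- move=> i m i' m' /and3P[/eqP -> _ _] /and3P[/eqP -> _ _] /eqP.
  by rewrite eqn_pmul2l // => /eqP.
Qed.

(** Inclusion-exclusion one prime at a time: the rounding error 1 doubles with each prime. The bound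
    depends only on the number of primes, which is where the uniformity in p and q comes from. *)
Lemma avoid_count_close (s : seq nat) (Y : R) (K : nat) :
  all prime s -> uniq s -> K%:R <= Y < K.+1%:R ->
  `|avoid_count s K - Y * \prod_(p <- s) (1 - p%:R^-1)| <= 2 ^+ size s.
Proof.
elim: s Y K => [|p s IH] Y K.
  move=> _ _ /andP[KY YK]; rewrite big_nil mulr1 expr0 /avoid_count.
  have -> : \sum_(0 <= a < K.+1 | (0 < a)%N && avoids [::] a) 1 = K%:R :> R.
    rewrite big_mkcond big_nat_recl //= add0r big_mkord sumr_const card_ord //.
  by rewrite -natr1 in YK; rewrite distrC ger0_norm; lra.
move=> /= /andP[pp ps] /andP[pns us] KY; rewrite avoid_count_cons //.
have p1 : (0 : R) < p%:R by rewrite ltr0n prime_gt0.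
have KY' : (K %/ p)%:R <= Y / p%:R < (K %/ p).+1%:R.
  move: KY => /andP[K1 K2]; rewrite ler_pdivlMr // ltr_pdivrMr //; apply/andP; split.
    by apply: le_trans K1; rewrite -natrM ler_nat leq_trunc_div.
  apply: (lt_le_trans K2); rewrite -natrM ler_nat.
  by rewrite {1}(divn_eq K p) mulSn addnC -addSn leq_add2r ltn_mod prime_gt0.
have h1 := IH _ _ ps us KY; have h2 := IH _ _ ps us KY'.
rewrite big_cons exprS; set X := \prod_(_ <- _) _ in h1 h2 *.
have -> : avoid_count s K - avoid_count s (K %/ p) - Y * ((1 - p%:R^-1) * X) =
  (avoid_count s K - Y * X) - (avoid_count s (K %/ p) - Y / p%:R * X) by lra.
apply: (le_trans (ler_normB _ _)); lra.
Qed.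
End AvoidCount.

Section HfullCount.
Variables (R : realType) (h : nat).
Hypothesis h0 : (0 < h)%N.

Definition root_inv (n : nat) : R := (n%:R `^ h%:R^-1)^-1.

Definition hfull_count (s : seq nat) (M : nat) : R :=
  \sum_(0 <= n < M.+1 | hfull h n && avoids s n) 1.

Definition mid_count (M : nat) : R := \sum_(0 <= b < M.+1 | mid_full h b) 1.

Definition mid_weight (s : seq nat) (M : nat) : R :=
  \sum_(0 <= b < M.+1 | mid_full h b && avoids s b) root_inv b.

Lemma hfull_count_decomp (s : seq nat) (M : nat) : all prime s ->
  hfull_count s M = \sum_(0 <= b < M.+1 | mid_full h b && avoids s b)
    \sum_(0 <= a < M.+1 | ((0 < a)%N && avoids s a) && (a ^ h * b <= M)%N) 1.
Proof.
move=> ps; rewrite /hfull_count (@sum_reindex_pairs _ M.+1 M.+1 M.+1 _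
  (fun b a => [&& mid_full h b && avoids s b, (0 < a)%N && avoids s a & a ^ h * b <= M]%N)
  (fun b a => a ^ h * b)%N).
- rewrite [RHS]big_mkcond; apply: eq_bigr => b _.
  by case: (mid_full h b && avoids s b) => //=; rewrite big_pred0.
- move=> n nM /andP[/(hfull_decomp _ _ h0)[a [b [a0 Bb E]]] an].
  have b0 : (0 < b)%N by case/full_setP: Bb.
  move: an; rewrite -E avoidsM // avoidsX // => /andP[aa ab].
  exists b, a; split=> //.
  + by apply: leq_ltn_trans nM; rewrite -E leq_pmull // expn_gt0 a0.
  + apply: leq_ltn_trans nM; rewrite -E (leq_trans _ (leq_pmulr _ b0)) //.
    by rewrite -{1}(expn1 a) leq_pexp2l.
  + by rewrite Bb aa ab a0 E -ltnS nM.
- move=> b a _ _ /and3P[/andP[Bb ab] /andP[a0 aa] abM]; rewrite ltnS abM.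
  by rewrite hfull_mul_mid // avoidsM // avoidsX // aa ab.
- move=> b a b' a' /and3P[/andP[Bb _] /andP[a0 _] _] /and3P[/andP[Bb' _] /andP[a0' _] _].
  by move/(mid_full_uniq _ _ _ _ _ h0 a0 a0' Bb Bb') => [-> ->].
Qed.

Lemma root_count (s : seq nat) (y : R) (b : nat) : 0 <= y -> (0 < b)%N ->
  \sum_(0 <= a < (Num.truncn y).+1 |
     ((0 < a)%N && avoids s a) && (a ^ h * b <= Num.truncn y)%N) 1 =
  avoid_count R s (Num.truncn (y `^ h%:R^-1 * root_inv b)).
Proof.
move=> y0 b0; set Y := y `^ _ * _; set K := Num.truncn Y.
have bR : (0 : R) < b%:R by rewrite ltr0n.
have Y0 : 0 <= Y by rewrite mulr_ge0 ?invr_ge0 ?powR_ge0.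
have hV : 0 <= h%:R^-1 :> R by rewrite invr_ge0.
have YE : Y = (y / b%:R) `^ h%:R^-1.
  rewrite /Y /root_inv powRM ?invr_ge0 //; congr (_ * _).
  by rewrite -powR_inv1 // -powRAC powR_inv1 // powR_ge0.
have aK a : (a ^ h * b <= Num.truncn y)%N = (a < K.+1)%N.
  rewrite ltnS /K !truncn_ge_nat // natrM natrX -ler_pdivlMr // YE.
  apply/idP/idP => H.
    by rewrite -(rootKX R h a%:R) // ler_powRl // exprn_ge0.
  by rewrite -(rootXK R h (y / b%:R)) // ?divr_ge0 // lerXn2r // nnegrE // powR_ge0.
under eq_bigl do rewrite aK.
rewrite /avoid_count -big_nat_widen // ltnS.
have := aK K; rewrite ltnS leqnn => KM.
apply: leq_trans KM; apply: leq_trans (leq_pmulr _ b0).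
by case: {aK} K => // K; rewrite -{1}(expn1 K.+1) leq_pexp2l.
Qed.

Lemma hfull_count_close (s : seq nat) (y : R) : all prime s -> uniq s -> 0 <= y ->
  `|hfull_count s (Num.truncn y) -
     y `^ h%:R^-1 * \prod_(p <- s) (1 - p%:R^-1) * mid_weight s (Num.truncn y)|
  <= 2 ^+ size s * mid_count (Num.truncn y).
Proof.
move=> ps us y0; rewrite hfull_count_decomp //.
rewrite /mid_weight /mid_count !mulr_sumr -sumrB.
apply: (le_trans (ler_norm_sum _ _ _)).
rewrite [leRHS]big_mkcond [leLHS]big_mkcond /=.
apply: ler_sum => b _; case: ifPn => [/andP[Bb ab]|_]; last first.
  by case: ifP => // _; rewrite mulr1 exprn_ge0.
rewrite Bb mulr1 root_count //; last by case/full_setP: Bb.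
have -> : y `^ h%:R^-1 * \prod_(p <- s) (1 - p%:R^-1) * root_inv b =
  (y `^ h%:R^-1 * root_inv b) * \prod_(p <- s) (1 - p%:R^-1) by rewrite mulrAC.
apply: avoid_count_close => //; apply: truncn_itv.
by rewrite mulr_ge0 ?invr_ge0 ?powR_ge0.
Qed.

(** A crude upper bound, used at h + 1 to count the cofactors b, which are (h+1)-full. *)
Lemma hfull_count_le (M : nat) :
  hfull_count [::] M <= M%:R `^ h%:R^-1 * mid_weight [::] M.
Proof.
have := hfull_count_decomp [::] M isT => ->.
rewrite /mid_weight mulr_sumr; apply: ler_sum => b /andP[Bb _].
have b0 : (0 < b)%N by case/full_setP: Bb.
have := root_count [::] M%:R b (ler0n R M) b0; rewrite natrK => ->.
set Y := _ * _; have Y0 : 0 <= Y by rewrite mulr_ge0 ?invr_ge0 ?powR_ge0.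
rewrite /avoid_count big_mkcond big_nat_recl //= add0r big_mkord sumr_const card_ord.
by rewrite truncn_le.
Qed.
End HfullCount.

(** * The Euler product of the cofactors *)

Section MidEuler.
Variables (R : realType) (h : nat).
Hypothesis h0 : (0 < h)%N.
Let v (p : nat) : R := root_inv R h p.

(** The Euler factor at p of the cofactors b weighted by b^(-1/h). [local_factor_closed] sums the
    geometric progression and recovers the factor of [gamma0]. *)
Definition local_factor (p : nat) : R := 1 + \sum_(h.+1 <= j < h.*2) v p ^+ j.

Lemma root_inv_gt0 n : (0 < n)%N -> 0 < v n.
Proof. by move=> n0; rewrite /v /root_inv invr_gt0 powR_gt0 // ltr0n. Qed.

Lemma root_inv_ge0 n : 0 <= v n.
Proof. by rewrite /v /root_inv invr_ge0 powR_ge0. Qed.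

Lemma root_inv_le1 n : (0 < n)%N -> v n <= 1.
Proof.
move=> n0; rewrite /v /root_inv invf_le1 ?powR_gt0 ?ltr0n //.
by rewrite -[leLHS](powRr0 n%:R) ler_powR ?ler1n // invr_ge0.
Qed.

Lemma root_inv_powRN n : v n = n%:R `^ (- h%:R^-1).
Proof. by rewrite powRN. Qed.

Lemma root_invM m n : v (m * n)%N = v m * v n.
Proof. by rewrite /v /root_inv natrM powRM // invfM. Qed.

Lemma root_invX p j : v (p ^ j)%N = v p ^+ j.
Proof. by rewrite /v /root_inv natrX_powR exprVn. Qed.

Lemma root_invXh p : v p ^+ h = p%:R^-1.
Proof. by rewrite /v /root_inv exprVn rootXK. Qed.

Lemma local_factor_ge1 p : 1 <= local_factor p.
Proof. by rewrite lerDl sumr_ge0 // => j _; rewrite exprn_ge0 // root_inv_ge0. Qed.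

Lemma local_factor_le p : prime p ->
  local_factor p <= 1 + h%:R * p%:R `^ (- (1 + h%:R^-1)).
Proof.
move=> pp; have p0 := prime_gt0 pp; have pR : (0 : R) < p%:R by rewrite ltr0n.
rewrite lerD2l; have -> : p%:R `^ (- (1 + h%:R^-1)) = v p ^+ h.+1.
  rewrite exprSr root_invXh root_inv_powRN opprD powRD; last by rewrite (gt_eqF pR) implybT.
  by rewrite powR_inv1 // ltW.
apply: (@le_trans _ _ (\sum_(h.+1 <= j < h.*2) v p ^+ h.+1)).
  rewrite big_seq [leRHS]big_seq; apply: ler_sum => j; rewrite mem_index_iota => /andP[hj _].
  by rewrite ler_wiXn2l // ?root_inv_ge0 ?root_inv_le1.
rewrite sumr_const_nat -[leLHS]mulr_natl ler_wpM2r ?exprn_ge0 ?root_inv_ge0 //.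
by rewrite ler_nat; lia.
Qed.

Lemma local_factor_closed p : prime p ->
  1 + (p%:R - p%:R `^ h%:R^-1) / (p%:R ^+ 2 * (p%:R `^ h%:R^-1 - 1)) = local_factor p.
Proof.
move=> pp; have pR : (1 : R) < p%:R by rewrite ltr1n prime_gt1.
set q := p%:R `^ h%:R^-1.
have q1 : 1 < q.
  rewrite /q powR_expR; last lra.
  by rewrite expR_gt1 mulr_gt0 ?invr_gt0 ?ltr0n // ln_gt0.
have vE : v p = q^-1 by [].
have S : (1 - v p) * \sum_(h.+1 <= j < h.*2) v p ^+ j = v p ^+ h.+1 - v p ^+ h.*2.
  rewrite mulr_sumr (eq_bigr (fun j => - (v p ^+ j.+1 - v p ^+ j))); last first.
    by move=> j _; rewrite exprS; lra.
  by rewrite sumrN telescope_sumr ?opprB //; lia.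
have v1 : 1 - v p != 0.
  by rewrite subr_eq0 eq_sym lt_eqF // vE invf_lt1 //; lra.
rewrite /local_factor; congr (1 + _); apply: (mulfI v1); rewrite S.
rewrite -mul2n mulnC exprM [v p ^+ h.+1]exprS root_invXh vE.
by field; apply/and3P; split; apply: lt0r_neq0; lra.
Qed.

Definition lf_prod (N : nat) : R := \prod_(0 <= p < N | prime p) local_factor p.

Lemma lf_prod_mono : {homo lf_prod : m n / (m <= n)%N >-> m <= n}.
Proof.
apply/nondecreasing_seqP => n; rewrite /lf_prod [leRHS]big_mkcond big_nat_recr //=.
rewrite -big_mkcond; case: ifP => _; last by rewrite mulr1.
rewrite ler_peMr ?local_factor_ge1 // prodr_ge0 // => p _.
by apply: le_trans (local_factor_ge1 p); exact: ler01.
Qed.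

(** 1 + u <= exp u turns the product into a prime sum. Of the two factors h, one bounds the number
    of terms in [local_factor], the other the sum of p^(-(1+1/h)). *)
Lemma lf_prod_le N : lf_prod N <= expR (h%:R * h%:R).
Proof.
apply: (@le_trans _ _ (expR (h%:R * \sum_(0 <= p < N | prime p) p%:R `^ (- (1 + h%:R^-1))))).
  rewrite mulr_sumr expR_sum; apply: ler_prod => p pp.
  rewrite (le_trans ler01 (local_factor_ge1 p)) /=.
  by apply: (le_trans (local_factor_le p pp)); exact: expR_ge1Dx.
rewrite ler_expR ler_wpM2l //.
by have := @prime_powR_sum_le R h%:R^-1 N; rewrite invrK; apply; rewrite invr_gt0 ltr0n.
Qed.

Lemma lf_prod_cvg : lf_prod @ \oo --> gamma0 R h.
Proof.
have c : cvgn lf_prod.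
  apply: nondecreasing_is_cvgn; first exact: lf_prod_mono.
  by exists (expR (h%:R * h%:R)) => _ [N _ <-]; exact: lf_prod_le.
rewrite /gamma0 /prime_prod.
rewrite (_ : (fun n => _) = lf_prod); first exact: c.
by apply/funext => N; apply: eq_bigr => p; exact: local_factor_closed.
Qed.

Lemma lf_prod_le_gamma0 N : lf_prod N <= gamma0 R h.
Proof.
have c := lf_prod_cvg; rewrite -(cvg_lim _ c) //.
apply: nondecreasing_cvgn_le; first exact: lf_prod_mono.
by apply/cvg_ex; eexists; exact: c.
Qed.

Lemma gamma0_ge1 : 1 <= gamma0 R h.
Proof. by have := lf_prod_le_gamma0 0; rewrite /lf_prod big_geq. Qed.

Section Avoiding.
Variable s : seq nat.
Hypothesis ps : all prime s.
Hypothesis us : uniq s.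
Let g n : R := (mid_full h n && avoids s n)%:R * v n.
Let F p : R := if p \in s then 1 else local_factor p.

Let g_ge0 n : 0 <= g n. Proof. by rewrite mulr_ge0 // root_inv_ge0. Qed.

Let mid1 : mid_full h 1. Proof. by []. Qed.
Let avoids1 : avoids s 1.
Proof. by apply/allP => p /(allP ps) pp; rewrite dvdn1; apply: contraTneq pp => ->. Qed.

Let midX p i : prime p -> mid_full h (p ^ i) = (i == 0)%N || (h < i < h.*2)%N.
Proof.
move=> pp; have := full_setMp (fun e => (h < e < h.*2)%N) p i 1 pp (coprimen1 p).
by rewrite /mid_full muln1 => ->; rewrite andbT.
Qed.

Let g1 : g 1 = 1.
Proof. by rewrite /g mid1 avoids1 mul1r /v /root_inv powR1 invr1. Qed.

Let gM p i m : prime p -> coprime p m -> g (p ^ i * m)%N = g (p ^ i)%N * g m.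
Proof.
move=> pp cpm; rewrite /g root_invM avoidsM //.
rewrite {1}/mid_full full_setMp // -(midX p i pp) -/(mid_full h m).
by case: mid_full; case: mid_full; case: avoids; case: avoids; rewrite /= ?mul1r ?mul0r ?mulr0.
Qed.

Let g_pow p j : prime p ->
  g (p ^ j)%N = if j == 0%N then 1 else if (h < j < h.*2)%N && (p \notin s) then v p ^+ j else 0.
Proof.
move=> pp; case: j => [|j]; first by rewrite expn0 g1.
rewrite /g midX // avoidsX // avoids_prime // root_invX.
by case: (h < j.+1 < h.*2)%N; case: (p \notin s); rewrite /= ?mul1r ?mul0r.
Qed.

Let g_sum p J : prime p -> (h.*2 <= J)%N -> \sum_(0 <= j < J) g (p ^ j)%N = F p.
Proof.
move=> pp hJ.
have zero a b : (forall j, (a <= j < b)%N -> (0 < j)%N && ~~ (h < j < h.*2)%N) ->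
    \sum_(a <= j < b) g (p ^ j)%N = 0.
  move=> ab; rewrite big_nat_cond big1 // => j /andP[/ab /andP[j0 /negbTE jh] _].
  by rewrite g_pow // jh gtn_eqF.
rewrite big_ltn //; last lia.
rewrite (@big_cat_nat _ _ _ h.+1 1 J) //=; last lia.
rewrite (@big_cat_nat _ _ _ h.*2 h.+1 J) //=; last lia.
rewrite (zero 1%N h.+1) ?add0r; last by move=> j jj; lia.
rewrite (zero h.*2 J) ?addr0; last by move=> j jj; lia.
rewrite /F /local_factor expn0 g1; case: ifPn => pns.
  rewrite big_nat_cond big1 ?addr0 // => j /andP[/andP[hj _] _].
  by rewrite g_pow // pns andbF gtn_eqF // (leq_ltn_trans _ hj).
congr (1 + _); apply: eq_big_nat => j jj; rewrite g_pow // jj pns.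
by case/andP: jj => hj _; rewrite gtn_eqF // (leq_ltn_trans _ hj).
Qed.

Let g_geo p : prime p -> \sum_(0 <= j < J) g (p ^ j)%N @[J --> \oo] --> F p.
Proof. by move=> pp; apply: cvg_near_cst; exists h.*2 => // J /= hJ; exact: g_sum. Qed.

Let g_le p J : prime p -> \sum_(0 <= j < J) g (p ^ j)%N <= F p.
Proof.
move=> pp; rewrite -(g_sum p (J + h.*2) pp (leq_addl _ _)).
by rewrite (@big_cat_nat _ _ _ J 0 (J + h.*2)) ?leq_addr //= lerDl sumr_ge0.
Qed.

Let lfs := \prod_(p <- s) local_factor p.
Let lfs_gt0 : 0 < lfs.
Proof. by apply: prodr_gt0 => p _; apply: lt_le_trans (local_factor_ge1 p); exact: ltr01. Qed.

Let K0 := (\max_(p <- s) p).+1.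

Let F_prod N : (K0 <= N)%N -> \prod_(0 <= p < N | prime p) F p = lf_prod N / lfs.
Proof.
move=> K0N; have sN p : p \in s -> (p < N)%N.
  by move=> q; apply: leq_trans K0N; rewrite ltnS; exact: leq_bigmax_seq.
apply: (mulIf (lt0r_neq0 lfs_gt0)); rewrite divfK ?gt_eqF //.
rewrite /lfs /F; move: us ps sN; clear; elim: s => [|q t IH] /=.
  by rewrite big_nil mulr1.
move=> /andP[qt ut] /andP[pq pt] qN.
rewrite -IH //; last by move=> p ptt; apply: qN; rewrite inE ptt orbT.
rewrite big_cons mulrA; congr (_ * _).
rewrite big_mkcond [in RHS]big_mkcond.
rewrite (bigD1_seq q) ?iota_uniq ?mem_index_iota ?qN ?inE ?eqxx //= pq mul1r.
rewrite [in RHS](bigD1_seq q) ?iota_uniq ?mem_index_iota ?qN ?inE ?eqxx //= pq (negbTE qt) mulrC.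
by congr (_ * _); apply: eq_bigr => p pneq; rewrite inE (negbTE pneq).
Qed.

Let mid_weightE M : mid_weight R h s M = \sum_(1 <= n < M.+1) g n.
Proof.
rewrite /mid_weight big_mkcond big_nat_recl //= add0r big_add1 /=.
by apply: eq_bigr => n _; rewrite /g; case: ifP; rewrite ?mul1r ?mul0r.
Qed.

Lemma mid_weight_le M : mid_weight R h s M <= gamma0 R h / lfs.
Proof.
rewrite mid_weightE; set K := maxn K0 M.+1.
apply: (@le_trans _ _ (\sum_(1 <= n < K) g n)).
  rewrite (@big_cat_nat _ _ _ M.+1 1 K) ?leq_maxr //= lerDl sumr_ge0 //.
apply: (le_trans (@euler_partial_ge R g g_ge0 g1 gM F K g_le)).
rewrite F_prod ?leq_maxl // ler_wpM2r ?invr_ge0 ?(ltW lfs_gt0) //.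
exact: lf_prod_le_gamma0.
Qed.

(** With [mid_weight_le] this identifies the total weight as [gamma0] divided by the removed
    factors. The form of a least upper bound is the one applied later, with B a partial weight plus
    a tail estimate. *)
Lemma mid_weight_sup B : (forall M, mid_weight R h s M <= B) -> gamma0 R h / lfs <= B.
Proof.
move=> MB; have gB M : \sum_(1 <= n < M) g n <= B.
  case: M => [|M]; last by rewrite -mid_weightE.
  rewrite big_geq //; apply: le_trans (MB 0%N); rewrite /mid_weight sumr_ge0 // => n _.
  exact: root_inv_ge0.
have c : (fun N => lf_prod N / lfs) @ \oo --> gamma0 R h / lfs.
  by apply: cvgMl; exact: lf_prod_cvg.
rewrite -(cvg_lim _ c) //; apply: limr_le; first by apply/cvg_ex; eexists; exact: c.
exists K0 => // N /= K0N; rewrite -F_prod //.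
exact: (@euler_prod_le R g g_ge0 g1 gM F B N g_geo gB).
Qed.
End Avoiding.
End MidEuler.

Lemma mid_count_le (R : realType) (h M : nat) : (0 < h)%N ->
  mid_count R h M <= gamma0 R h.+1 * M%:R `^ h.+1%:R^-1.
Proof.
move=> h0; apply: (@le_trans _ _ (hfull_count R h.+1 [::] M)).
  rewrite /mid_count /hfull_count big_mkcond [leRHS]big_mkcond; apply: ler_sum => b _ /=.
  by case: ifP => [/mid_full_hfull ->//|_]; case: ifP.
apply: (le_trans (hfull_count_le R h.+1 isT M)); rewrite mulrC ler_wpM2r ?powR_ge0 //.
by have := mid_weight_le R h.+1 isT [::] isT isT M; rewrite big_nil divr1.
Qed.

Section HfullAsymptotics.
Variables (R : realType) (h : nat).
Hypothesis h0 : (0 < h)%N.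
Let eta : R := h%:R^-1 - h.+1%:R^-1.
Let g1 : R := gamma0 R h.+1.

Let hR : (1 : R) <= h%:R. Proof. by rewrite ler1n. Qed.
Let g1_gt0 : 0 < g1. Proof. exact: lt_le_trans ltr01 (gamma0_ge1 R h.+1 isT). Qed.

Let eta_bounds : 0 < eta <= 1.
Proof.
have a : 0 < h.+1%:R^-1 :> R by rewrite invr_gt0.
have b : h.+1%:R^-1 < h%:R^-1 :> R by rewrite ltf_pV2 ?posrE ?ltr0n // ltr_nat.
have c : h%:R^-1 <= 1 :> R by rewrite invf_le1 // ltr0n.
by rewrite /eta; apply/andP; split; lrai.
Qed.

Let powRD' (x a b : R) : 0 < x -> x `^ (a + b) = x `^ a * x `^ b.
Proof. by move=> x0; rewrite powRD // (gt_eqF x0) implybT. Qed.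

(** Abel summation; the lower boundary term has a favourable sign and is dropped. *)
Lemma mid_abel (M K : nat) :
  \sum_(M.+1 <= n < (M + K).+1 | mid_full h n) root_inv R h n <=
  mid_count R h (M + K) * root_inv R h (M + K) +
  \sum_(M <= n < M + K) mid_count R h n * (root_inv R h n - root_inv R h n.+1).
Proof.
have B0 n : 0 <= mid_count R h n by rewrite /mid_count sumr_ge0.
elim: K => [|K IH].
  by rewrite addn0 !big_geq // addr0 mulr_ge0 ?root_inv_ge0.
rewrite addnS big_mkcond big_nat_recr ?ltnS ?leq_addr //= -big_mkcond /=.
rewrite [X in _ <= _ + X]big_nat_recr ?leq_addr //=.
have -> : mid_count R h (M + K).+1 = mid_count R h (M + K) + (mid_full h (M + K).+1)%:R.
  rewrite /mid_count big_mkcond [in RHS]big_mkcond big_nat_recr //=.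
  by case: mid_full.
have -> : (if mid_full h (M + K).+1 then root_inv R h (M + K).+1 else 0) =
  (mid_full h (M + K).+1)%:R * root_inv R h (M + K).+1.
  by case: mid_full; rewrite ?mul1r ?mul0r.
by move: IH; lra.
Qed.

(** Collects three contributions, each with a factor [g1]: the upper boundary term, the summand n =
    M, and 1/eta from the tail of the sum of n^(-(1+eta)). *)
Let tail_const : R := g1 * (2 + eta^-1).

Lemma mid_tail (s : seq nat) (M M' : nat) : (0 < M)%N ->
  mid_weight R h s M' - mid_weight R h s M <= tail_const * M%:R `^ (- eta).
Proof.
move=> M0; have /andP[e0 e1] := eta_bounds.
have MR : (0 : R) < M%:R by rewrite ltr0n.
have C0 : 0 <= tail_const * M%:R `^ (- eta).
  rewrite mulr_ge0 ?powR_ge0 // mulr_ge0 ?(ltW g1_gt0) // addr_ge0 // invr_ge0 ltW //.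
have [M'M|MM'] := leqP M' M.
  apply: le_trans C0; rewrite subr_le0 /mid_weight.
  rewrite [leRHS](@big_cat_nat _ _ _ M'.+1) //= lerDl sumr_ge0 // => i _.
  exact: root_inv_ge0.
have -> : mid_weight R h s M' - mid_weight R h s M =
    \sum_(M.+1 <= n < M'.+1 | mid_full h n && avoids s n) root_inv R h n.
  rewrite /mid_weight [X in X - _](@big_cat_nat _ _ _ M.+1) //=; last lia.
  by rewrite addrAC subrr add0r.
apply: (@le_trans _ _ (\sum_(M.+1 <= n < M'.+1 | mid_full h n) root_inv R h n)).
  rewrite big_mkcondr; apply: ler_sum => n _; case: ifP => // _; exact: root_inv_ge0.
have := mid_abel M (M' - M); rewrite subnKC ?(ltnW MM') // => /le_trans; apply.
have cle n : (0 < n)%N -> mid_count R h n <= g1 * n%:R `^ h.+1%:R^-1.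
  by move=> _; exact: mid_count_le.
have t1 : mid_count R h M' * root_inv R h M' <= g1 * M%:R `^ (- eta).
  have M'0 : (0 < M')%N by lia.
  have M'R : (0 : R) < M'%:R by rewrite ltr0n.
  apply: (le_trans (ler_wpM2r (root_inv_ge0 _ _ _) (cle _ M'0))).
  rewrite root_inv_powRN -mulrA -powRD' // ler_wpM2l ?(ltW g1_gt0) //.
  have -> : h.+1%:R^-1 + - h%:R^-1 = - eta by rewrite /eta opprB.
  rewrite !powRN lef_pV2 ?posrE ?powR_gt0 //.
  by rewrite ler_powRl ?(ltW e0) ?(ltW MR) // ler_nat ltnW.
have t2 : \sum_(M <= n < M') mid_count R h n * (root_inv R h n - root_inv R h n.+1) <=
    \sum_(M <= n < M') g1 * n%:R `^ (- (1 + eta)).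
  rewrite big_seq [leRHS]big_seq; apply: ler_sum => n; rewrite mem_index_iota => /andP[Mn _].
  have n0 : (0 < n)%N by lia.
  have nR : (0 : R) < n%:R by rewrite ltr0n.
  have hV0 : 0 <= h%:R^-1 :> R by rewrite invr_ge0.
  have d1 := powRNDiff_le R n h%:R^-1 n0 hV0; rewrite -!root_inv_powRN in d1.
  have d2 : root_inv R h n - root_inv R h n.+1 <= n%:R `^ (- (1 + h%:R^-1)).
    apply: (le_trans d1); rewrite ler_piMl ?powR_ge0 // invf_le1 // ltr0n //.
  have d0 : 0 <= root_inv R h n - root_inv R h n.+1.
    rewrite subr_ge0 /root_inv lef_pV2 ?posrE ?powR_gt0 ?ltr0n //.
    by rewrite ler_powRl // ler_nat.
  apply: (le_trans (ler_wpM2r d0 (cle n n0))).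
  rewrite -mulrA ler_wpM2l ?(ltW g1_gt0) //.
  apply: (le_trans (ler_wpM2l (powR_ge0 _ _) d2)); rewrite -powRD' //.
  by rewrite /eta; have -> : h.+1%:R^-1 + - (1 + h%:R^-1) = - (1 + (h%:R^-1 - h.+1%:R^-1)) :> R by lrai.
apply: (le_trans (lerD t1 t2)); rewrite -mulr_sumr -mulrDr /tail_const -mulrA.
rewrite ler_wpM2l ?(ltW g1_gt0) // big_ltn //.
have t3 := sum_powR_tail R M M' eta M0 e0.
have t4 : M%:R `^ (- (1 + eta)) <= M%:R `^ (- eta) by rewrite ler_powR ?ler1n //; lra.
by lra.
Qed.

Lemma hfull_count_asymp : exists2 C : R, 0 <= C &
  forall (s : seq nat) (y : R), all prime s -> uniq s -> (size s <= 2)%N -> 1 <= y ->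
  `|hfull_count R h s (Num.truncn y) -
     gamma0 R h * \prod_(p <- s) ((1 - p%:R^-1) / local_factor R h p) * y `^ h%:R^-1|
  <= C * y `^ h.+1%:R^-1.
Proof.
have /andP[e0 e1] := eta_bounds.
have T0 : 0 <= tail_const.
  by rewrite mulr_ge0 ?(ltW g1_gt0) // addr_ge0 // invr_ge0 ltW.
(* 4 = 2^2 is the inclusion-exclusion factor for at most two primes; 2 comes from y <= 2 M, which
   bounds M^(-eta) by 2 y^(-eta). *)
exists (4 * g1 + 2 * tail_const).
  by rewrite addr_ge0 // mulr_ge0 // ltW.
move=> s y ps us s2 y1; have y0 : 0 < y by lra.
have /andP[M1 M2] := truncn_itv (ltW y0).
set M := Num.truncn y in M1 M2 *.
have M0 : (0 < M)%N by rewrite truncn_gt0.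
have MR : (1 : R) <= M%:R by rewrite ler1n.
have yM : y <= 2 * M%:R by rewrite -natr1 in M2; lra.
have P1 : (0 : R) <= \prod_(p <- s) (1 - p%:R^-1 : R) <= 1.
  rewrite big_seq; apply/andP; split.
    by apply: prodr_ge0 => p /(allP ps) /(invp_le_half R); lra.
  apply: prodr_ile1 => p /(allP ps) pp; have := invp_le_half R p pp.
  have : 0 <= p%:R^-1 :> R by rewrite invr_ge0.
  by move=> a b; apply/andP; split; lra.
have c1 := hfull_count_close R h h0 s y ps us (ltW y0); rewrite -/M in c1.
have w1 := mid_weight_le R h h0 s ps us M.
set lfs := \prod_(p <- s) local_factor R h p in w1.
have w2 : gamma0 R h / lfs <= mid_weight R h s M + tail_const * M%:R `^ (- eta).
  apply: (mid_weight_sup R h h0 s ps us) => M'.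
  by have := mid_tail s M M' M0; lra.
have mt : M%:R `^ (- eta) <= 2 * y `^ (- eta).
  rewrite !powRN ler_pdivlMr ?powR_gt0 // ler_pdivrMl ?powR_gt0 //; last lra.
  apply: (@le_trans _ _ ((2 * M%:R) `^ eta)).
    by rewrite ler_powRl // ltW.
  rewrite powRM // mulrC ler_wpM2l ?powR_ge0 //.
  by rewrite -[leRHS]powRr1 // ler_powR //; lra.
rewrite big_split /= prodfV -/lfs.
set Pi := \prod_(p <- s) (1 - p%:R^-1) in P1 c1 *; case/andP: P1 => P0 P1.
set Y := y `^ h%:R^-1 in c1 *; have Y0 : 0 <= Y by exact: powR_ge0.
have mc : 2 ^+ size s * mid_count R h M <= 4 * g1 * y `^ h.+1%:R^-1.
  rewrite -mulrA; apply: ler_pM.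
  - by rewrite exprn_ge0.
  - by rewrite /mid_count sumr_ge0.
  - apply: (@le_trans _ _ (2 ^+ 2)); last by rewrite expr2; lra.
    by rewrite ler_weXn2l // ler1n.
  - apply: (le_trans (mid_count_le R h M h0)); rewrite ler_wpM2l ?(ltW g1_gt0) //.
    by rewrite ler_powRl ?invr_ge0.
have YY : Y * y `^ (- eta) = y `^ h.+1%:R^-1.
  by rewrite /Y -powRD' // /eta; congr (_ `^ _); lrai.
have d : `|Y * Pi * mid_weight R h s M - gamma0 R h * (Pi / lfs) * Y| <=
    2 * tail_const * y `^ h.+1%:R^-1.
  have -> : Y * Pi * mid_weight R h s M - gamma0 R h * (Pi / lfs) * Y =
    - (Y * Pi * (gamma0 R h / lfs - mid_weight R h s M)) by lrai.
  rewrite normrN ger0_norm; last by rewrite !mulr_ge0 // subr_ge0.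
  apply: (@le_trans _ _ (Y * (tail_const * (2 * y `^ (- eta))))).
    apply: ler_pM => //; [by rewrite mulr_ge0|by rewrite subr_ge0|by rewrite ler_piMr|].
    by apply: (@le_trans _ _ (tail_const * M%:R `^ (- eta))); [lra|rewrite ler_wpM2l].
  by rewrite -YY le_eqVlt; apply/orP; left; apply/eqP; lra.
have -> : hfull_count R h s M - gamma0 R h * (Pi / lfs) * Y =
  (hfull_count R h s M - Y * Pi * mid_weight R h s M) +
  (Y * Pi * mid_weight R h s M - gamma0 R h * (Pi / lfs) * Y) by lra.
apply: (le_trans (ler_normD _ _)); rewrite mulrDl; apply: lerD => //.
exact: le_trans mc.
Qed.

Lemma hfull_count0 (s : seq nat) : hfull_count R h s 0 = 0.
Proof. by rewrite /hfull_count big_mkcond big_nat1. Qed.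
End HfullAsymptotics.

(** * Expansion of the second moment over primes and pairs of primes *)

Definition exactly (k n p : nat) : bool := (p ^ k %| n)%N && ~~ (p ^ k.+1 %| n)%N.

(** Lets the primes run over a range independent of n, so that the sums over n and over p can be
    interchanged. *)
Lemma omega_sum (R : realType) (k n K : nat) : (0 < n)%N -> (0 < k)%N ->
  (forall p, prime p -> (p ^ k <= n)%N -> (p < K)%N) ->
  (omega_ k n)%:R = \sum_(0 <= p < K | prime p) (exactly k n p)%:R :> R.
Proof.
move=> n0 k0 nK; rewrite /omega_ -size_filter -natr_sum; congr _%:R.
have -> : (\sum_(0 <= p < K | prime p) exactly k n p =
    size [seq p <- index_iota 0 K | prime p && exactly k n p])%N.
  rewrite size_filter -sum1_count big_mkcond [RHS]big_mkcond /=.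
  by apply: eq_bigr => p _; case: (prime p) => //; case: exactly.
apply/perm_size/uniq_perm.
- by rewrite filter_uniq // primes_uniq.
- by rewrite filter_uniq // iota_uniq.
move=> p; rewrite !mem_filter mem_primes n0 mem_index_iota -/(exactly k n p).
apply/idP/idP => [/and3P[e pp _]|/andP[/andP[pp e] _]].
  by rewrite pp e /= nK // dvdn_leq //; case/andP: e.
rewrite e pp /=; case/andP: e => e _; apply: dvdn_trans e.
by rewrite -{1}(expn1 p) dvdn_exp2l.
Qed.

Lemma sum_prime_D1 (V : nmodType) (K p : nat) (F : nat -> V) : prime p -> (p < K)%N ->
  \sum_(0 <= q < K | prime q) F q = F p + \sum_(0 <= q < K | prime q && (q != p)) F q.
Proof.
move=> pp pK; rewrite big_mkcond (bigD1_seq p) ?iota_uniq ?mem_index_iota //= pp.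
by congr (_ + _); rewrite [RHS]big_mkcondl.
Qed.

Lemma sum_prime_sqr (R : comPzRingType) (K : nat) (f : nat -> R) :
  (\sum_(0 <= p < K | prime p) f p) ^+ 2 = \sum_(0 <= p < K | prime p) f p ^+ 2 +
  \sum_(0 <= p < K | prime p) \sum_(0 <= q < K | prime q && (q != p)) f p * f q.
Proof.
rewrite expr2 mulr_suml -big_split /= big_nat_cond [RHS]big_nat_cond.
apply: eq_bigr => p /andP[/andP[_ pK] pp].
by rewrite mulr_sumr (sum_prime_D1 _ _ _ _ pp pK) expr2.
Qed.

Section OmegaSum.
Variables (R : realType) (h k : nat).
Hypothesis h0 : (0 < h)%N.
Hypothesis hk : (h <= k)%N.

Let cnt (s t : seq nat) (M : nat) : R :=
  \sum_(0 <= n < M.+1 | [&& hfull h n, all (exactly k n) s & avoids t n]) 1.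

Lemma exactly_mul p m : prime p -> (0 < m)%N -> exactly k (p ^ k * m) p = ~~ (p %| m)%N.
Proof.
move=> pp m0; have p0 := prime_gt0 pp.
by rewrite /exactly dvdn_mulr // expnSr dvdn_pmul2l ?expn_gt0 ?p0.
Qed.

Lemma exactly_mul_neq p q m : prime p -> prime q -> q != p ->
  exactly k (p ^ k * m) q = exactly k m q.
Proof.
move=> pp pq qp; have c j : coprime (q ^ j) (p ^ k).
  by rewrite coprimeXl // coprimeXr // prime_coprime // dvdn_prime2.
by rewrite /exactly !Gauss_dvdr.
Qed.

(** Writing n = p^k m with m prime to p, the prime p passes from the list of exact divisors to the
    list avoided by m; since k >= h, p^k m is h-full exactly when m is. One application handles a
    prime, two a pair. *)
Let cnt_cons p s t M : prime p -> all prime s -> all prime t -> p \notin s -> p \notin t ->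
  cnt (p :: s) t M = cnt s (p :: t) (M %/ p ^ k).
Proof.
move=> pp ps pt pns pnt; have p0 := prime_gt0 pp.
have pk0 : (0 < p ^ k)%N by rewrite expn_gt0 p0.
have exs m : all (exactly k (p ^ k * m)) s = all (exactly k m) s.
  apply: eq_in_all => q qs; apply: exactly_mul_neq => //; first exact: (allP ps).
  by apply: contraNneq pns => <-.
have avt m : avoids t (p ^ k * m) = avoids t m.
  by rewrite avoidsM // avoidsX ?(leq_trans h0 hk) // avoids_prime // pnt.
have hf m : coprime p m -> hfull h (p ^ k * m) = hfull h m.
  by move=> cpm; rewrite !hfull_full_set full_setMp // hk orbT.
rewrite /cnt (@sum_reindex_pairs _ M.+1 1 (M %/ p ^ k).+1 _
  (fun i m => (i == 0)%N && [&& hfull h m, all (exactly k m) s & avoids (p :: t) m])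
  (fun i m => p ^ k * m)%N).
- by rewrite big_nat1; apply: eq_bigl.
- move=> n nM /and3P[hn /= /andP[en es] at_].
  have n0 : (0 < n)%N by case/andP: hn.
  have /andP[/dvdnP[m nE] _] := en; rewrite mulnC in nE.
  have m0 : (0 < m)%N by move: n0; rewrite nE muln_gt0 => /andP[].
  move: en; rewrite nE exactly_mul // => pm.
  exists 0%N, m; split=> //=; first by rewrite ltnS leq_divRL // mulnC -nE.
  by rewrite -exs -nE es pm -avt -nE at_ -hf ?prime_coprime // -nE hn.
- move=> i m _ mM /= /and4P[_ hm es /andP[pm at_]].
  have m0 : (0 < m)%N by case/andP: hm.
  rewrite ltnS mulnC -leq_divRL // -ltnS mM /= mulnC hf ?prime_coprime // hm.
  by rewrite exactly_mul // pm exs es avt at_.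
- move=> i m i' m' /andP[/eqP -> _] /andP[/eqP -> _] /eqP.
  by rewrite eqn_pmul2l // => /eqP.
Qed.

Let cnt_nil t M : cnt [::] t M = hfull_count R h t M. Proof. by []. Qed.

Lemma exactly_count1 p M : prime p ->
  \sum_(1 <= n < M.+1 | hfull h n) (exactly k n p)%:R = hfull_count R h [:: p] (M %/ p ^ k).
Proof.
move=> pp; rewrite -cnt_nil -(cnt_cons p [::] [::] M) // /cnt big_mkcond [RHS]big_mkcond.
rewrite [RHS]big_nat_recl //= add0r big_add1 /=; apply: eq_bigr => n _.
by case: hfull => //=; rewrite !andbT; case: exactly.
Qed.

Lemma exactly_count2 p q M : prime p -> prime q -> q != p ->
  \sum_(1 <= n < M.+1 | hfull h n) (exactly k n p)%:R * (exactly k n q)%:R =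
  hfull_count R h [:: q; p] (M %/ (p ^ k * q ^ k)).
Proof.
move=> pp pq qp; rewrite divnMA -cnt_nil -(cnt_cons q [::] [:: p]) //=; last first.
- by rewrite inE.
- by rewrite pp.
rewrite -(cnt_cons p [:: q] [::] M) //=; last first.
- by rewrite inE eq_sym.
- by rewrite pq.
rewrite /cnt big_mkcond [RHS]big_mkcond.
rewrite [RHS]big_nat_recl //= add0r big_add1 /=; apply: eq_bigr => n _.
by case: hfull => //=; rewrite !andbT; case: exactly; case: exactly; rewrite ?mulr0 ?mul0r ?mulr1.
Qed.

Lemma hfull_omega2_expand (x : R) (K : nat) :
  (forall p, prime p -> (p ^ k <= Num.truncn x)%N -> (p < K)%N) ->
  hfull_omega2_sum h k x =
  \sum_(0 <= p < K | prime p) hfull_count R h [:: p] (Num.truncn x %/ p ^ k) +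
  \sum_(0 <= p < K | prime p) \sum_(0 <= q < K | prime q && (q != p))
     hfull_count R h [:: q; p] (Num.truncn x %/ (p ^ k * q ^ k)).
Proof.
move=> xK; rewrite /hfull_omega2_sum; set M := Num.truncn x in xK *.
have k0 := leq_trans h0 hk.
rewrite big_nat_cond.
rewrite (eq_bigr (fun n => \sum_(0 <= p < K | prime p) (exactly k n p)%:R +
  \sum_(0 <= p < K | prime p) \sum_(0 <= q < K | prime q && (q != p))
    (exactly k n p)%:R * (exactly k n q)%:R)); last first.
  move=> n /andP[/andP[n0 nM] _].
  rewrite (omega_sum R k n K) //; last first.
    by move=> p pp pkn; apply: xK => //; apply: leq_trans pkn _; rewrite -ltnS.
  rewrite sum_prime_sqr; congr (_ + _); apply: eq_bigr => p _.
  by case: exactly; rewrite ?expr1n ?expr0n.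
rewrite -big_nat_cond big_split /=; congr (_ + _); rewrite exchange_big /=.
  by apply: eq_bigr => p pp; exact: exactly_count1.
apply: eq_bigr => p pp; rewrite exchange_big /=; apply: eq_bigr => q /andP[pq qp].
exact: exactly_count2.
Qed.
End OmegaSum.

Lemma eq_prime_sum (R : realType) (f g : nat -> R) :
  (forall p, prime p -> f p = g p) -> prime_sum f = prime_sum g.
Proof.
by move=> fg; rewrite /prime_sum; congr (limn _); apply/funext => n; apply: eq_bigr.
Qed.

Lemma powR_nat_div (R : realType) (x : R) (h j : nat) : 0 <= x ->
  x `^ (j%:R / h%:R) = (x `^ h%:R^-1) ^+ j.
Proof. by move=> x0; rewrite mulrC powRrM powR_mulrn ?powR_ge0. Qed.

(** Multiply numerator and denominator by a^(k+1). With a = p^(-1/h), the left side is the fraction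
    squared in the prime sums of the theorem, and the right side is [cweight]. *)
Lemma inv_geo_fraction (R : realFieldType) (h k : nat) (a : R) : 0 < a -> a < 1 ->
  (h <= k.+1)%N ->
  (a^-1 - 1) / (a^-1 ^+ k.+1 - a^-1 ^+ k + a^-1 ^+ (k.+1 - h)) =
  (1 - a) / (1 - a + a ^+ h) * a ^+ k.
Proof.
move=> a0 a1 hk; rewrite !exprVn.
have ah0 : 0 < a ^+ h by rewrite exprn_gt0.
have ak0 : 0 < a ^+ k by rewrite exprn_gt0.
have -> : (a ^+ (k.+1 - h))^-1 = a ^+ h / a ^+ k.+1.
  have := exprD a (k.+1 - h) h; rewrite subnK // => ->.
  by rewrite invfM mulrCA mulfV ?mulr1 // lt0r_neq0.
rewrite exprS; move: (a ^+ k) (a ^+ h) ak0 ah0 => b c b0 c0.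
have d0 : 0 < 1 - a + c by lra.
have -> : (a * b)^-1 - b^-1 + c / (a * b) = (1 - a + c) / (a * b).
  by field; rewrite !lt0r_neq0.
rewrite invfM invrK; field; rewrite !lt0r_neq0 //.
Qed.

(** * The second moment of omega_k *)

Section Weights.
Variables (R : realType) (h : nat).
Hypothesis h0 : (0 < h)%N.
Let v p : R := root_inv R h p.

(* Asymptotically, [weight p] is the proportion of h-full numbers prime to p and
   [cweight k p] the proportion of those exactly divisible by p^k. *)
Definition weight (p : nat) : R := (1 - p%:R^-1) / local_factor R h p.
Definition cweight (k p : nat) : R := weight p * v p ^+ k.
(** The general term of L_h(k) in terms of v = p^(-1/h); see [Lterm_formula]. *)
Definition Lterm (k p : nat) : R := v p ^+ k / (1 - v p + v p ^+ h).

Let hR : (0 : R) < h%:R. Proof. by rewrite ltr0n. Qed.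

Lemma root_inv_lt1 p : prime p -> v p <= v 2 /\ v 2 < 1.
Proof.
move=> pp; split.
  rewrite /v /root_inv lef_pV2 ?posrE ?powR_gt0 ?ltr0n ?prime_gt0 //.
  by rewrite ler_powRl ?invr_ge0 // ler_nat prime_gt1.
rewrite /v /root_inv invf_lt1 ?powR_gt0 // powR_expR // expR_gt1.
by rewrite mulr_gt0 ?invr_gt0 // ln_gt0 //; lra.
Qed.

Let v_bounds p : prime p -> 0 < v p < 1.
Proof.
move=> pp; have [a b] := root_inv_lt1 p pp.
by rewrite root_inv_gt0 ?prime_gt0 //= (le_lt_trans a b).
Qed.

Lemma weight01 p : prime p -> 0 <= weight p <= 1.
Proof.
move=> pp; have l1 := local_factor_ge1 R h p; have p2 := invp_le_half R p pp.
have p0 : 0 <= p%:R^-1 :> R by rewrite invr_ge0.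
have l0 : 0 < local_factor R h p by lra.
rewrite /weight divr_ge0 ?(ltW l0) //=; last lra.
by rewrite ler_pdivrMr // mul1r; lra.
Qed.

Lemma local_factor_geo p : (1 - v p) * (local_factor R h p - 1) = v p ^+ h.+1 - v p ^+ h.*2.
Proof.
have -> : local_factor R h p - 1 = \sum_(h.+1 <= j < h.*2) v p ^+ j.
  by rewrite /local_factor addrAC subrr add0r.
rewrite mulr_sumr.
rewrite (eq_bigr (fun j => - (v p ^+ j.+1 - v p ^+ j))); last first.
  by move=> j _; rewrite exprS /v; lra.
by rewrite sumrN telescope_sumr ?opprB //; lia.
Qed.

(** (1 - v) times the local factor is (1 - v^h)(1 - v + v^h), and 1 - v^h is the factor 1 - 1/p of
    the numerator. *)
Lemma weightE p : prime p -> weight p = (1 - v p) / (1 - v p + v p ^+ h).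
Proof.
move=> pp; have /andP[v0 v1] := v_bounds p pp.
have l1 := local_factor_ge1 R h p; have S := local_factor_geo p.
have vh : v p ^+ h = p%:R^-1 by exact: root_invXh.
have vh0 : 0 < v p ^+ h by rewrite exprn_gt0.
have l0 : 0 < local_factor R h p := lt_le_trans ltr01 l1.
have d0 : 0 < 1 - v p + v p ^+ h by rewrite addr_gt0 // subr_gt0.
have {S} : (1 - v p) * (local_factor R h p - 1) = v p * v p ^+ h - v p ^+ h * v p ^+ h.
  by rewrite S -mul2n mulnC exprM [v p ^+ h.+1]exprS [(v p ^+ h) ^+ 2]expr2.
rewrite /weight -vh => S; apply/eqP.
rewrite eqr_div ?lt0r_neq0 //; apply/eqP; move: S.
by set a := v p ^+ h; set b := v p; set c := local_factor _ _ _; lra.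
Qed.

(** Expanding the numerator (1 - v) v^k splits the weight in two; hence the differences of
    consecutive values of L_h in the constants. *)
Lemma cweightE k p : prime p -> cweight k p = Lterm k p - Lterm k.+1 p.
Proof. by move=> pp; rewrite /cweight weightE // /Lterm exprS; lra. Qed.

Lemma cweight_ge0 k p : prime p -> 0 <= cweight k p.
Proof.
by move=> pp; have /andP[a _] := weight01 p pp; rewrite mulr_ge0 // exprn_ge0 // root_inv_ge0.
Qed.

Lemma cweight_le k p : prime p -> cweight k p <= v p ^+ k.
Proof.
by move=> pp; have /andP[_ a] := weight01 p pp; rewrite ler_piMl // exprn_ge0 // root_inv_ge0.
Qed.

Lemma root_invXS p : prime p -> v p ^+ h.+1 = p%:R `^ (- (1 + h%:R^-1)).
Proof.
move=> pp; have pR : (0 : R) < p%:R by rewrite ltr0n prime_gt0.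
rewrite exprSr root_invXh // /v root_inv_powRN opprD powRD; last by rewrite (gt_eqF pR) implybT.
by rewrite powR_inv1 // ltW.
Qed.

Lemma root_invX_le k p : (h < k)%N -> prime p -> v p ^+ k <= p%:R `^ (- (1 + h%:R^-1)).
Proof.
move=> hk pp; rewrite -root_invXS //; have /andP[a b] := v_bounds p pp.
by rewrite ler_wiXn2l // ltW.
Qed.

Lemma cweight_bound k p : (h < k)%N -> prime p ->
  `|cweight k p| <= 1 * p%:R `^ (- (1 + h%:R^-1)).
Proof.
move=> hk pp; rewrite mul1r ger0_norm ?cweight_ge0 //.
by apply: (le_trans (cweight_le _ _ pp)); exact: root_invX_le.
Qed.

Lemma cweight2_bound k p : (h < k)%N -> prime p ->
  `|cweight k p ^+ 2| <= 1 * p%:R `^ (- (1 + h%:R^-1)).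
Proof.
move=> hk pp; have := cweight_bound k p hk pp; apply: le_trans.
have /andP[a b] := v_bounds p pp.
rewrite normrX expr2 ler_piMr // ger0_norm ?cweight_ge0 //.
apply: (le_trans (cweight_le _ _ pp)); rewrite exprn_ile1 // ltW //.
Qed.

Lemma Lterm_bound k p : (h < k)%N -> prime p ->
  `|Lterm k p| <= (1 - v 2)^-1 * p%:R `^ (- (1 + h%:R^-1)).
Proof.
move=> hk pp; have /andP[v0 v1] := v_bounds p pp; have [a b] := root_inv_lt1 p pp.
have vh0 : 0 < v p ^+ h by rewrite exprn_gt0.
rewrite ger0_norm; last by rewrite divr_ge0 ?exprn_ge0 ?(ltW v0) //; lra.
rewrite /Lterm [leLHS]mulrC; apply: ler_pM.
- by rewrite invr_ge0; lra.
- by rewrite exprn_ge0 // ltW.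
- by rewrite lef_pV2 ?posrE; lra.
- exact: root_invX_le.
Qed.

Lemma Lterm_formula (k p : nat) : prime p ->
  (p%:R `^ (k%:R / h%:R - 1) * (p%:R - p%:R `^ (1 - h%:R^-1) + 1))^-1 = Lterm k p.
Proof.
move=> pp; have pR : (0 : R) < p%:R by rewrite ltr0n prime_gt0.
have /andP[v0 v1] := v_bounds p pp.
have vh0 : 0 < v p ^+ h by rewrite exprn_gt0.
have powD a b : p%:R `^ (a + b) = p%:R `^ a * p%:R `^ b :> R.
  by rewrite powRD // (gt_eqF pR) implybT.
rewrite !powD powR_nat_div ?(ltW pR) // powR_inv1 ?(ltW pR) // powRr1 ?(ltW pR) //.
have -> : p%:R `^ (- h%:R^-1) = v p by rewrite /v root_inv_powRN.
have -> : (p%:R `^ h%:R^-1) ^+ k = (v p ^+ k)^-1 :> R by rewrite /v /root_inv exprVn invrK.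
rewrite /Lterm root_invXh //.
have vk0 : 0 < v p ^+ k by rewrite exprn_gt0.
have d0 : 0 < 1 - v p + p%:R^-1 by rewrite addr_gt0 ?invr_gt0 //; lra.
have -> : p%:R - p%:R * v p + 1 = p%:R * (1 - v p + p%:R^-1).
  by rewrite mulrDr mulfV ?gt_eqF //; lra.
by rewrite mulrA mulfVK ?gt_eqF // invfM invrK.
Qed.

Lemma Lh_cvg k : (h < k)%N -> cvgn (fun M => \sum_(0 <= p < M | prime p) Lterm k p).
Proof.
move=> hk; have hV : 0 < h%:R^-1 :> R by rewrite invr_gt0.
by have [] := @prime_sum_tail R (Lterm k) _ _ hV (fun p => Lterm_bound k p hk).
Qed.

Lemma LhE k : Lh h k%:R = prime_sum (Lterm k).
Proof. by apply: eq_prime_sum => p pp; exact: Lterm_formula. Qed.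

Lemma Lh_diff k : (h < k)%N -> Lh h k%:R - Lh h k.+1%:R = prime_sum (cweight k).
Proof.
move=> hk; rewrite !LhE -limB; [|exact: Lh_cvg|exact: Lh_cvg (leqW hk)].
congr (limn _); apply/funext => n /=; rewrite fctE -sumrB.
by apply: eq_bigr => p pp; rewrite cweightE.
Qed.

Lemma cweight_formula (k p : nat) (D : R) : prime p -> (h <= k.+1)%N ->
  D = (p%:R `^ h%:R^-1) ^+ k.+1 - (p%:R `^ h%:R^-1) ^+ k + (p%:R `^ h%:R^-1) ^+ (k.+1 - h) ->
  (p%:R `^ h%:R^-1 - 1) / D = cweight k p.
Proof.
move=> pp hk ->; have /andP[v0 v1] := v_bounds p pp.
have qE : p%:R `^ h%:R^-1 = (v p)^-1 by rewrite /v /root_inv invrK.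
by rewrite qE inv_geo_fraction // /cweight weightE.
Qed.
End Weights.

Lemma powR_root_div (R : realType) (h d : nat) (x : R) : 0 <= x ->
  (x / d%:R) `^ h%:R^-1 = x `^ h%:R^-1 * root_inv R h d.
Proof.
move=> x0; rewrite powRM ?invr_ge0 // /root_inv; congr (_ * _).
by rewrite -powR_inv1 // -powRAC powR_inv1 // powR_ge0.
Qed.

Lemma truncn_div (R : realType) (x : R) (d : nat) : 0 <= x -> (0 < d)%N ->
  Num.truncn (x / d%:R) = (Num.truncn x %/ d)%N.
Proof.
move=> x0 d0; have dR : (0 : R) < d%:R by rewrite ltr0n.
have /andP[x1 x2] := truncn_itv x0.
apply: truncn_def; rewrite ler_pdivlMr // ltr_pdivrMr //; apply/andP; split.
  by apply: le_trans x1; rewrite -natrM ler_nat leq_trunc_div.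
apply: (lt_le_trans x2); rewrite -natrM ler_nat.
by rewrite {1}(divn_eq (Num.truncn x) d) mulSn addnC -addSn leq_add2r ltn_mod.
Qed.

Section OmegaApprox.
Variables (R : realType) (h : nat).
Hypothesis h0 : (0 < h)%N.

(** Removes the condition d <= x: if y = x/d < 1 the count is 0 and the main term is at most gamma0
    y^(1/h) <= gamma0 y^(1/(h+1)). Prime sums may then run past the range where counts are
    nonzero. *)
Lemma hfull_count_approx : exists2 C : R, 0 <= C &
  forall (s : seq nat) (x : R) (d : nat), all prime s -> uniq s -> (size s <= 2)%N ->
    0 < x -> (0 < d)%N ->
  `|hfull_count R h s (Num.truncn x %/ d) -
    gamma0 R h * \prod_(p <- s) weight R h p * (x `^ h%:R^-1 * root_inv R h d)|
  <= C * (x `^ h.+1%:R^-1 * root_inv R h.+1 d).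
Proof.
have [C C0 H] := hfull_count_asymp R h h0.
have g0 : 0 <= gamma0 R h := le_trans ler01 (gamma0_ge1 R h h0).
exists (C + gamma0 R h); first exact: addr_ge0.
move=> s x d ps us s2 x0 d0; have dR : (0 : R) < d%:R by rewrite ltr0n.
have y0 : 0 < x / d%:R by rewrite divr_gt0.
rewrite -truncn_div ?(ltW x0) // -!powR_root_div ?(ltW x0) //.
set y := x / d%:R in y0 *; have Y0 := powR_ge0 y h.+1%:R^-1.
have [y1|y1] := leP 1 y.
  apply: (le_trans (H s y ps us s2 y1)).
  by rewrite ler_wpM2r // lerDl.
have -> : Num.truncn y = 0%N by apply/truncn0Pn; rewrite -ltNge.
rewrite hfull_count0 sub0r normrN.
have P01 : (0 : R) <= \prod_(p <- s) weight R h p <= 1.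
  rewrite big_seq; apply/andP; split.
    by apply: prodr_ge0 => p /(allP ps) /(weight01 R h) /andP[].
  by apply: prodr_ile1 => p /(allP ps) /(weight01 R h).
case/andP: P01 => P0 P1.
rewrite ger0_norm; last by rewrite !mulr_ge0 // powR_ge0.
apply: (@le_trans _ _ (gamma0 R h * y `^ h.+1%:R^-1)); last first.
  by rewrite ler_wpM2r // lerDr.
rewrite -mulrA ler_wpM2l //; apply: (@le_trans _ _ (y `^ h%:R^-1)).
  by rewrite ler_piMl // powR_ge0.
by rewrite ger_powR ?y0 ?(ltW y1) // lef_pV2 ?posrE ?ltr0n // ler_nat.
Qed.

(* [Q] restricts the pairs to those which can occur; for k = h the error sum
   over all pairs of primes up to x would be too large. *)
Lemma omega2_approx : exists2 C : R, 0 <= C &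
  forall (k K : nat) (Q : rel nat) (x : R), (h <= k)%N -> 0 < x ->
  (forall p, prime p -> (p ^ k <= Num.truncn x)%N -> (p < K)%N) ->
  (forall p q, prime p -> prime q -> ~~ Q p q -> (Num.truncn x < p ^ k * q ^ k)%N) ->
  `|hfull_omega2_sum h k x - gamma0 R h * x `^ h%:R^-1 *
     (\sum_(0 <= p < K | prime p) cweight R h k p +
      \sum_(0 <= p < K | prime p) \sum_(0 <= q < K | (prime q && (q != p)) && Q p q)
        cweight R h k p * cweight R h k q)|
  <= C * x `^ h.+1%:R^-1 *
     (\sum_(0 <= p < K | prime p) root_inv R h.+1 p ^+ k +
      \sum_(0 <= p < K | prime p) \sum_(0 <= q < K | (prime q && (q != p)) && Q p q)
        root_inv R h.+1 p ^+ k * root_inv R h.+1 q ^+ k).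
Proof.
have [C C0 H] := hfull_count_approx.
exists C => // k K Q x hk x0 xK xQ.
rewrite (hfull_omega2_expand R h k h0 hk x K xK); set M := Num.truncn x in xK xQ *.
have -> : \sum_(0 <= p < K | prime p) \sum_(0 <= q < K | prime q && (q != p))
     hfull_count R h [:: q; p] (M %/ (p ^ k * q ^ k)) =
   \sum_(0 <= p < K | prime p) \sum_(0 <= q < K | (prime q && (q != p)) && Q p q)
     hfull_count R h [:: q; p] (M %/ (p ^ k * q ^ k)).
  apply: eq_bigr => p pp; rewrite [RHS]big_mkcondr; apply: eq_bigr => q /andP[pq _].
  by case: ifPn => // /(xQ _ _ pp pq) /divn_small ->; rewrite hfull_count0.
rewrite !mulrDr opprD addrACA; apply: (le_trans (ler_normD _ _)); apply: lerD.
  rewrite !mulr_sumr -sumrB (le_trans (ler_norm_sum _ _ _)) //; apply: ler_sum => p pp.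
  have := H [:: p] x (p ^ k)%N ltac:(by rewrite /= pp) isT isT x0
    ltac:(by rewrite expn_gt0 prime_gt0).
  rewrite big_seq1 !root_invX -mulrA; congr (`| _ - _ | <= _); rewrite /cweight.
    by lra.
  by lra.
rewrite !mulr_sumr -sumrB (le_trans (ler_norm_sum _ _ _)) //; apply: ler_sum => p pp.
rewrite !mulr_sumr -sumrB (le_trans (ler_norm_sum _ _ _)) //; apply: ler_sum => q.
move=> /andP[/andP[pq qp] _].
have := H [:: q; p] x (p ^ k * q ^ k)%N ltac:(by rewrite /= pp pq) ltac:(by rewrite /= inE qp)
    isT x0 ltac:(by rewrite muln_gt0 !expn_gt0 !prime_gt0).
rewrite big_cons big_seq1 !root_invM !root_invX; congr (`| _ - _ | <= _); rewrite /cweight.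
  by lra.
by lra.
Qed.
End OmegaApprox.

Lemma bigO_pinfty_intro (R : realType) (f g e : R -> R) (C x0 : R) :
  (forall x, x0 <= x -> `|f x - g x| <= C * `|e x|) -> f = g +O_ (+oo) e.
Proof.
move=> H; apply/eqaddOP; near=> k; near=> x.
apply: (@le_trans _ _ (C * `|e x|)).
  by apply: H; near: x; apply: nbhs_pinfty_ge; exact: num_real.
rewrite ler_wpM2r //; near: k; apply: nbhs_pinfty_ge; exact: num_real.
Unshelve. all: by end_near. Qed.

Lemma prime_recip_le (R : realType) : exists2 C : R, 0 <= C &
  forall x : R, 1 <= ln (ln x) ->
  \sum_(0 <= p < (Num.truncn x).+1 | prime p) p%:R^-1 <= C * ln (ln x).
Proof.
have [c [C H]] := mertens2 R.
have C0 : 0 <= C by have := H 1%N isT; rewrite divr1; apply: le_trans.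
exists (4 + `|c| + C); first by rewrite !addr_ge0.
move=> x L1; have l1 : 1 < ln x.
  by rewrite ltNge; apply/negP => /ln_le0; lra.
have x1 : 1 < x by rewrite ltNge; apply/negP => /ln_le0; lra.
set M := Num.truncn x; have M0 : (0 < M)%N by rewrite truncn_gt0 ltW.
set N := (trunc_log 2 M).+1.
have MN : (M < 2 ^ N)%N by exact: trunc_log_ltn.
have NM : (2 ^ N.-1 <= M)%N by exact: trunc_logP.
have /andP[M1 _] := truncn_itv (le_trans ler01 (ltW x1)).
have NR : (0 : R) < N%:R by rewrite ltr0n.
have N3 : N%:R <= 3 * ln x.
  have : ln (2 ^ N.-1)%:R <= ln x.
    rewrite ler_ln ?posrE ?ltr0n ?expn_gt0 //; last lra.
    by apply: le_trans M1; rewrite ler_nat.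
  rewrite natrX lnXn // -[_ *+ N.-1]mulr_natl; have /andP[h1 _] := ln2_bounds R => h2.
  have h3 : N.-1%:R * 2^-1 <= N.-1%:R * ln 2 :> R by rewrite ler_wpM2l.
  have -> : N%:R = N.-1%:R + 1 :> R by rewrite natr1.
  lra.
have lN : ln N%:R <= 2 + ln (ln x).
  apply: (@le_trans _ _ (ln (3 * ln x))); first by rewrite ler_ln ?posrE //; lra.
  rewrite lnM ?posrE //; last lra.
  have := @ln_le_sub1 R 3 ltac:(lra); lra.
apply: (@le_trans _ _ (\sum_(0 <= p < 2 ^ N | prime p) p%:R^-1)).
  rewrite [leRHS](@big_cat_nat _ _ _ M.+1) //= lerDl sumr_ge0 //.
have := H N isT; have h4 := harmonic_le R N isT; rewrite ler_norml => /andP[_ h5].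
have h6 : C / N%:R <= C by rewrite ler_pdivrMr // ler_peMr // ler1n.
have h7 := ler_norm c.
have k0 : 0 <= 3 + `|c| + C by rewrite !addr_ge0.
have : 0 <= (3 + `|c| + C) * (ln (ln x) - 1) by rewrite mulr_ge0 // subr_ge0.
by lra.
Qed.

(** * The exponents k > h *)

Section LargeExponents.
Variables (R : realType) (h : nat).
Hypothesis h0 : (0 < h)%N.
Let X (x : R) : R := x `^ h%:R^-1.
Let X' (x : R) : R := x `^ h.+1%:R^-1.
Let gam := gamma0 R h.
Let S k K : R := \sum_(0 <= p < K | prime p) cweight R h k p.
Let T k K : R := \sum_(0 <= p < K | prime p) cweight R h k p ^+ 2.
Let U k K : R := \sum_(0 <= p < K | prime p) root_inv R h.+1 p ^+ k.
Let Sinf k : R := prime_sum (cweight R h k).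
Let Tinf k : R := prime_sum (fun p => cweight R h k p ^+ 2).

Let hV : 0 < h%:R^-1 :> R. Proof. by rewrite invr_gt0 ltr0n. Qed.

Lemma omega2_approx_full : exists2 C : R, 0 <= C &
  forall (k K : nat) (x : R), (h <= k)%N -> 0 < x -> (Num.truncn x < K)%N ->
  `|hfull_omega2_sum h k x - gam * X x * (S k K + (S k K ^+ 2 - T k K))|
  <= C * X' x * (U k K + U k K ^+ 2).
Proof.
have [C C0 H] := omega2_approx R h h0; exists C => // k K x hk x0 xK.
have := H k K (fun _ _ => true) x hk x0 _ (fun _ _ _ _ => ltac:(by [])).
have xK' p : prime p -> (p ^ k <= Num.truncn x)%N -> (p < K)%N.
  move=> pp pk; apply: leq_ltn_trans xK; apply: leq_trans pk.
  by rewrite -{1}(expn1 p) leq_pexp2l ?(prime_gt0 pp) // (leq_trans h0).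
move=> /(_ xK').
have sq (f : nat -> R) : \sum_(0 <= p < K | prime p) \sum_(0 <= q < K | (prime q && (q != p)) && true)
    f p * f q = (\sum_(0 <= p < K | prime p) f p) ^+ 2 - \sum_(0 <= p < K | prime p) f p ^+ 2.
  rewrite sum_prime_sqr addrAC subrr add0r; apply: eq_bigr => p _.
  by apply: eq_bigl => q; rewrite andbT.
rewrite !sq -/(S k K) -/(T k K) -/(U k K) => /le_trans; apply.
rewrite ler_wpM2l ?mulr_ge0 ?powR_ge0 // lerD2l lerBlDr lerDl sumr_ge0 // => p _.
exact: sqr_ge0.
Qed.

Section Convergence.
Variable k : nat.
Hypothesis hk : (h < k)%N.

Let S_tail := @prime_sum_tail R _ 1 _ hV (fun p => @cweight_bound R h h0 k p hk).
Let T_tail := @prime_sum_tail R _ 1 _ hV (fun p => @cweight2_bound R h h0 k p hk).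

Lemma cweight_sum_cvg : (fun K => S k K) @ \oo --> Sinf k.
Proof. by have [] := S_tail. Qed.

Lemma cweight2_sum_cvg : (fun K => T k K) @ \oo --> Tinf k.
Proof. by have [] := T_tail. Qed.

Lemma cweight_sum_tail M : (0 < M)%N -> `|Sinf k - S k M.+1| <= h%:R * M%:R `^ (- h%:R^-1).
Proof. by have [_ H] := S_tail; move=> /H; rewrite div1r invrK. Qed.

Lemma cweight2_sum_tail M : (0 < M)%N -> `|Tinf k - T k M.+1| <= h%:R * M%:R `^ (- h%:R^-1).
Proof. by have [_ H] := T_tail; move=> /H; rewrite div1r invrK. Qed.

Lemma cweight_sum_bounds K : 0 <= S k K <= h%:R.
Proof.
apply/andP; split; first by apply: sumr_ge0 => p; exact: cweight_ge0.
have := @prime_powR_sum_le R h%:R^-1 K hV; rewrite invrK; apply: le_trans.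
apply: ler_sum => p pp; have := cweight_bound R h h0 k p hk pp.
by rewrite mul1r; apply: le_trans; exact: ler_norm.
Qed.

Lemma cweight_sum_lim_bounds : 0 <= Sinf k <= h%:R.
Proof.
have c := cweight_sum_cvg; rewrite -(cvg_lim _ c) //.
have cc : cvgn (fun K => S k K) by apply/cvg_ex; eexists; exact: c.
apply/andP; split.
  by apply: limr_ge => //; apply: nearW => K; have /andP[] := cweight_sum_bounds K.
by apply: limr_le => //; apply: nearW => K; have /andP[] := cweight_sum_bounds K.
Qed.
End Convergence.

(** K tends to infinity with x fixed: the left side does not see primes beyond x, and the error sum
    stays bounded because p^(-k/(h+1)) <= p^(-(1+1/(h+1))), which sums to at most h + 1. Thus no
    tail of the main sums has to be estimated. *)
Lemma omega2_large : exists2 C : R, 0 <= C & forall (k : nat) (x : R), (h.+1 < k)%N -> 0 < x ->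
  `|hfull_omega2_sum h k x - gam * X x * (Sinf k + (Sinf k ^+ 2 - Tinf k))| <= C * X' x.
Proof.
have [C C0 H] := omega2_approx_full.
exists (C * (h.+1%:R + h.+1%:R ^+ 2)); first by rewrite mulr_ge0 // addr_ge0 // exprn_ge0.
move=> k x hk x0; have hk' : (h < k)%N by exact: ltnW.
have Ub K : 0 <= U k K <= h.+1%:R.
  apply/andP; split; first by apply: sumr_ge0 => p _; rewrite exprn_ge0 // root_inv_ge0.
  have hV' : 0 < h.+1%:R^-1 :> R by rewrite invr_gt0.
  have := @prime_powR_sum_le R h.+1%:R^-1 K hV'; rewrite invrK; apply: le_trans.
  by apply: ler_sum => p pp; apply: root_invX_le.
have c : (fun K => `|hfull_omega2_sum h k x - gam * X x * (S k K + (S k K ^+ 2 - T k K))|) @ \oo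
    --> `|hfull_omega2_sum h k x - gam * X x * (Sinf k + (Sinf k ^+ 2 - Tinf k))|.
  have cS := cweight_sum_cvg k hk'; have cT := cweight2_sum_cvg k hk'.
  apply: cvg_norm; apply: cvgB; first exact: cvg_cst.
  apply: cvgM; first exact: cvg_cst.
  apply: cvgD => //; apply: cvgB => //.
  by rewrite expr2; under eq_fun do rewrite expr2; exact: cvgM.
rewrite -(cvg_lim _ c) //; apply: limr_le; first by apply/cvg_ex; eexists; exact: c.
exists (Num.truncn x).+1 => // K /= xK; apply: (le_trans (H k K x (ltnW hk') x0 xK)).
rewrite -mulrA [X' x * _]mulrC mulrA ler_wpM2r ?powR_ge0 // ler_wpM2l //.
have /andP[a b] := Ub K; apply: lerD => //.
by rewrite lerXn2r // nnegrE.
Qed.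

(** Here the error sum is that of 1/p and diverges, so the primes are cut at x. Cutting the main
    sums there costs x^(1/h) times a tail of order x^(-1/h), which is O(1). *)
Lemma omega2_succ : exists2 C : R, 0 <= C & forall x : R, 1 <= ln (ln x) ->
  `|hfull_omega2_sum h h.+1 x - gam * X x * (Sinf h.+1 + (Sinf h.+1 ^+ 2 - Tinf h.+1))|
  <= C * (X' x * ln (ln x) ^+ 2).
Proof.
have [C C0 H] := omega2_approx_full.
have [D D0 HD] := prime_recip_le R.
have g0 : 0 <= gam := le_trans ler01 (gamma0_ge1 R h h0).
have hR : (1 : R) <= h%:R by rewrite ler1n.
exists (C * (D + D ^+ 2) + 2 * gam * (h%:R * (2 * h%:R + 2))).
  by rewrite addr_ge0 // ?mulr_ge0 ?addr_ge0 ?exprn_ge0 ?mulr_ge0.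
move=> x L1; pose k := h.+1; rewrite -/k; have hk : (h < k)%N by [].
have l1 : 1 < ln x.
  by rewrite ltNge; apply/negP => /ln_le0; lra.
have x1 : 1 < x by rewrite ltNge; apply/negP => /ln_le0; lra.
have x0 : 0 < x by lra.
set L := ln (ln x) in L1 *.
set M := Num.truncn x; have M0 : (0 < M)%N by rewrite truncn_gt0 ltW.
have MR : (1 : R) <= M%:R by rewrite ler1n.
have /andP[M1 M2] := truncn_itv (ltW x0); rewrite -/M in M1 M2.
have xM : x <= 2 * M%:R by rewrite -natr1 in M2; lra.
have X1 : 1 <= X' x.
  by rewrite /X' -[leLHS](powRr0 x) ler_powR ?invr_ge0 // ltW.
have b1 := H k M.+1 x (ltnW hk) x0 (ltnSn M).
have UE : U k M.+1 = \sum_(0 <= p < M.+1 | prime p) p%:R^-1.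
  by apply: eq_bigr => p _; rewrite root_invXh.
have U1 : 0 <= U k M.+1 <= D * L.
  rewrite UE HD // andbT; apply: sumr_ge0 => p _; by rewrite invr_ge0.
have LL : L <= L ^+ 2 by rewrite expr2 ler_peMr //; lra.
have b2 : C * X' x * (U k M.+1 + U k M.+1 ^+ 2) <= C * (D + D ^+ 2) * (X' x * L ^+ 2).
  have -> : C * (D + D ^+ 2) * (X' x * L ^+ 2) = C * X' x * ((D + D ^+ 2) * L ^+ 2) by lra.
  case/andP: U1 => Ua Ub.
  rewrite ler_wpM2l ?mulr_ge0 ?powR_ge0 // mulrDl; apply: lerD.
    by apply: (le_trans Ub); rewrite ler_wpM2l.
  by rewrite -exprMn lerXn2r // nnegrE (le_trans Ua).
have tS := cweight_sum_tail k hk M M0; have tT := cweight2_sum_tail k hk M M0.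
have /andP[s1 s2] := cweight_sum_bounds k hk M.+1.
have /andP[s3 s4] := cweight_sum_lim_bounds k hk.
set tau := h%:R * M%:R `^ _ in tS tT.
have Xtau : X x * tau <= 2 * h%:R.
  rewrite /tau mulrCA [leLHS]mulrC ler_wpM2r //.
  rewrite powRN ler_pdivrMr ?powR_gt0 //; last lra.
  apply: (@le_trans _ _ ((2 * M%:R) `^ h%:R^-1)).
    by apply: ler_powRl => //; exact: ltW.
  rewrite powRM // ler_wpM2r ?powR_ge0 //.
  rewrite -[leRHS]powRr1 // ler_powR //; first lra.
  by rewrite invf_le1 // ltr0n.
have tau0 : 0 <= tau by rewrite mulr_ge0 ?powR_ge0.
have b3 : `|gam * X x * (S k M.+1 + (S k M.+1 ^+ 2 - T k M.+1)) -
    gam * X x * (Sinf k + (Sinf k ^+ 2 - Tinf k))| <= 2 * gam * (h%:R * (2 * h%:R + 2)).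
  rewrite -mulrBr normrM ger0_norm; last by rewrite mulr_ge0 // powR_ge0.
  apply: (@le_trans _ _ (gam * X x * ((2 * h%:R + 2) * tau))).
    rewrite ler_wpM2l ?mulr_ge0 ?powR_ge0 //.
    set a := S k M.+1 in tS s1 s2 *; set b := Sinf k in tS s3 s4 *.
    have h1 : `|(b - a) * (a + b)| <= tau * (2 * h%:R).
      rewrite normrM ler_pM // ger0_norm; lra.
    move: tS tT h1; rewrite !ler_norml => /andP[t1 t2] /andP[t3 t4] /andP[t5 t6].
    by apply/andP; split; lra.
  have := ler_wpM2l (mulr_ge0 g0 (addr_ge0 (mulr_ge0 (ler0n R 2) (ler0n R h)) (ler0n R 2))) Xtau.
  lra.
have b4 : 2 * gam * (h%:R * (2 * h%:R + 2)) <= 2 * gam * (h%:R * (2 * h%:R + 2)) * (X' x * L ^+ 2).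
  rewrite ler_peMr ?mulr_ge0 ?addr_ge0 ?mulr_ge0 //.
  by rewrite -[leLHS]mulr1 ler_pM //; lra.
rewrite [leRHS]mulrDl.
set Y := hfull_omega2_sum _ _ _ in b1 *.
set Z := gam * X x * (S _ _ + _) in b1 b3; set W := gam * X x * _ in b3 *.
have -> : Y - W = (Y - Z) + (Z - W) by ring.
apply: (le_trans (ler_normD _ _)); lra.
Qed.
End LargeExponents.

(** * The case k = h *)

Lemma sum_buckets (V : nmodType) (G : nat -> V) (N : nat) :
  \sum_(0 <= p < 2 ^ N | prime p) G p =
  \sum_(0 <= i < N) \sum_(2 ^ i <= p < 2 ^ i.+1 | prime p) G p.
Proof.
elim: N => [|N IH]; first by rewrite expn0 big_mkcond big_nat1 /= big_geq.
by rewrite bucket_recr IH big_nat_recr.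
Qed.

Section PairSum.
Variables (R : realType) (f : nat -> R).
Hypothesis f_ge0 : forall p, prime p -> 0 <= f p.

(** Keeps the diagonal p = q, so that the sum can be compared with convolutions over buckets;
    [pair_sum_diag] removes it afterwards. *)
Definition pair_sum (K : nat) : R :=
  \sum_(0 <= p < K | prime p) \sum_(0 <= q < K | prime q && (p * q < K)%N) f p * f q.

Definition dyadic_sum (N : nat) : R := \sum_(0 <= p < 2 ^ N | prime p) f p.

Let subsum (a b : nat) (P Q : pred nat) (F : nat -> R) : (a <= b)%N ->
  (forall q, (q < a)%N -> P q -> Q q) -> (forall q, Q q -> 0 <= F q) ->
  \sum_(0 <= q < a | P q) F q <= \sum_(0 <= q < b | Q q) F q.
Proof.
move=> ab PQ F0; rewrite [leRHS](@big_cat_nat _ _ _ a) //=.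
apply: ler_wpDr; first exact: sumr_ge0.
rewrite big_nat_cond [leRHS]big_nat_cond big_mkcond [leRHS]big_mkcond /=.
apply: ler_sum => q _; case: ifPn => [/andP[qa Pq]|_].
  by rewrite qa PQ.
by case: ifPn => // /andP[_]; exact: F0.
Qed.

Lemma dyadic_sum0 : dyadic_sum 0 = 0.
Proof. by rewrite /dyadic_sum expn0 big_mkcond big_nat1. Qed.

Lemma dyadic_sum_incr N : dyadic_sum N <= dyadic_sum N.+1.
Proof. by apply: subsum => //; rewrite leq_exp2l. Qed.

Lemma dyadic_sum_diff N : dyadic_sum N.+1 - dyadic_sum N =
  \sum_(2 ^ N <= p < 2 ^ N.+1 | prime p) f p.
Proof. by rewrite /dyadic_sum bucket_recr addrAC subrr add0r. Qed.

Lemma pair_sum_mono K K' : (K <= K')%N -> pair_sum K <= pair_sum K'.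
Proof.
move=> KK'; apply: (@le_trans _ _ (\sum_(0 <= p < K | prime p)
  \sum_(0 <= q < K' | prime q && (p * q < K')%N) f p * f q)).
  apply: ler_sum => p pp; apply: subsum => // q.
    by move=> _ /andP[-> pq] /=; apply: leq_trans pq KK'.
  by move=> /andP[pq _]; rewrite mulr_ge0 ?f_ge0.
apply: subsum => // p pp; apply: sumr_ge0 => q /andP[pq _].
by rewrite mulr_ge0 ?f_ge0.
Qed.

Let ler_buckets (F G : nat -> R) (i : nat) :
  (forall p, prime p -> (2 ^ i <= p < 2 ^ i.+1)%N -> F p <= G p) ->
  \sum_(2 ^ i <= p < 2 ^ i.+1 | prime p) F p <= \sum_(2 ^ i <= p < 2 ^ i.+1 | prime p) G p.
Proof.
move=> FG; rewrite big_nat_cond [leRHS]big_nat_cond.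
by apply: ler_sum => p /andP[pi pp]; exact: FG.
Qed.

(** For p in [2^i, 2^(i+1)), p q < 2^N implies q < 2^(N-i), and it follows from q < 2^(N-i-1), the
    case of [pair_sum_ge]. The gap of one bucket amounts to a shift of N by one. *)
Lemma pair_sum_le N : pair_sum (2 ^ N) <=
  \sum_(0 <= i < N) (dyadic_sum i.+1 - dyadic_sum i) * dyadic_sum (N - i)%N.
Proof.
rewrite /pair_sum sum_buckets big_nat [leRHS]big_nat; apply: ler_sum => i /andP[_ iN].
rewrite dyadic_sum_diff mulr_suml; apply: ler_buckets => p pp /andP[pi _].
rewrite -mulr_sumr ler_wpM2l ?f_ge0 //.
rewrite (eq_bigl (fun q => (prime q && (p * q < 2 ^ N)%N) && (q < 2 ^ (N - i))%N)); last first.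
  move=> q; case: (prime q) => //=; case: ltnP => //= pqN; apply/esym.
  rewrite -(ltn_pmul2l (expn_gt0 2 i : (0 < 2 ^ i)%N)).
  by rewrite -expnD subnKC ?(ltnW iN) // (leq_ltn_trans _ pqN) // leq_mul2r pi orbT.
rewrite -big_nat_widen; last by rewrite leq_exp2l // leq_subr.
by apply: subsum => // q _ /andP[].
Qed.

Lemma pair_sum_ge N :
  \sum_(0 <= i < N) (dyadic_sum i.+1 - dyadic_sum i) * dyadic_sum (N - i.+1)%N
  <= pair_sum (2 ^ N).
Proof.
rewrite /pair_sum sum_buckets big_nat [leRHS]big_nat; apply: ler_sum => i /andP[_ iN].
rewrite dyadic_sum_diff mulr_suml; apply: ler_buckets => p pp /andP[_ pi].
rewrite -mulr_sumr ler_wpM2l ?f_ge0 //.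
apply: subsum; first by rewrite leq_exp2l // leq_subr.
  move=> q qN ->; rewrite /= -(subnKC iN) expnD.
  have [->|q0] := posnP q; first by rewrite muln0 muln_gt0 !expn_gt0.
  by apply: (@leq_trans (p.+1 * q)); [rewrite mulSn -[X in (X < _)%N]add0n ltn_add2r|
    rewrite leq_mul // ltnW].
by move=> q /andP[/f_ge0].
Qed.

(** The upper bound is the convolution at N + 1: its additional last term contains [dyadic_sum] at
    0, which vanishes. *)
Lemma pair_sum_le_conv N : pair_sum (2 ^ N) <=
  \sum_(0 <= i < N.+1) (dyadic_sum i.+1 - dyadic_sum i) * dyadic_sum (N.+1 - i.+1)%N.
Proof.
rewrite big_nat_recr //= subnn dyadic_sum0 mulr0 addr0.
exact: pair_sum_le.
Qed.

Lemma pair_sum_diag K :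
  \sum_(0 <= p < K | prime p) \sum_(0 <= q < K | (prime q && (q != p)) && (p * q < K)%N)
    f p * f q = pair_sum K - \sum_(0 <= p < K | prime p && (p * p < K)%N) f p ^+ 2.
Proof.
apply/eqP; rewrite eq_sym subr_eq; apply/eqP.
rewrite [X in _ + X]big_mkcondr -big_split /= /pair_sum.
rewrite [LHS]big_nat_cond [RHS]big_nat_cond; apply: eq_bigr => p /andP[/andP[_ pK] pp].
rewrite big_mkcondr (sum_prime_D1 _ K p _ pp pK) addrC expr2; congr (_ + _).
by rewrite [RHS]big_mkcondr.
Qed.

Lemma off_diag_le K :
  \sum_(0 <= p < K | prime p) \sum_(0 <= q < K | (prime q && (q != p)) && (p * q < K)%N)
    f p * f q <= pair_sum K.
Proof.
by rewrite pair_sum_diag lerBlDr lerDl sumr_ge0 // => p _; rewrite sqr_ge0.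
Qed.
End PairSum.

Lemma geometric_over_index (R : realType) (rho : R) : 1 < rho ->
  exists2 D : R, 0 <= D & forall N, \sum_(0 <= i < N) rho ^+ i.+1 / i.+1%:R <= D * rho ^+ N / N%:R.
Proof.
move=> r1; set d := rho - 1; have d0 : 0 < d by rewrite subr_gt0.
have r0 : 0 < rho by lra.
(* From m = [N0] on, 1/m <= d/2. Half of the growth rho = 1 + d then absorbs the change from 1/m to
   1/(m+1), the other half the new term. In [D], N0 S0 covers the start and 2 rho/d the new
   terms. *)
set N0 := (Num.truncn (2 / d)).+1.
set S0 := \sum_(0 <= i < N0) rho ^+ i.+1 / i.+1%:R.
have P0 i : 0 <= rho ^+ i.+1 / i.+1%:R by rewrite divr_ge0 // exprn_ge0 // ltW.
have S00 : 0 <= S0 by exact: sumr_ge0.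
set D := N0%:R * S0 + 2 * rho / d.
have q0 : 0 <= 2 * rho / d.
  by apply: divr_ge0; [apply: mulr_ge0 => //; exact: ltW|exact: ltW].
have D0 : 0 <= D by apply: addr_ge0 => //; exact: mulr_ge0.
exists D => // N; have [NN0|N0N] := leqP N N0.
  have [->|Npos] := posnP N; first by rewrite big_geq // invr0 mulr0.
  have NR : (0 : R) < N%:R by rewrite ltr0n.
  rewrite ler_pdivlMr //; apply: (@le_trans _ _ (S0 * N0%:R)).
    apply: ler_pM; [exact: sumr_ge0|by []| |by rewrite ler_nat].
    by rewrite /S0 [leRHS](@big_cat_nat _ _ _ N) //= lerDl sumr_ge0.
  apply: (@le_trans _ _ (D * 1)).
    by rewrite mulr1 mulrC lerDl.
  by rewrite ler_wpM2l // exprn_ege1 // ltW.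
have E : exists n, N = (N0 + n)%N by exists (N - N0)%N; lia.
case: E => n ->; elim: n => [|n IH].
  rewrite addn0 -/S0 ler_pdivlMr ?ltr0n //; apply: (@le_trans _ _ (D * 1)).
    by rewrite mulr1 mulrC lerDl.
  by rewrite ler_wpM2l // exprn_ege1 // ltW.
rewrite addnS big_nat_recr //=; apply: (le_trans (lerD IH (lexx _))).
set m := (N0 + n)%N; have mR : (0 : R) < m%:R by rewrite ltr0n addn_gt0.
have m2 : 2 / d <= m%:R.
  apply: (@le_trans _ _ N0%:R); first exact/ltW/truncnS_gt.
  by rewrite ler_nat leq_addr.
have rm : 0 < rho ^+ m by rewrite exprn_gt0.
rewrite exprS -natr1 ler_pdivlMr; last by rewrite addr_gt0.
rewrite mulrDl divfK; last by rewrite gt_eqF // addr_gt0.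
have m1 : D * rho ^+ m / m%:R * (m%:R + 1) = D * rho ^+ m * (1 + m%:R^-1).
  by rewrite -[LHS]mulrA [_^-1 * _]mulrDr mulVf ?gt_eqF // mulr1.
have k : m%:R^-1 <= d / 2.
  rewrite -[leRHS]invrK lef_pV2 ?posrE ?invr_gt0 ?divr_gt0 // invf_div //.
have k2 : rho <= D * (d / 2).
  have : 2 * rho / d <= D by rewrite lerDr mulr_ge0.
  by rewrite ler_pdivrMr //; lra.
rewrite m1.
have h1 : D * rho ^+ m * m%:R^-1 <= D * rho ^+ m * (d / 2).
  by rewrite ler_wpM2l // mulr_ge0 // ltW.
have h2 : rho * rho ^+ m <= D * (d / 2) * rho ^+ m by rewrite ler_wpM2r // ltW.
have -> : D * (rho * rho ^+ m) = D * rho ^+ m + D * rho ^+ m * d by rewrite /d; lra.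
by lra.
Qed.

Section EqualExponent.
Variables (R : realType) (h : nat).
Hypothesis h0 : (0 < h)%N.
Let ub p : R := root_inv R h.+1 p ^+ h.
Let rho : R := 2 `^ h.+1%:R^-1.

Let rho_bounds : 1 < rho <= 2.
Proof.
have a : 0 < h.+1%:R^-1 :> R by rewrite invr_gt0.
rewrite /rho powR_expR // expR_gt1 mulr_gt0 ?ln_gt0 //=; last lra.
rewrite -powR_expR // -[leRHS]powRr1 // ler_powR //; first lra.
by rewrite invf_le1 // ler1n.
Qed.

Let rho0 : 0 < rho. Proof. by have /andP[a _] := rho_bounds; apply: lt_trans a. Qed.

Let ub_ge0 p : prime p -> 0 <= ub p.
Proof. by move=> _; rewrite exprn_ge0 // root_inv_ge0. Qed.

Let ub_bucket p i : prime p -> (p < 2 ^ i)%N -> ub p <= rho ^+ i * p%:R^-1.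
Proof.
move=> pp pi; have u0 : 0 < root_inv R h.+1 p by rewrite root_inv_gt0 // prime_gt0.
have -> : ub p = p%:R `^ h.+1%:R^-1 * p%:R^-1.
  rewrite -(root_invXh R h.+1 isT p) exprS mulrA.
  by rewrite /root_inv mulfV ?mul1r // gt_eqF // powR_gt0 // ltr0n prime_gt0.
rewrite ler_wpM2r ?invr_ge0 // /rho -natrX_powR ler_powRl ?invr_ge0 //.
by rewrite ler_nat ltnW.
Qed.

(** The error weight p^(-h/(h+1)) is p^(1/(h+1))/p, at most rho^(i+1)/p in bucket i, so its bucket
    sums are O(rho^(i+1)/(i+1)). In a convolution of two of them the powers of rho multiply to
    rho^(N+1) in every term, leaving the sum of [sum_inv_pair]. *)
Lemma ub_sums : exists2 D : R, 0 <= D & forall N, (0 < N)%N ->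
  dyadic_sum R ub N <= D * (rho ^+ N / N%:R) /\
  pair_sum R ub (2 ^ N) <= D * (rho ^+ N * ((1 + ln N%:R) / N%:R)).
Proof.
have [c [C PHc]] := mertens2 R.
have P0 : dyadic_sum R (fun p => p%:R^-1) 0 = 0 := dyadic_sum0 R _.
have C0 : 0 <= C by have := PHc 1%N isT; rewrite divr1; apply: le_trans.
have inc := increment_le R (dyadic_sum R (fun p => p%:R^-1)) c C P0 PHc.
set Ca := 1 + 2 * (2 * C + `|c|) in inc.
have Ca0 : 0 <= Ca by rewrite /Ca addr_ge0 // mulr_ge0 // addr_ge0 // mulr_ge0.
have /andP[r1 r2] := rho_bounds.
have [D D0 HD] := geometric_over_index R rho r1.
have diff i : 0 <= dyadic_sum R ub i.+1 - dyadic_sum R ub i <= Ca * (rho ^+ i.+1 / i.+1%:R).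
  apply/andP; split; first by rewrite subr_ge0 dyadic_sum_incr.
  rewrite dyadic_sum_diff mulrCA; apply: le_trans (ler_wpM2l (exprn_ge0 _ (ltW rho0)) (inc i)).
  rewrite dyadic_sum_diff mulr_sumr big_nat_cond [leRHS]big_nat_cond.
  by apply: ler_sum => p /andP[/andP[_ pi] pp]; exact: ub_bucket.
have dy N : dyadic_sum R ub N <= Ca * D * (rho ^+ N / N%:R).
  have -> : dyadic_sum R ub N = \sum_(0 <= i < N) (dyadic_sum R ub i.+1 - dyadic_sum R ub i).
    by rewrite telescope_sumr // dyadic_sum0 subr0.
  apply: (@le_trans _ _ (\sum_(0 <= i < N) Ca * (rho ^+ i.+1 / i.+1%:R))).
    by apply: ler_sum => i _; have /andP[] := diff i.
  by rewrite -mulr_sumr -mulrA ler_wpM2l // mulrA.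
exists (Ca * D + 2 * (Ca * (Ca * D)) * rho).
  by apply: addr_ge0; [exact: mulr_ge0|do ! apply: mulr_ge0 => //; exact: ltW].
move=> N N0; have NR : (0 : R) < N%:R by rewrite ltr0n.
have q0 : 0 <= rho ^+ N / N%:R by rewrite divr_ge0 // exprn_ge0 // ltW.
have L0 := @ln_nat_ge0 R N.
have k0 : 0 <= 2 * (Ca * (Ca * D)) * rho.
  by do ! apply: mulr_ge0 => //; exact: ltW.
split; first by apply: (le_trans (dy N)); rewrite ler_wpM2r // lerDl.
apply: (le_trans (pair_sum_le R ub ub_ge0 N)).
apply: (@le_trans _ _ (\sum_(0 <= i < N) Ca * (Ca * D) * rho ^+ N.+1 * (i.+1%:R * (N - i)%:R)^-1)).
  rewrite big_nat [leRHS]big_nat; apply: ler_sum => i /andP[_ iN].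
  have /andP[d1 d2] := diff i.
  have -> : Ca * (Ca * D) * rho ^+ N.+1 / (i.+1%:R * (N - i)%:R) =
    (Ca * (rho ^+ i.+1 / i.+1%:R)) * (Ca * D * (rho ^+ (N - i) / (N - i)%:R)).
    have -> : N.+1 = (i.+1 + (N - i))%N by rewrite addSn subnKC // ltnW.
    by rewrite exprD invfM; set a := _^-1; set b := _^-1; lra.
  by apply: ler_pM => //; rewrite /dyadic_sum sumr_ge0.
rewrite -mulr_sumr sum_inv_pair exprS.
have H1 := harmonic_le R N N0.
have H2 : 2 * series harmonic N / N.+1%:R <= 2 * ((1 + ln N%:R) / N%:R) :> R.
  rewrite -mulrA ler_wpM2l //; apply: ler_pM => //.
  - by apply: le_trans (harmonic_ge1 R N N0); exact: ler01.
  - by rewrite lef_pV2 ?posrE ?ltr0n // ler_nat.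
apply: (@le_trans _ _ (Ca * (Ca * D) * (rho * rho ^+ N) * (2 * ((1 + ln N%:R) / N%:R)))).
  rewrite ler_wpM2l //; do ! apply: mulr_ge0 => //; try exact: ltW.
  by rewrite exprn_ge0 // ltW.
have -> : Ca * (Ca * D) * (rho * rho ^+ N) * (2 * ((1 + ln N%:R) / N%:R)) =
  2 * (Ca * (Ca * D)) * rho * (rho ^+ N * ((1 + ln N%:R) / N%:R)) by lra.
rewrite ler_wpM2r //; last by rewrite lerDr mulr_ge0.
rewrite mulr_ge0 ?exprn_ge0 ?(ltW rho0) // divr_ge0 // addr_ge0 //.
Qed.

Let c p : R := cweight R h h p.
Let G : R := prime_sum (fun p => ln (1 - p%:R^-1) + p%:R^-1).
Let Lhh : R := Lh h (2 * h%:R).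

Let c_ge0 p : prime p -> 0 <= c p. Proof. exact: cweight_ge0. Qed.

Let v_bounds p : prime p -> 0 < root_inv R h p /\ root_inv R h p <= root_inv R h 2 /\
  root_inv R h 2 < 1.
Proof.
move=> pp; have [a b] := root_inv_lt1 R h h0 p pp.
by split=> //; rewrite root_inv_gt0 // prime_gt0.
Qed.

Let cE p : prime p -> c p = p%:R^-1 - Lterm R h h.*2 p.
Proof.
move=> pp; have [v0 [v1 v2]] := v_bounds p pp.
rewrite /c /cweight weightE // /Lterm -mul2n mulnC exprM -(root_invXh R h h0 p).
have : 0 < root_inv R h p ^+ h by rewrite exprn_gt0.
have : root_inv R h p < 1 by lra.
move: (root_inv R h p ^+ h) (root_inv R h p) => b a a1 b0.
by field; apply: lt0r_neq0; lra.
Qed.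

Let powR2 (n : nat) : n%:R `^ (- (1 + 1)) = n%:R^-1 ^+ 2 :> R.
Proof. by rewrite powRN -[1 + 1]/(2%:R) powR_mulrn // exprVn. Qed.

(** Since (1 - v) v^h/(1 - v + v^h) = v^h - v^(2h)/(1 - v + v^h), c_p is 1/p minus the general term
    of L_h(2h); hence [Lhh] and, from there, L_h(2h) in D1. *)
Lemma dyadic_cweight : exists2 C : R, 0 <= C & forall N, (0 < N)%N ->
  `|dyadic_sum R c N - series harmonic N - (ln (ln 2) + G - Lhh)| <= C / N%:R.
Proof.
have [b [C PHb]] := mertens2 R.
have C0 : 0 <= C by have := PHb 1%N isT; rewrite divr1; apply: le_trans.
have bE := mertens_constE R b C PHb; rewrite -/G in bE.
have v21 : 0 < 1 - root_inv R h 2 by have [_ [_ v2]] := v_bounds 2 isT; lra.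
set B := (1 - root_inv R h 2)^-1; have B0 : 0 < B by rewrite invr_gt0.
have Lb p : prime p -> `|Lterm R h h.*2 p| <= B * p%:R `^ (- (1 + 1)).
  move=> pp; have [v0 [v1 v2]] := v_bounds p pp.
  have d0 : 0 < root_inv R h p ^+ h by rewrite exprn_gt0.
  have v3 : root_inv R h p < 1 by lra.
  rewrite /Lterm ger0_norm; last by rewrite divr_ge0 ?exprn_ge0 ?(ltW v0) //; lra.
  rewrite powR2 -(root_invXh R h h0 p) -exprM muln2 mulrC ler_wpM2r ?exprn_ge0 ?(ltW v0) //.
  by rewrite lef_pV2 ?posrE //; lra.
have [_ Lt] := @prime_sum_tail R _ B 1 ltr01 Lb.
exists (C + B); first by rewrite addr_ge0 // ltW.
move=> N N0; have NR : (0 : R) < N%:R by rewrite ltr0n.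
have h1 := PHb N N0.
have h2 : `|Lhh - \sum_(0 <= p < 2 ^ N | prime p) Lterm R h h.*2 p| <= B / N%:R.
  have -> : Lhh = prime_sum (Lterm R h h.*2).
    by rewrite -LhE // /Lhh -natrM mul2n.
  have hN : (N < 2 ^ N)%N by exact: ltn_expl.
  have hN' : (N <= (2 ^ N).-1)%N by rewrite -ltnS prednK ?expn_gt0.
  have := Lt (2 ^ N).-1 (leq_trans N0 hN'); rewrite prednK ?expn_gt0 // divr1.
  move/le_trans; apply; rewrite powR_inv1 // ler_wpM2l ?(ltW B0) //.
  by rewrite lef_pV2 ?posrE ?ltr0n ?ler_nat // (leq_trans N0).
have -> : dyadic_sum R c N = \sum_(0 <= p < 2 ^ N | prime p) p%:R^-1 -
    \sum_(0 <= p < 2 ^ N | prime p) Lterm R h h.*2 p.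
  by rewrite -sumrB; apply: eq_bigr => p; exact: cE.
rewrite mulrDl.
set P := \sum_(_ <= _ < _ | _) _^-1 in h1 *; set L := \sum_(_ <= _ < _ | _) _ in h2 *.
have -> : P - L - series harmonic N - (ln (ln 2) + G - Lhh) =
  (P - series harmonic N - b) + (Lhh - L) by rewrite bE; lra.
by apply: (le_trans (ler_normD _ _)); exact: lerD.
Qed.
End EqualExponent.

Lemma ln_shift_le (R : realType) (N j : nat) : (0 < N)%N ->
  ln (N + j)%:R <= ln N%:R + j%:R / N%:R :> R.
Proof.
move=> N0; have NR : (0 : R) < N%:R by rewrite ltr0n.
have q0 : 0 < 1 + j%:R / N%:R :> R by rewrite ltr_pwDl // divr_ge0.
have -> : (N + j)%:R = N%:R * (1 + j%:R / N%:R) :> R.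
  by rewrite natrD mulrDr mulr1 mulrCA mulfV ?mulr1 // gt_eqF.
rewrite lnM ?posrE // lerD2l.
by have := ln_le_sub1 _ _ q0; lra.
Qed.

Section OmegaEqual.
Variables (R : realType) (h : nat).
Hypothesis h0 : (0 < h)%N.
Let c p : R := cweight R h h p.
Let G : R := prime_sum (fun p => ln (1 - p%:R^-1) + p%:R^-1).
Let Lhh : R := Lh h (2 * h%:R).
(** The constant in the sum of c_p over p < 2^N when this is compared with ln N instead of a
    harmonic number. *)
Let kap : R := euler_gamma R + (ln (ln 2) + G - Lhh).
Let T : R := prime_sum (fun p => c p ^+ 2).
Let E N : R := (1 + ln N%:R) / N%:R.

Let c_ge0 p : prime p -> 0 <= c p. Proof. exact: cweight_ge0. Qed.

Let E_ge N : (0 < N)%N -> (0 : R) < N%:R^-1 /\ N%:R^-1 <= E N.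
Proof.
move=> N0; have i0 : 0 < N%:R^-1 :> R by rewrite invr_gt0 ltr0n.
by split=> //; rewrite /E ler_peMl ?(ltW i0) // lerDl ln_nat_ge0.
Qed.

Let dyadic_ln : exists2 C : R, 0 <= C & forall N, (0 < N)%N ->
  `|dyadic_sum R c N - (ln N%:R + kap)| <= C / N%:R.
Proof.
have [C C0 H] := dyadic_cweight R h h0; exists (C + 1); first exact: addr_ge0.
move=> N N0; have h1 := H N N0; have h2 := harmonic_ln R N N0.
rewrite mulrDl mul1r; set D := dyadic_sum _ _ _ in h1 *.
have -> : D - (ln N%:R + kap) = (D - series harmonic N - (ln (ln 2) + G - Lhh)) +
  (series harmonic N - ln N%:R - euler_gamma R) by rewrite /kap; lra.
by apply: (le_trans (ler_normD _ _)); exact: lerD.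
Qed.

(** The condition p^2 <= m keeps all primes up to a = 2^(N %/ 2), and N <= 2 a makes the missing
    tail O(1/N). *)
Lemma diag_close : forall N m : nat, (2 ^ N <= m)%N -> (0 < N)%N ->
  `|\sum_(0 <= p < m.+1 | prime p && (p * p < m.+1)%N) c p ^+ 2 - T| <= 2 * N%:R^-1.
Proof.
move=> N m Nm N0; have NR : (0 : R) < N%:R by rewrite ltr0n.
have cb p : prime p -> `|c p ^+ 2| <= 1 * p%:R `^ (- (1 + 1)).
  move=> pp; rewrite mul1r powRN -[1 + 1]/(2%:R) powR_mulrn // -exprVn normrX.
  rewrite lerXn2r // ?nnegrE ?invr_ge0 // ger0_norm ?c_ge0 //.
  by rewrite -(root_invXh R h h0 p); exact: cweight_le.
have [_ Tt] := @prime_sum_tail R (fun p => c p ^+ 2) 1 1 ltr01 cb.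
have tail a : (0 < a)%N -> `|T - \sum_(0 <= p < a.+1 | prime p) c p ^+ 2| <= a%:R^-1.
  by move=> /Tt; rewrite divr1 mul1r powR_inv1.
set a := (2 ^ (N %/ 2))%N.
have a0 : (0 < a)%N by rewrite expn_gt0.
have Na : (N <= 2 * a)%N.
  have : (N %/ 2 < a)%N by exact: ltn_expl.
  by have := ltn_ceil N (isT : 0 < 2)%N; lia.
have aam : (a * a <= m)%N.
  by apply: leq_trans Nm; rewrite -expnD leq_exp2l // addnn -muln2 leq_trunc_div.
have am : (a <= m)%N by apply: leq_trans aam; rewrite leq_pmulr.
have m0 : (0 < m)%N by apply: leq_trans am.
have s1 : \sum_(0 <= p < a.+1 | prime p) c p ^+ 2 <=
    \sum_(0 <= p < m.+1 | prime p && (p * p < m.+1)%N) c p ^+ 2.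
  rewrite [leRHS](@big_cat_nat _ _ _ a.+1) //=.
  apply: ler_wpDr; first by apply: sumr_ge0 => p _; exact: sqr_ge0.
  rewrite big_nat_cond [leRHS]big_nat_cond; rewrite big_mkcond [leRHS]big_mkcond.
  apply: ler_sum => p _; case: ifPn => [/andP[pa pp]|_]; last by case: ifP => // _; exact: sqr_ge0.
  rewrite pa pp /= ltnS (leq_trans _ aam) ?lexx //.
  by case/andP: pa => _ pa; rewrite ltnS in pa; exact: leq_mul.
have s2 : \sum_(0 <= p < m.+1 | prime p && (p * p < m.+1)%N) c p ^+ 2 <=
    \sum_(0 <= p < m.+1 | prime p) c p ^+ 2.
  by rewrite big_mkcondr; apply: ler_sum => p _; case: ifP => // _; exact: sqr_ge0.
have i1 : a%:R^-1 <= 2 * N%:R^-1 :> R.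
  rewrite ler_pdivlMr // mulrC ler_pdivrMr ?ltr0n // -natrM ler_nat //.
have i2 : m%:R^-1 <= 2 * N%:R^-1 :> R.
  by apply: le_trans i1; rewrite lef_pV2 ?posrE ?ltr0n // ler_nat.
have := tail a a0; have := tail m m0; rewrite !ler_norml => /andP[t1 t2] /andP[t3 t4].
apply/andP; split; lra.
Qed.

(** [t] will be ln ln x + D1. The sum of c_p over p <= m lies between the dyadic sums at N and N +
    1, so any [t] between ln N + kap and ln(N+1) + kap approximates it up to O(1/N). *)
Lemma omega2_equal_core : exists2 C : R, 0 <= C & forall (x t : R) (N : nat),
  let X := x `^ h%:R^-1 in let m := Num.truncn X in
  0 < x -> (0 < N)%N -> (2 ^ N <= m)%N -> (m < 2 ^ N.+1)%N ->
  ln N%:R + kap <= t -> t <= ln N.+1%:R + kap ->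
  `|hfull_omega2_sum h h x - gamma0 R h * X * (t + (t ^+ 2 - zeta 2 - T))| <= C * (X * E N).
Proof.
have [C1 C10 HO] := omega2_approx R h h0.
have [C2 C20 HU] := ub_sums R h.
have [C3 C30 HA] := dyadic_ln.
have c00 : dyadic_sum R c 0 = 0 := dyadic_sum0 R c.
have [C4 HD C40] : exists2 C4 : R, (forall N, (0 < N)%N ->
    `|\sum_(0 <= i < N) (dyadic_sum R c i.+1 - dyadic_sum R c i) * dyadic_sum R c (N - i.+1)%N
      - ((ln N%:R + kap) ^+ 2 - zeta 2)| <= C4 * E N) & 0 <= C4.
  have [C _ HC] := dyadic_cweight R h h0.
  have [D HD] := conv_asymp R (dyadic_sum R c) _ C c00
    (dyadic_sum_incr R c c_ge0) HC.
  exists D; first by move=> N N0; have := HD N N0; rewrite -mulrA.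
  have := HD 1%N isT; rewrite ln1 addr0 mulr1 divr1.
  by apply: le_trans.
have g0 : 0 <= gamma0 R h := le_trans ler01 (gamma0_ge1 R h h0).
set K := 3 + 2 * `|kap|.
have K0 : 0 <= K by rewrite addr_ge0 // mulr_ge0.
exists (gamma0 R h * (C3 + 1 + 3 * C4 + 2 * K + 2) + C1 * (6 * C2)).
  have q1 : 0 <= C3 + 1 + 3 * C4 + 2 * K + 2 by rewrite !addr_ge0 // mulr_ge0.
  have q2 : 0 <= 6 * C2 by rewrite mulr_ge0.
  by apply: addr_ge0; exact: mulr_ge0.
move=> x t N X m x0 N0 Nm mN t1 t2.
have NR : (0 : R) < N%:R by rewrite ltr0n.
have X0 : 0 < X by rewrite powR_gt0.
have [i0 iE] := E_ge N N0; set v := N%:R^-1 in i0 iE.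
have EN0 : 0 < E N by apply: lt_le_trans iE.
have L0 := @ln_nat_ge0 R N; set L := ln N%:R in L0 t1.
have /andP[m1 m2] := truncn_itv (ltW X0); rewrite -/m in m1 m2.
(* p^h <= x means p <= m, hence p^h q^h <= x means p q <= m: this is the restriction [Q] on
   pairs. *)
have Xm p : (p ^ h <= Num.truncn x)%N = (p < m.+1)%N.
  rewrite ltnS /m !truncn_ge_nat ?(ltW X0) ?(ltW x0) // natrX.
  apply/idP/idP => H.
    by rewrite -(rootKX R h p%:R) // ler_powRl ?invr_ge0 // exprn_ge0.
  by rewrite -(rootXK R h x h0 (ltW x0)) lerXn2r // nnegrE // ltW.
pose S := \sum_(0 <= p < m.+1 | prime p) c p.
pose PS := pair_sum R c m.+1.
pose Dg := \sum_(0 <= p < m.+1 | prime p && (p * p < m.+1)%N) c p ^+ 2.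
pose ub p : R := root_inv R h.+1 p ^+ h.
pose Er : R := \sum_(0 <= p < m.+1 | prime p) ub p + \sum_(0 <= p < m.+1 | prime p)
  \sum_(0 <= q < m.+1 | (prime q && (q != p)) && (p * q < m.+1)%N) ub p * ub q.
have ln1S : ln N.+1%:R <= L + v.
  by have := ln_shift_le R N 1 N0; rewrite addn1 div1r.
have ln2S : ln N.+2%:R <= L + 2 * v by have := ln_shift_le R N 2 N0; rewrite addn2.
have lnm1 : L <= ln N.+1%:R by rewrite ler_ln ?posrE ?ltr0n // ler_nat.
have lnm2 : ln N.+1%:R <= ln N.+2%:R :> R by rewrite ler_ln ?posrE ?ltr0n // ler_nat.
have subP (f : nat -> R) a b : (forall p, prime p -> 0 <= f p) -> (a <= b)%N ->
    \sum_(0 <= p < a | prime p) f p <= \sum_(0 <= p < b | prime p) f p.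
  by move=> f0 ab; rewrite [leRHS](@big_cat_nat _ _ _ a) //= lerDl sumr_ge0.
have S_close : `|S - t| <= (C3 + 1) * E N.
  have a1 : dyadic_sum R c N <= S by apply: subP => //; exact: leqW.
  have a2 : S <= dyadic_sum R c N.+1 by apply: subP.
  have := HA N N0; have := HA N.+1 isT; rewrite !ler_norml => /andP[_ b1] /andP[b2 _].
  have b3 : C3 / N.+1%:R <= C3 * v by rewrite ler_wpM2l // lef_pV2 ?posrE ?ltr0n // ler_nat.
  have b4 : C3 * v <= C3 * E N by rewrite ler_wpM2l.
  have {b1 b3} b1 := le_trans b1 b3.
  rewrite -/v -/L in b2.
  by apply/andP; split; lra.
have Dg_close : `|Dg - T| <= 2 * E N.
  by apply: (le_trans (diag_close N m Nm N0)); rewrite ler_wpM2l.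
have t_abs : `|t| <= L + v + `|kap|.
  have := ler_norm kap; have := ler_norm (- kap); rewrite normrN.
  move=> k1 k2; rewrite ler_norml.
  by apply/andP; split; lra.
have v1 : v <= 1 by rewrite invf_le1 // ler1n.
(* The range reaches ln(N+2) because the upper bound for [PS] is a convolution at N + 2: one step
   from m < 2^(N+1), one from [pair_sum_le_conv]. *)
have sqdiff u : ln N%:R + kap <= u -> u <= ln N.+2%:R + kap -> `|u ^+ 2 - t ^+ 2| <= 2 * K * E N.
  move=> u1 u2; rewrite -/L in u1; rewrite subr_sqr normrM.
  have d1 : `|u - t| <= 2 * v.
    rewrite ler_norml.
    by apply/andP; split; lra.
  have d2 : `|u + t| <= K * (1 + L).
    have := ler_norm kap; have := ler_norm (- kap); rewrite normrN => k1 k2.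
    have kL : 0 <= `|kap| * L by rewrite mulr_ge0.
    rewrite ler_norml /K.
    by apply/andP; split; lra.
  apply: (le_trans (ler_pM (normr_ge0 _) (normr_ge0 _) d1 d2)).
  by rewrite /E -/v -/L; lra.
have PS_close : `|PS - (t ^+ 2 - zeta 2)| <= (3 * C4 + 2 * K) * E N.
  have a1 : pair_sum R c (2 ^ N) <= PS by apply: pair_sum_mono => //; exact: leqW.
  have a2 : PS <= pair_sum R c (2 ^ N.+1) by apply: pair_sum_mono.
  have a3 := pair_sum_ge R c c_ge0 N; have a4 := pair_sum_le_conv R c c_ge0 N.+1.
  have := HD N N0; have := HD N.+2 isT; rewrite !ler_norml => /andP[_ b1] /andP[b2 _].
  have b3 : C4 * E N.+2 <= C4 * (3 * E N).
    rewrite ler_wpM2l // /E; apply: (@le_trans _ _ ((3 * (1 + L)) * v)); last by rewrite mulrA.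
    apply: ler_pM; [by rewrite addr_ge0 // ln_nat_ge0|by []| |].
      by lra.
    by rewrite lef_pV2 ?posrE ?ltr0n // ler_nat leqW.
  have := sqdiff (ln N%:R + kap) (lexx _) ltac:(by rewrite lerD2r (le_trans lnm1)).
  have := sqdiff (ln N.+2%:R + kap) ltac:(by rewrite lerD2r (le_trans lnm1)) (lexx _).
  rewrite !ler_norml => /andP[_ b4] /andP[b5 _].
  have b6 : 0 <= C4 * E N by rewrite mulr_ge0 // ltW. by apply/andP; split; lra.
have Er_close : x `^ h.+1%:R^-1 * Er <= 6 * C2 * (X * E N).
  set rho : R := 2 `^ h.+1%:R^-1.
  have ub0 p : prime p -> 0 <= root_inv R h.+1 p ^+ h.
    by move=> _; rewrite exprn_ge0 // root_inv_ge0.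
  have [u1 u2] := HU N.+1 isT.
  have u3 : Er <= C2 * (rho ^+ N.+1 / N.+1%:R) + C2 * (rho ^+ N.+1 * E N.+1).
    apply: lerD; first by apply: le_trans u1; apply: subP.
    apply: le_trans u2; apply: (le_trans (off_diag_le R _ m.+1)).
    exact: pair_sum_mono.
  have r2 : rho <= 2.
    by rewrite -[leRHS]powRr1 // ler_powR ?invf_le1 ?ler1n //; lra.
  have r0 : 0 < rho by rewrite powR_gt0.
  have rN : rho ^+ N <= X `^ h.+1%:R^-1.
    rewrite -natrX_powR ler_powRl ?invr_ge0 //.
    by apply: le_trans m1; rewrite ler_nat.
  have XX : x `^ h.+1%:R^-1 * X `^ h.+1%:R^-1 = X.
    rewrite /X -powRrM -powRD; last by rewrite (gt_eqF x0) implybT.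
    congr (_ `^ _); rewrite -natr1; have hR : (0 : R) < h%:R by rewrite ltr0n. by field; apply/andP; split; apply: lt0r_neq0; lra.
  have e1 : N.+1%:R^-1 <= E N.
    by apply: le_trans iE; rewrite lef_pV2 ?posrE ?ltr0n // ler_nat.
  have e2 : E N.+1 <= 2 * E N.
    rewrite /E mulrA; apply: ler_pM => //; [by rewrite addr_ge0 // ln_nat_ge0| |].
      by rewrite -/L; lra.
    by rewrite lef_pV2 ?posrE ?ltr0n // ler_nat.
  have rN0 : 0 < rho ^+ N by rewrite exprn_gt0.
  have u4 : Er <= C2 * (rho ^+ N * (6 * E N)).
    apply: (le_trans u3); rewrite -mulrDr ler_wpM2l // -mulrDr exprS -mulrA mulrCA.
    rewrite ler_wpM2l ?(ltW rN0) //; apply: (@le_trans _ _ (2 * (3 * E N))); last by lra.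
    apply: ler_pM => //; [exact: ltW| |by apply: (le_trans (lerD e1 e2)); lra].
    by rewrite addr_ge0 // /E divr_ge0 // addr_ge0 // ln_nat_ge0.
  apply: (le_trans (ler_wpM2l (powR_ge0 _ _) u4)).
  have : C2 * (6 * E N) * (x `^ h.+1%:R^-1 * rho ^+ N) <= C2 * (6 * E N) * X.
    have q : 0 <= C2 * (6 * E N).
      by apply: mulr_ge0 => //; apply: mulr_ge0 => //; exact: ltW.
    by rewrite -[X in _ <= _ * X]XX !ler_wpM2l ?powR_ge0.
  by lra.
have main_close : `|gamma0 R h * X * (S + (PS - Dg)) -
    gamma0 R h * X * (t + (t ^+ 2 - zeta 2 - T))| <=
    gamma0 R h * (C3 + 1 + 3 * C4 + 2 * K + 2) * (X * E N).
  rewrite -mulrBr normrM ger0_norm; last by rewrite mulr_ge0 // ltW.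
  have -> : S + (PS - Dg) - (t + (t ^+ 2 - zeta 2 - T)) =
    (S - t) + (PS - (t ^+ 2 - zeta 2)) - (Dg - T) by ring.
  have -> : gamma0 R h * (C3 + 1 + 3 * C4 + 2 * K + 2) * (X * E N) =
    gamma0 R h * X * ((C3 + 1 + 3 * C4 + 2 * K + 2) * E N) by ring.
  rewrite ler_wpM2l ?mulr_ge0 ?(ltW X0) //.
  move: S_close PS_close Dg_close; rewrite !ler_norml.
  move=> /andP[a1 a2] /andP[a3 a4] /andP[a5 a6].
  by apply/andP; split; lra.
have := HO h m.+1 (fun p q => (p * q < m.+1)%N) x (leqnn h) x0
  (fun p _ H => eq_ind _ is_true H _ (Xm p))
  (fun p q _ _ H => ltac:(by rewrite -expnMn ltnNge Xm)).
rewrite pair_sum_diag -/Er -/S -/PS -/Dg.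
set Y := hfull_omega2_sum _ _ _ => hY.
have er2 : C1 * x `^ h.+1%:R^-1 * Er <= C1 * (6 * C2) * (X * E N).
  by rewrite -!mulrA ler_wpM2l // [6 * _]mulrA.
rewrite mulrDl; set Z := gamma0 R h * X * (S + _) in hY main_close.
set W := gamma0 R h * X * _ in main_close *.
have -> : Y - W = (Y - Z) + (Z - W) by ring.
by apply: (le_trans (ler_normD _ _)); rewrite [leRHS]addrC; apply: lerD => //; exact: le_trans er2.
Qed.
End OmegaEqual.

(** N is the base 2 logarithm of m, so ln N is ln ln X - ln ln 2 up to O(1/N), and ln ln X = ln ln x
    - ln h. The ln ln 2 cancels against the one in [kap], and D1 remains. *)
Lemma omega2_equal (R : realType) (h : nat) : (0 < h)%N ->
  let D1 : R := mertens_B1 R - ln h%:R - Lh h (2 * h%:R) in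
  exists C x0 : R, forall x t, x0 <= x -> t = ln (ln x) + D1 ->
  `|hfull_omega2_sum h h x - gamma0 R h * x `^ h%:R^-1 *
     (t + (t ^+ 2 - zeta 2 - prime_sum (fun p => cweight R h h p ^+ 2)))|
  <= C * (x `^ h%:R^-1 * ln (ln x) / ln x).
Proof.
move=> h0 D1; have [C C0 H] := omega2_equal_core R h h0.
have hR : (1 : R) <= h%:R by rewrite ler1n.
(* 6 h is 3 times 2 h: 1 + ln N <= 3 ln ln x and 1/N <= 2 h / ln x. The threshold ensures ln ln x >=
   1 and X >= 2, hence N >= 1. *)
exists (C * (6 * h%:R)), (expR (expR 1) + 2 ^+ h) => x t xx0 tD.
have e0 : (0 : R) < 2 ^+ h by rewrite exprn_gt0.
have x0 : 0 < x by apply: lt_le_trans xx0; rewrite addr_gt0 // expR_gt0.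
have lx : expR 1 <= ln x.
  by rewrite -[leLHS]expRK ler_ln ?posrE ?expR_gt0 //; lra.
have lx0 : 0 < ln x by apply: lt_le_trans lx; exact: expR_gt0.
have L1 : 1 <= ln (ln x) by rewrite -[leLHS]expRK ler_ln ?posrE ?expR_gt0.
set X := x `^ h%:R^-1.
have X2 : 2 <= X.
  rewrite -(rootKX R h 2 h0) //; apply: ler_powRl; first by rewrite invr_ge0.
    exact: ltW.
  by have := expR_gt0 (expR (1 : R)); lra.
have X0 : 0 < X by lra.
set m := Num.truncn X; have m2 : (2 <= m)%N by rewrite truncn_ge_nat // ltW.
have m0 : (0 < m)%N by exact: leq_trans m2.
set N := trunc_log 2 m.
have N0 : (0 < N)%N by rewrite trunc_log_gt0.
have Nm : (2 ^ N <= m)%N by exact: trunc_logP.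
have mN : (m < 2 ^ N.+1)%N by exact: trunc_log_ltn.
have NR : (0 : R) < N%:R by rewrite ltr0n.
have /andP[m1 m3] := truncn_itv (ltW X0); rewrite -/m in m1 m3.
have /andP[la lb] := ln2_bounds R; have l20 : 0 < ln 2 :> R by lra.
have lX : ln X = ln x / h%:R by rewrite ln_powR mulrC.
have lX0 : 0 < ln X by rewrite ln_gt0 //; lra.
have lX1 : N%:R * ln 2 <= ln X.
  rewrite mulr_natl -lnXn // ler_ln ?posrE ?exprn_gt0 // -natrX.
  by apply: le_trans m1; rewrite ler_nat.
have lX2 : ln X <= N.+1%:R * ln 2.
  rewrite mulr_natl -lnXn // ler_ln ?posrE ?exprn_gt0 // -natrX.
  by apply: (le_trans (ltW m3)); rewrite ler_nat.
have llX : ln (ln X) = ln (ln x) - ln h%:R by rewrite lX ln_div // posrE; lra.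
have t1 : ln N%:R + ln (ln 2) <= ln (ln X).
  by rewrite -lnM ?posrE // ler_ln ?posrE ?mulr_gt0.
have t2 : ln (ln X) <= ln N.+1%:R + ln (ln 2).
  by rewrite -lnM ?posrE ?ltr0n // ler_ln ?posrE ?mulr_gt0 ?ltr0n.
have := H x t N x0 N0 Nm mN.
have tE : t = ln (ln X) - ln (ln 2) + (euler_gamma R + (ln (ln 2) +
    prime_sum (fun p => ln (1 - p%:R^-1) + p%:R^-1) - Lh h (2 * h%:R))).
  by rewrite llX tD /D1 /mertens_B1; lra.
have c1 : ln N%:R + (euler_gamma R + (ln (ln 2) +
    prime_sum (fun p => ln (1 - p%:R^-1) + p%:R^-1) - Lh h (2 * h%:R))) <= t.
  by rewrite tE lerD2r; lra.
have c2 : t <= ln N.+1%:R + (euler_gamma R + (ln (ln 2) +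
    prime_sum (fun p => ln (1 - p%:R^-1) + p%:R^-1) - Lh h (2 * h%:R))).
  by rewrite tE lerD2r; lra.
move=> /(_ c1 c2); rewrite -/X => /le_trans; apply.
rewrite -!mulrA ler_wpM2l //.
have -> : 6 * (h%:R * (X * (ln (ln x) * (ln x)^-1))) =
  X * ((3 * ln (ln x)) * (2 * h%:R * (ln x)^-1)) by lrai.
rewrite ler_wpM2l ?(ltW X0) //; apply: ler_pM.
- by rewrite addr_ge0 // ln_nat_ge0.
- by rewrite invr_ge0.
- have := ln_nat_ge0 R h; have := ln_ge_subV R (ln 2) l20.
  have : (ln 2)^-1 <= 2 :> R by rewrite -[leRHS]invrK lef_pV2 ?posrE ?invr_gt0.
  by lrai.
have s1 : ln x <= h%:R * N.+1%:R.
  move: lX2; rewrite lX ler_pdivrMr; last lra.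
  move/le_trans; apply; rewrite mulrC ler_wpM2l //.
  by rewrite ler_piMr.
rewrite -div1r ler_pdivrMr // mulrAC ler_pdivlMr // mul1r.
apply: (le_trans s1); have : (1 : R) <= N%:R by rewrite ler1n.
by rewrite -natr1 => n1; have := ler_wpM2l (ler0n R h) n1; lra.
Qed.

Theorem theorem1p4 (R : realType) (h : nat) (hh : (2 <= h)%N) :
  let D1 : R := mertens_B1 R - ln h%:R - Lh h (2 * h%:R) in
  let D2 : R :=
    D1 ^+ 2 + D1 - zeta 2
    - prime_sum (fun p =>
        ((p%:R `^ h%:R^-1 - 1)
         / (p%:R `^ (1 + h%:R^-1) - p%:R + p%:R `^ h%:R^-1)) ^+ 2) in
  [/\ hfull_omega2_sum h h
      = (fun x : R =>
           gamma0 R h * x `^ h%:R^-1 * ln (ln x) ^+ 2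
           + (2 * D1 + 1) * gamma0 R h * x `^ h%:R^-1 * ln (ln x)
           + D2 * gamma0 R h * x `^ h%:R^-1)
        +O_ (+oo) (fun x : R => x `^ h%:R^-1 * ln (ln x) / ln x),
      hfull_omega2_sum h h.+1
      = (fun x : R =>
           ((Lh h h.+1%:R - Lh h h.+2%:R) ^+ 2
            + Lh h h.+1%:R - Lh h h.+2%:R
            - prime_sum (fun p =>
                ((p%:R `^ h%:R^-1 - 1)
                 / (p%:R `^ (1 + 2 / h%:R) - p%:R `^ (1 + h%:R^-1)
                    + p%:R `^ (2 / h%:R))) ^+ 2))
           * gamma0 R h * x `^ h%:R^-1)
        +O_ (+oo) (fun x : R => x `^ h.+1%:R^-1 * ln (ln x) ^+ 2)
    & forall k : nat, (h.+1 < k)%N ->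
      hfull_omega2_sum h k
      = (fun x : R =>
           ((Lh h k%:R - Lh h k.+1%:R) ^+ 2
            + Lh h k%:R - Lh h k.+1%:R
            - prime_sum (fun p =>
                ((p%:R `^ h%:R^-1 - 1)
                 / (p%:R `^ (k.+1%:R / h%:R) - p%:R `^ (k%:R / h%:R)
                    + p%:R `^ ((k.+1%:R - h%:R) / h%:R))) ^+ 2))
           * gamma0 R h * x `^ h%:R^-1)
        +O_ (+oo) (fun x : R => x `^ h.+1%:R^-1)].
Proof.
move=> D1 D2; have h0 : (0 < h)%N by apply: leq_trans hh.
have hR : h%:R != 0 :> R by rewrite pnatr_eq0 -lt0n.
have pow1 (p : nat) : p%:R `^ (1 + h%:R^-1) = (p%:R `^ h%:R^-1) ^+ h.+1 :> R.
  by rewrite -powR_nat_div // -natr1 mulrDl mulfV // mul1r.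
split.
- have [C [x0 H]] := omega2_equal R h h0.
  apply: (bigO_pinfty_intro R _ _ _ `|C| x0) => x xx0.
  (* At k = h the exponents (k+1)/h, k/h and (k+1-h)/h of [cweight_formula] are 1 + 1/h, 1 and
     1/h. *)
  have TE : prime_sum (fun p => ((p%:R `^ h%:R^-1 - 1)
         / (p%:R `^ (1 + h%:R^-1) - p%:R + p%:R `^ h%:R^-1)) ^+ 2) =
      prime_sum (fun p => cweight R h h p ^+ 2).
    apply: eq_prime_sum => p pp; congr (_ ^+ 2).
    apply: (cweight_formula R h h0 h p) => //.
    by rewrite pow1 rootXK // subSnn expr1.
  rewrite -normrM; apply: le_trans (ler_norm _); apply: le_trans (H x _ xx0 erefl).
  (* Expanding t^2 + t at t = ln ln x + D1 yields the coefficients 1, 2 D1 + 1 and D1^2 + D1. *)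
  by rewrite le_eqVlt; apply/orP; left; apply/eqP; congr `| _ - _ |; rewrite /D2 TE /D1; ring.
- have [C C0 H] := omega2_succ R h h0.
  apply: (bigO_pinfty_intro R _ _ _ C (expR (expR 1))) => x xx0.
  have x0 : 0 < x by apply: lt_le_trans xx0; exact: expR_gt0.
  have lx : expR 1 <= ln x by rewrite -[leLHS]expRK ler_ln ?posrE ?expR_gt0.
  have L1 : 1 <= ln (ln x).
    by rewrite -[leLHS]expRK ler_ln ?posrE ?expR_gt0 // (lt_le_trans (expR_gt0 1)).
  have TE : prime_sum (fun p => ((p%:R `^ h%:R^-1 - 1)
         / (p%:R `^ (1 + 2 / h%:R) - p%:R `^ (1 + h%:R^-1) + p%:R `^ (2 / h%:R))) ^+ 2) =
      prime_sum (fun p => cweight R h h.+1 p ^+ 2).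
    apply: eq_prime_sum => p pp; congr (_ ^+ 2).
    apply: (cweight_formula R h h0 h.+1 p) => //; first lia.
    rewrite pow1 -[2 in LHS]/(2%:R); have -> : 1 + 2%:R / h%:R = h.+2%:R / h%:R :> R.
      by rewrite -[h.+2]addn2 (natrD _ h 2) [RHS]mulrDl (mulfV hR).
    by rewrite !powR_nat_div //; have -> : (h.+2 - h = 2)%N by lia.
  apply: (le_trans _ (ler_wpM2l C0 (ler_norm _))); apply: le_trans (H x L1).
  rewrite TE -(Lh_diff R h h0 h.+1 (ltnSn h)).
  by rewrite le_eqVlt; apply/orP; left; apply/eqP; congr `| _ - _ |; ring.
- move=> k hk; have [C C0 H] := omega2_large R h h0.
  apply: (bigO_pinfty_intro R _ _ _ C 1) => x x1.
  have x0 : 0 < x by lra.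
  have hk' : (h < k)%N by exact: ltnW.
  have TE : prime_sum (fun p => ((p%:R `^ h%:R^-1 - 1)
         / (p%:R `^ (k.+1%:R / h%:R) - p%:R `^ (k%:R / h%:R)
                    + p%:R `^ ((k.+1%:R - h%:R) / h%:R))) ^+ 2) =
      prime_sum (fun p => cweight R h k p ^+ 2).
    apply: eq_prime_sum => p pp; congr (_ ^+ 2).
    apply: (cweight_formula R h h0 k p) => //; first by apply: leqW; exact: ltnW.
    by rewrite -natrB; [rewrite !powR_nat_div|apply: leqW; exact: ltnW].
  apply: (le_trans _ (ler_wpM2l C0 (ler_norm _))); apply: le_trans (H k x hk x0).
  rewrite TE -(Lh_diff R h h0 k hk').
  by rewrite le_eqVlt; apply/orP; left; apply/eqP; congr `| _ - _ |; ring.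
Qed.
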